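(* Let $M$ be a unitarizable finite dimensional $\widehat{W}^Y$-module. For $\widehat{v}\in\widehat{V}^+$ and $\widehat{\lambda}\in\widehat{\mathfrak{h}}^+_{reg}$ the series $$E_M(\widehat{v};\widehat{\lambda}):=\sum_{y\in Y}e^{(t_y\widehat{\lambda},\widehat{v})}J_{t_y}(\widehat{\lambda}),\qquad E_M^+(\widehat{v};\widehat{\lambda}):=\sum_{w\in\widehat{W}^Y}e^{(w\widehat{\lambda},\widehat{v})}J_w(\widehat{\lambda})$$ converge in $\mathrm{End}_{\mathbb{C}}(M)$ and satisfy: (1) $E_M^+(\widehat{v};\widehat{\lambda})=\sum_{w\in W}E_M(\widehat{v};w\widehat{\lambda})J_w(\widehat{\lambda})$. (2) If $\widehat{\lambda}\in\widehat{\mathfrak{h}}_{\kappa,reg}$ with $\kappa\in\mathbb{C}_+$, then (a) $E_M(\cdot;\widehat{\lambda})\in C^\omega_\kappa(\widehat{V}^+)\otimes_{\mathbb{C}}\mathrm{End}_{\mathbb{C}}(M)$, and (b) $E_M^+(\cdot;\widehat{\lambda})\in\widehat{S}_{\mathrm{End}_{\mathbb{C}}(M)}\big(\kappa,(\widehat{\lambda},\widehat{\lambda})\big)^{\widehat{Q}(\widehat{W}^Y)}$. (3) If $\widehat{v}\in\widehat{V}_\xi$ with $\xi>0$, then $E_M(\widehat{v};\cdot)\in\mathrm{adKZ}_\xi$ and $E_M^+(\widehat{v};\cdot)\in\mathrm{adKZ}_\xi^{\cdot W}$.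
   Context: Root data. Let $\mathfrak{g}$ be a complex finite dimensional reductive Lie algebra with $\mathfrak{g}_s=[\mathfrak{g},\mathfrak{g}]$ simple, and $\mathfrak{h}=\mathfrak{h}_s\oplus Z(\mathfrak{g})$ with $\mathfrak{h}_s$ a Cartan subalgebra of $\mathfrak{g}_s$ and $Z(\mathfrak{g})$ the center. Let $R\subset\mathfrak{h}_s$ be the root system of $(\mathfrak{g}_s,\mathfrak{h}_s)$, where $\mathfrak{h}_s^*$ is identified with $\mathfrak{h}_s$ via the Killing form, and let $V_s$ be the real span of $R$, with scalar product the restriction of the Killing form. Fix a real form $V=V_s\oplus V'$ of $\mathfrak{h}$ with $V'$ a real form of $Z(\mathfrak{g})$, extend the scalar product of $V_s$ to a scalar product $(\cdot,\cdot)$ on $V$ with $V'\perp V_s$, and extend it complex bilinearly to $\mathfrak{h}$. Put $\widetilde{\mathfrak{h}}=\mathfrak{h}\oplus\mathbb{C}c$ and $\widehat{\mathfrak{h}}=\mathfrak{h}\oplus\mathbb{C}c\oplus\mathbb{C}d$, and extend $(\cdot,\cdot)$ to a symmetric bilinear form on $\widehat{\mathfrak{h}}$ by $(c,d)=1$, $(c,c)=(d,d)=(c,v)=(d,v)=0$ for $v\in\mathfrak{h}$. For $a\in\widehat{\mathfrak{h}}$ with $(a,a)\neq0$ put $a^\vee=2a/(a,a)$ and $s_a(\widehat{v})=\widehat{v}-(\widehat{v},a^\vee)a$. For $u\in\mathfrak{h}$ let $t_u\in\mathrm{GL}(\widehat{\mathfrak{h}})$ be $t_u(v+\eta c+\xi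 d)=v+\xi u+\big(\eta-\tfrac{\xi}{2}(u,u)-(v,u)\big)c+\xi d$ ($v\in\mathfrak{h}$, $\eta,\xi\in\mathbb{C}$). Let $Q$ and $Q^\vee$ be the root and co-root lattices, i.e. the $\mathbb{Z}$-spans of $R$ and of $\{\alpha^\vee\}_{\alpha\in R}$. Let $W$ be the Weyl group generated by $s_\alpha$ ($\alpha\in R$), acting on $\widehat{\mathfrak{h}}$ (fixing $c$ and $d$). Let $\widehat{R}=\{\alpha+mc:\alpha\in R,\ m\in\mathbb{Z}\}$, and let $\widehat{W}$ be the affine Weyl group generated by $s_a$ ($a\in\widehat{R}$); then $\widehat{W}=W\ltimes Q^\vee$, with $y\in Q^\vee$ acting as $t_y$. Fix positive roots $R^+$ with simple roots $F=\{a_1,\dots,a_n\}$ and highest root $\theta$; put $a_0=-\theta+c$ and $\widehat{F}=\{a_0,\dots,a_n\}$. Every element of $\widehat{R}$ is a nonnegative or a nonpositive integral combination of $\widehat{F}$; this defines $\widehat{R}^+$ and $\widehat{R}^-$. Fix a lattice $Y\subset V$ with $Q^\vee\subseteq Y$ and $(Y,Q)\subseteq\mathbb{Z}$; it is assumed that $Y$ spans $V$. The extended affine Weyl group is $\widehat{W}^Y=W\ltimes Y$, acting on $\widehat{\mathfrak{h}}$ with $y\in Y$ acting as $t_y$; it preserves $\widehat{R}$. Put $\Omega=\{\omega\in\widehat{W}^Y:\omega(\widehat{R}^+)\subseteq\widehat{R}^+\}$; $\widehat{W}^Y$ is generated by $\Omega$ and $s_a$ ($a\in\widehat{F}$). Fix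 a $\widehat{W}^Y$-invariant function $k:\widehat{R}\to\mathbb{C}$. Domains. $\mathbb{C}_+=\{z\in\mathbb{C}:\mathrm{Re}(z)>0\}$; $\widehat{\mathfrak{h}}_\kappa=\widetilde{\mathfrak{h}}+\kappa d$; $\widehat{\mathfrak{h}}_{reg}=\{\widehat{\lambda}\in\widehat{\mathfrak{h}}:(a^\vee,\widehat{\lambda})\neq0,k_a\ \forall a\in\widehat{R}\}$; $\widehat{\mathfrak{h}}_{\kappa,reg}=\widehat{\mathfrak{h}}_{reg}\cap\widehat{\mathfrak{h}}_\kappa$; $\widehat{\mathfrak{h}}^+_{reg}=\widehat{\mathfrak{h}}_{reg}\cap(\widetilde{\mathfrak{h}}+\mathbb{C}_+d)$, an open $\widehat{W}^Y$-stable subset of $\widehat{\mathfrak{h}}$. Also $\widehat{V}=V\oplus\mathbb{R}c\oplus\mathbb{R}d$, $\widehat{V}^+=V\oplus\mathbb{R}c\oplus\mathbb{R}_{>0}d$, $\widehat{V}_\xi=V\oplus\mathbb{R}c+\xi d$. Cocycle. $\{J_w\}_{w\in\widehat{W}^Y}$ is the unique family of $\mathbb{C}[\widehat{W}^Y]$-valued rational functions on $\widehat{\mathfrak{h}}$, regular on $\widehat{\mathfrak{h}}_{reg}$, with $J_{uw}(\widehat{\lambda})=J_u(w\widehat{\lambda})J_w(\widehat{\lambda})$ for $u,w\in\widehat{W}^Y$, $J_{s_a}(\widehat{\lambda})=\dfrac{(a^\vee,\widehat{\lambda})s_a+k_a}{(a^\vee,\widehat{\lambda})-k_a}$ for $a\in\widehat{F}$,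 and $J_\omega(\widehat{\lambda})=\omega$ for $\omega\in\Omega$ (its existence is a known result of Cherednik). For a $\widehat{W}^Y$-module $M$ with representation map $\pi_M$, $J_w(\widehat{\lambda})$ is regarded as an element of $\mathrm{End}_{\mathbb{C}}(M)$ via $\pi_M$. $M$ is unitarizable if it carries a $\widehat{W}^Y$-invariant Hermitian inner product. adKZ. $\mathcal{O}(\widehat{\mathfrak{h}}^+_{reg})$ is the ring of holomorphic functions on $\widehat{\mathfrak{h}}^+_{reg}$, and $\mathcal{O}_\xi(\widehat{\mathfrak{h}}^+_{reg})=\{f:\partial_cf=\xi f\}$, with $\partial_c$ the directional derivative in direction $c$. $\widehat{W}^Y$ acts from the right on $\mathrm{End}_{\mathbb{C}}(M)$-valued holomorphic functions by $(\Psi\cdot w)(\widehat{\lambda})=\Psi(w\widehat{\lambda})J_w(\widehat{\lambda})$; this preserves $\mathcal{O}_\xi(\widehat{\mathfrak{h}}^+_{reg})\otimes\mathrm{End}_{\mathbb{C}}(M)$. $\mathrm{adKZ}_\xi$ is the space of $\Psi\in\mathcal{O}_\xi(\widehat{\mathfrak{h}}^+_{reg})\otimes\mathrm{End}_{\mathbb{C}}(M)$ with $\Psi\cdot t_y=\Psi$ for all $y\in Y$ (the affine difference Knizhnik-Zamolodchikov equations), and $\mathrm{adKZ}_\xi^{\cdot W}$ is its subspace of elements with $\Psi\cdot w=\Psi$ for all $w\in W$. Integral-reflection action. $C^\omega(\widehat{V}^+)$ is the space of complex valued real analytic functions on $\widehat{V}^+$, and $C^\omega_\kappa(\widehat{V}^+)=\{f\in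 C^\omega(\widehat{V}^+):\partial_cf=\kappa f\}$. For a finite dimensional $\widehat{W}^Y$-module $N$, $\widehat{W}^Y$ acts on $C^\omega(\widehat{V}^+)\otimes N$ by the representation $\widehat{Q}$ determined by $\widehat{Q}(s_a)=s_a\otimes\pi_N(s_a)-k_aI(a)\otimes\mathrm{Id}_N$ ($a\in\widehat{F}$) and $\widehat{Q}(\omega)=\omega\otimes\pi_N(\omega)$ ($\omega\in\Omega$), where $(wf)(\widehat{v})=f(w^{-1}\widehat{v})$ and $(I(a)f)(\widehat{v})=\int_0^{(a,\widehat{v})}f(\widehat{v}-ta^\vee)\,dt$. Let $\widehat{\Delta}=\Delta+2\partial_c\partial_d$ with $\Delta$ the Laplacian on $V$. For $\gamma,\Gamma\in\mathbb{C}$, $\widehat{S}_N(\gamma,\Gamma)=\{f\in C^\omega(\widehat{V}^+):\partial_cf=\gamma f,\ \widehat{\Delta}f=\Gamma f\}\otimes_{\mathbb{C}}N$, which is $\widehat{Q}(\widehat{W}^Y)$-stable; the superscript $\widehat{Q}(\widehat{W}^Y)$ denotes the invariants. $\mathrm{End}_{\mathbb{C}}(M)$ is a $\widehat{W}^Y$-module via $w\cdot\psi=\pi_M(w)\circ\psi$. *)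

(* Defs.v *)
From HB Require Import structures.
From mathcomp Require Import all_boot all_order all_algebra.
From mathcomp Require Import finmap.
From mathcomp Require Import all_classical all_reals all_analysis.
From mathcomp Require Import complex.
From mathcomp Require mpoly.
From mathcomp Require showcase.summability.
Set Implicit Arguments.
Unset Strict Implicit.
Unset Printing Implicit Defensive.
Import Order.TTheory GRing.Theory Num.Theory numFieldNormedType.Exports.
Local Open Scope classical_set_scope.
Local Open Scope ring_scope.
Local Open Scope sesquilinear_scope.

(* The topology of R[i] is the one of its norm, as for any numFieldType. *)
HB.instance Definition _ (R : rcfType) := NormedModule.copy R[i] (R[i]^o).

Definition toC (R : realType) (x : R) : R[i] := (x%:C)%C.

Definition cexp (R : realType) (z : R[i]) : R[i] :=
  toC (expR (complex.Re z)) * (cos (complex.Im z) +i* sin (complex.Im z))%C.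

(* The partial sums over the finite subsets of A, ordered by inclusion.  As
   neither a lattice nor an infinite group comes with an ordering, a series
   indexed by A converges when this net does; for values in a finite
   dimensional space this is absolute convergence. *)
Definition upartial (I : choiceType) (V : zmodType) (A : set I) (f : I -> V)
  (S : {fset I}) : V := \sum_(i <- S | i \in A) f i.

Definition usummable (I : choiceType) (K : numDomainType) (V : normedModType K)
    (A : set I) (f : I -> V) : Prop :=
  cvg (upartial A f @ summability.totally).

Definition usum (I : choiceType) (K : numDomainType) (V : normedModType K)
    (A : set I) (f : I -> V) : V :=
  lim (upartial A f @ summability.totally).

(* V is R^r through an orthonormal basis for its scalar product, so that
   h = C^r with the complex bilinear extension of that scalar product.
   The triple (v, eta, xi) stands for v + eta c + xi d. *)
Notation hat K r := ('cV[K]_r * K * K)%type.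
Notation hatmap R r := (hat R[i] r -> hat R[i] r).

Section HatSpace.
Context {K : numFieldType} {r : nat}.
Implicit Types (u v : 'cV[K]_r) (a x y : hat K r).

Definition dotv u v : K := \sum_(i < r) u i 0 * v i 0.

Definition hform x y : K := dotv x.1.1 y.1.1 + x.1.2 * y.2 + x.2 * y.1.2.

Definition hcoroot a : hat K r := (2 / hform a a) *: a.

Definition hrefl a x : hat K r := x - hform x (hcoroot a) *: a.

Definition htrans u x : hat K r :=
  (x.1.1 + x.2 *: u, x.1.2 - x.2 / 2 * dotv u u - dotv x.1.1 u, x.2).

Definition chat : hat K r := (0, 1, 0).
Definition dhat : hat K r := (0, 0, 1).
Definition vhat v : hat K r := (v, 0, 0).

Definition hcoord x (i : 'I_(r + 2)) : K :=
  match fintype.split i with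
  | inl j => x.1.1 j 0
  | inr j => if j == 0 then x.1.2 else x.2
  end.

Definition coroot v : 'cV[K]_r := (2 / dotv v v) *: v.

End HatSpace.

Section RealForm.
Context {R : realType} {r : nat}.

Definition vecC (v : 'cV[R]_r) : 'cV[R[i]]_r := map_mx (@toC R) v.

Definition hatC (x : hat R r) : hat R[i] r :=
  (vecC x.1.1, toC x.1.2, toC x.2).

Definition hatRe (x : hat R[i] r) : hat R r :=
  (map_mx (@complex.Re R) x.1.1, complex.Re x.1.2, complex.Re x.2).

Definition Vplus : set (hat R r) := [set v | 0 < v.2].

End RealForm.

Definition Zspan (R : realType) (r : nat) (A : set 'cV[R]_r) : set 'cV[R]_r :=
  [set v | exists (l : nat) (u : 'I_l -> 'cV[R]_r) (z : 'I_l -> int),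
     (forall i, A (u i)) /\ v = \sum_(i < l) u i *~ z i].

Definition Rspan (R : realType) (r : nat) (A : set 'cV[R]_r) : set 'cV[R]_r :=
  [set v | exists (l : nat) (u : 'I_l -> 'cV[R]_r) (z : 'I_l -> R),
     (forall i, A (u i)) /\ v = \sum_(i < l) z i *: u i].

(* The reductive Lie algebra enters through its root system in the Euclidean
   space V: reduced and crystallographic, irreducible since [g, g] is simple.
   V_s is the span of Phi and V' its orthogonal complement in V.  Under the
   identification of h_s with its dual, the Killing form
   tr (ad x \o ad y) is the sum over the roots g of (x, g) (g, y), root spaces
   being one dimensional: rs_killing says that the scalar product restricts to
   the Killing form on V_s. *)
Record root_system (R : realType) (r : nat) (Phi : set 'cV[R]_r) : Prop := {
  rs_finite : finite_set Phi;
  rs_nonempty : Phi !=set0;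
  rs_nonzero : ~ Phi 0;
  rs_refl : forall a b, Phi a -> Phi b -> Phi (b - dotv b (coroot a) *: a);
  rs_integral : forall a b, Phi a -> Phi b -> dotv b (coroot a) \is a Num.int;
  rs_reduced : forall a (t : R), Phi a -> Phi (t *: a) -> t = 1 \/ t = -1;
  rs_irreducible : forall A : set 'cV[R]_r, A `<=` Phi -> A !=set0 ->
    (Phi `\` A) !=set0 ->
    exists a b, [/\ A a, (Phi `\` A) b & dotv a b != 0];
  rs_killing : forall a b, Phi a -> Phi b ->
    dotv a b = \sum_(g \in Phi) dotv a g * dotv g b
}.

Record simple_roots (R : realType) (r n : nat) (Phi : set 'cV[R]_r)
    (F : 'I_n -> 'cV[R]_r) : Prop := {
  sr_root : forall i, Phi (F i);
  sr_free : free [seq F i | i <- enum 'I_n];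
  sr_span : forall a, Phi a -> exists c : 'I_n -> nat,
    a = \sum_(i < n) F i *+ c i \/ a = - \sum_(i < n) F i *+ c i
}.

Definition highest_root (R : realType) (r n : nat) (Phi : set 'cV[R]_r)
    (F : 'I_n -> 'cV[R]_r) (theta : 'cV[R]_r) : Prop :=
  Phi theta /\ forall a, Phi a -> exists c : 'I_n -> nat,
    theta - a = \sum_(i < n) F i *+ c i.

Definition is_lattice (R : realType) (r : nat) (Y : set 'cV[R]_r) : Prop :=
  exists b : seq 'cV[R]_r, free b /\ Y = Zspan [set` b].

Record affine_datum (R : realType) (r : nat) := AffineDatum {
  Phi : set 'cV[R]_r;
  rank : nat;
  simple : 'I_rank -> 'cV[R]_r;
  theta : 'cV[R]_r;
  Y : set 'cV[R]_r;
  Phi_root_system : root_system Phi;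
  simpleP : simple_roots Phi simple;
  thetaP : highest_root Phi simple theta;
  Y_lattice : is_lattice Y;
  Y_coroot : Zspan (coroot @` Phi) `<=` Y;
  Y_integral : forall y q, Y y -> Zspan Phi q -> dotv y q \is a Num.int;
  Y_span : Rspan Y = setT
}.
Arguments simple {R r} _ _.

Section AffineRoots.
Context {R : realType} {r : nat} (D : affine_datum R r).

Definition Rhat : set (hat R r) :=
  [set a | exists (al : 'cV[R]_r) (m : int),
     Phi D al /\ a = vhat al + m%:~R *: chat].

Definition a0 : hat R r := - vhat (theta D) + chat.

Definition Fhat : set (hat R r) :=
  [set a | a = a0 \/ exists i, a = vhat (simple D i)].

Definition Rhat_pos : set (hat R r) :=
  [set a | Rhat a /\ exists (c0 : nat) (c : 'I_(rank D) -> nat),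
     a = a0 *+ c0 + \sum_(i < rank D) vhat (simple D i) *+ c i].

(* The groups are realized as groups of self-maps of hat R[i] r. *)
Definition sC (a : hat R r) : hatmap R r := hrefl (hatC a).

Definition tC (y : 'cV[R]_r) : hatmap R r := htrans (vecC y).

(* Reflections being involutions, the group is generated as a monoid. *)
Inductive in_weyl : hatmap R r -> Prop :=
| weyl_id : in_weyl id
| weyl_refl al w : Phi D al -> in_weyl w -> in_weyl (sC (vhat al) \o w).

Definition weyl : set (hatmap R r) := [set w | in_weyl w].

Definition weylY : set (hatmap R r) :=
  [set g | exists y w, [/\ Y D y, weyl w & g = tC y \o w]].

Definition Omega : set (hatmap R r) :=
  [set o | weylY o /\ forall a, Rhat_pos a ->
     exists2 b, Rhat_pos b & o (hatC a) = hatC b].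

Definition weylY_invariant (k : hat R r -> R[i]) : Prop :=
  forall w a b, weylY w -> Rhat a -> Rhat b -> w (hatC a) = hatC b -> k b = k a.

(* (a^vee, lambda) *)
Definition cpair (a : hat R r) (lambda : hat R[i] r) : R[i] :=
  hform (hatC (hcoroot a)) lambda.

Definition hreg (k : hat R r -> R[i]) : set (hat R[i] r) :=
  [set lambda | forall a, Rhat a ->
     cpair a lambda != 0 /\ cpair a lambda != k a].

Definition hreg_kappa (k : hat R r -> R[i]) (kappa : R[i]) :
    set (hat R[i] r) := [set lambda | hreg k lambda /\ lambda.2 = kappa].

Definition hreg_plus (k : hat R r -> R[i]) : set (hat R[i] r) :=
  [set lambda | hreg k lambda /\ 0 < complex.Re lambda.2].

End AffineRoots.

(* An element of the group algebra is its family of coefficients. *)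
Definition galg (R : realType) (r : nat) :=
  hatmap R r -> R[i].

Section Cocycle.
Context {R : realType} {r : nat} (D : affine_datum R r).
Variable k : hat R r -> R[i].
Implicit Types (u w : hatmap R r) (lambda : hat R[i] r).

Definition gelt w : galg R r := fun u => (u == w)%:R.

Definition gmul (f g : galg R r) : galg R r := fun w =>
  \sum_(p \in [set p : hatmap R r * hatmap R r | p.1 \o p.2 = w]) f p.1 * g p.2.

Definition rational_regular_on (U : set (hat R[i] r))
    (f : hat R[i] r -> R[i]) : Prop :=
  exists p q : mpoly.mpoly (r + 2) R[i], forall lambda, U lambda ->
    mpoly.meval (hcoord lambda) q != 0 /\
    f lambda = mpoly.meval (hcoord lambda) p / mpoly.meval (hcoord lambda) q.

Record is_cocycle
    (J : hatmap R r -> hat R[i] r -> galg R r) : Prop := {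
  J_supp : forall w, weylY D w -> exists2 S, finite_set S /\ S `<=` weylY D &
    forall lambda u, hreg D k lambda -> ~ S u -> J w lambda u = 0;
  J_rational : forall w u, weylY D w -> weylY D u ->
    rational_regular_on (hreg D k) (fun lambda => J w lambda u);
  J_mul : forall u w lambda, weylY D u -> weylY D w -> hreg D k lambda ->
    J (u \o w) lambda = gmul (J u (w lambda)) (J w lambda);
  J_refl : forall a lambda, Fhat D a -> hreg D k lambda ->
    J (sC a) lambda = fun u =>
      (cpair a lambda * gelt (sC a) u + k a * gelt id u)
      / (cpair a lambda - k a);
  J_omega : forall o lambda, Omega D o -> hreg D k lambda ->
    J o lambda = gelt o
}.

End Cocycle.

(* A finite dimensional module is C^m, with matrices acting on columns;
   End(M) is then the algebra of m x m matrices. *)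
Section Modules.
Context {R : realType} {r m : nat} (D : affine_datum R r).
Variable pi : hatmap R r -> 'M[R[i]]_m.

Definition is_module : Prop :=
  pi id = 1%:M /\
  forall u w, weylY D u -> weylY D w -> pi (u \o w) = pi u *m pi w.

Definition unitarizable : Prop :=
  exists H : 'M[R[i]]_m,
    [/\ H ^t* = H,
        forall x : 'cV[R[i]]_m, x != 0 -> 0 < (x ^t* *m H *m x) 0 0 &
        forall w, weylY D w -> (pi w) ^t* *m H *m pi w = H].

Definition galg_End (f : galg R r) : 'M[R[i]]_m :=
  \sum_(u \in weylY D) f u *: pi u.

End Modules.

(* For a space P of scalar functions, P tensored with End(C^m). *)
Definition tensor_End (R : realType) (X : Type) (m : nat)
    (P : (X -> R[i]) -> Prop) (F : X -> 'M[R[i]]_m) : Prop :=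
  forall i j, P (fun x => F x i j).

Section AdKZ.
Context {R : realType} {r m : nat} (D : affine_datum R r).
Variables (k : hat R r -> R[i])
  (pi : hatmap R r -> 'M[R[i]]_m)
  (J : hatmap R r -> hat R[i] r -> galg R r).

Definition holomorphic_on (U : set (hat R[i] r)) (f : hat R[i] r -> R[i]) :
    Prop := forall lambda, U lambda -> differentiable f lambda.

Definition O_xi (xi : R[i]) (f : hat R[i] r -> R[i]) : Prop :=
  holomorphic_on (hreg_plus D k) f /\
  forall lambda, hreg_plus D k lambda -> 'D_chat f lambda = xi * f lambda.

Definition JM (w : hatmap R r) (lambda : hat R[i] r) :
    'M[R[i]]_m := galg_End D pi (J w lambda).

Definition ract (Psi : hat R[i] r -> 'M[R[i]]_m)
    (w : hatmap R r) (lambda : hat R[i] r) : 'M[R[i]]_m :=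
  Psi (w lambda) *m JM w lambda.

Definition adKZ (xi : R[i]) (Psi : hat R[i] r -> 'M[R[i]]_m) : Prop :=
  tensor_End (O_xi xi) Psi /\
  forall y lambda, Y D y -> hreg_plus D k lambda ->
    ract Psi (tC y) lambda = Psi lambda.

Definition adKZ_weyl (xi : R[i]) (Psi : hat R[i] r -> 'M[R[i]]_m) : Prop :=
  adKZ xi Psi /\
  forall w lambda, weyl D w -> hreg_plus D k lambda ->
    ract Psi w lambda = Psi lambda.

End AdKZ.

Section RealAnalytic.
Context {R : realType} {r : nat}.
Implicit Types (f : hat R r -> R[i]) (x h u : hat R r).

Definition monomial h (nu : {ffun 'I_(r + 2) -> nat}) : R :=
  \prod_(i < r + 2) hcoord h i ^+ nu i.

Definition analytic_at f x : Prop :=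
  exists (rho : R) (c : {ffun 'I_(r + 2) -> nat} -> R[i]), 0 < rho /\
    forall h, `|h| < rho ->
      upartial setT (fun nu => c nu * toC (monomial h nu))
        @ summability.totally --> f (x + h).

Definition Comega f : Prop := forall x, Vplus x -> analytic_at f x.

Definition dirder u f x : R[i] :=
  ('D_u (fun z => complex.Re (f z)) x +i* 'D_u (fun z => complex.Im (f z)) x)%C.

Definition hatLaplacian f x : R[i] :=
  \sum_(i < r) dirder (vhat (delta_mx i 0)) (dirder (vhat (delta_mx i 0)) f) x
  + 2 * dirder chat (dirder dhat f) x.

Definition Comega_kappa (kappa : R[i]) f : Prop :=
  Comega f /\ forall x, Vplus x -> dirder chat f x = kappa * f x.

Definition Shat (gam Gam : R[i]) f : Prop :=
  Comega_kappa gam f /\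
  forall x, Vplus x -> hatLaplacian f x = Gam * f x.

End RealAnalytic.

(* The oriented integral from 0 to b. *)
Definition int0 (R : realType) (g : R -> R) (b : R) : R :=
  if 0 <= b then \int[@lebesgue_measure R]_(t in `[0, b]) g t
  else - \int[@lebesgue_measure R]_(t in `[b, 0]) g t.

Definition cint0 (R : realType) (g : R -> R[i]) (b : R) : R[i] :=
  (int0 (fun t => complex.Re (g t)) b +i* int0 (fun t => complex.Im (g t)) b)%C.

Section IntegralReflection.
Context {R : realType} {r m : nat} (D : affine_datum R r).
Variables (k : hat R r -> R[i])
  (pi : hatmap R r -> 'M[R[i]]_m).
Implicit Types (a v : hat R r) (f : hat R r -> 'M[R[i]]_m).

Definition Iint a f v : 'M[R[i]]_m :=
  \matrix_(i, j) cint0 (fun t => f (v - t *: hcoroot a) i j) (hform a v).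

(* Elements of weylY preserve the real form. *)
Definition Q_refl a f v : 'M[R[i]]_m :=
  pi (sC a) *m f (hrefl a v) - k a *: Iint a f v.

(* o' stands for the inverse of o. *)
Definition Q_omega (o o' : hatmap R r) f v : 'M[R[i]]_m :=
  pi o *m f (hatRe (o' (hatC v))).

(* Qhat w A : the operator A is the action of w on End(M)-valued functions,
   w acting on End(M) by left multiplication with pi w. *)
Inductive Qhat : hatmap R r ->
    ((hat R r -> 'M[R[i]]_m) -> hat R r -> 'M[R[i]]_m) -> Prop :=
| Qhat_id : Qhat id id
| Qhat_refl a w A : Fhat D a -> Qhat w A -> Qhat (sC a \o w) (Q_refl a \o A)
| Qhat_omega o o' w A : Omega D o -> cancel o o' -> cancel o' o ->
    Qhat w A -> Qhat (o \o w) (Q_omega o o' \o A).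

Definition Qhat_invariant f : Prop :=
  forall w A, Qhat w A -> forall v, Vplus v -> A f v = f v.

Definition Shat_invariants (gam Gam : R[i]) f : Prop :=
  tensor_End (Shat gam Gam) f /\ Qhat_invariant f.

End IntegralReflection.

Section Series.
Context {R : realType} {r m : nat} (D : affine_datum R r).
Variables (pi : hatmap R r -> 'M[R[i]]_m)
  (J : hatmap R r -> hat R[i] r -> galg R r).

Definition E_term (v : hat R r) (lambda : hat R[i] r)
    (w : hatmap R r) : 'M[R[i]]_m :=
  cexp (hform (w lambda) (hatC v)) *: JM D pi J w lambda.

Definition E_M_summable v lambda : Prop :=
  usummable (Y D) (fun y => E_term v lambda (tC y)).

Definition E_M v lambda : 'M[R[i]]_m :=
  usum (Y D) (fun y => E_term v lambda (tC y)).

Definition E_Mplus_summable v lambda : Prop :=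
  usummable (weylY D) (E_term v lambda).

Definition E_Mplus v lambda : 'M[R[i]]_m :=
  usum (weylY D) (E_term v lambda).

End Series.

(* Main.v *)
(* A cocycle matrix of a generator at a point of the orbit of lambda is [pi s + k /
(z - k) (pi s + 1)] with [z = (b^vee, lambda)] for an affine root [b = alpha + m c],
and [z - k] stays away from 0 and grows linearly in [m]; so it is bounded, together
with its first two derivatives in lambda, uniformly over the orbit. Since [t_y] is a
product of O(|y|) lattice generators, the cocycle property gives [J_{t_y} =
O(e^(beta |y|))], which the Gaussian decay of [e^(t_y lambda, v)] beats. In v the
sums are series of exponentials of linear forms, hence analytic and differentiable
termwise; in lambda they are sums of functions whose second order expansions have
summable constants, hence holomorphic. The difference equations and the Weyl
invariance are reindexings of the sums. For the invariance under [Q(s_a)] let [T_w]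
be the summand of w and [z_w = (a^vee, w lambda)]; then [Q(s_a) T_w = ((z_w - k) /
z_w) T_(s_a w) - (k / z_w) T_w], and [z_(s_a w) = - z_w] makes the sum over w
collapse to the sum of the [T_w]. *)

From HB Require Import structures.
From mathcomp Require Import all_boot all_order all_algebra.
From mathcomp Require Import finmap.
From mathcomp Require Import all_classical all_reals all_analysis.
From mathcomp Require Import complex ring lra zify.
From mathcomp Require showcase.summability.
Require Import Defs.
Set Implicit Arguments.
Unset Strict Implicit.
Unset Printing Implicit Defensive.
Import Order.TTheory GRing.Theory Num.Theory numFieldNormedType.Exports.
Local Open Scope classical_set_scope.
Local Open Scope ring_scope.

(** * The modulus on R[i] and unconditional sums *)

(** The bound on [z - k] rests on a parity fact. Translating by a coroot shifts [m] by 2, so by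
    invariance [k] takes at most two values on the affine roots over a given root, and [z - k] runs
    inside two arithmetic progressions whose step is a nonzero multiple of [lambda.2]. The
    differential of [z] also grows linearly in [m]; only its size relative to [z - k] is uniform,
    whence the relative form of the estimates. Uniformity over the orbit is then automatic: pulling
    back by a group element permutes the affine roots and keeps [k]. The Gaussian comes from the
    c-coordinate of [t_y lambda], quadratic in y, paired with the positive d-coordinate of v. As t_y
    lambda itself has size of order |y|^2, Taylor bounds for the exponential have constants growing
    like exp(epsilon |y|^2); radii independent of y are chosen so small that these cost only half of
    the Gaussian exponent. Quadratic remainders are used in both variables because they add over a
    series and multiply along a word of generators. *)

Section Modulus.
Context {R : realType}.
Implicit Types z w : R[i].

Definition cabs z : R := complex.Re `|z|.

Lemma cabsE z : `|z| = toC (cabs z).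
Proof. by rewrite /cabs /toC normc_def. Qed.

Lemma ler_toC (x y : R) : (toC x <= toC y) = (x <= y).
Proof. exact: lecR. Qed.

Lemma ltr_toC (x y : R) : (toC x < toC y) = (x < y).
Proof. exact: ltcR. Qed.

Lemma toC_inj : injective (@toC R).
Proof. exact: complexI. Qed.

Lemma toCD (x y : R) : toC (x + y) = toC x + toC y.
Proof. exact: rmorphD. Qed.

Lemma toCN (x : R) : toC (- x) = - toC x.
Proof. exact: rmorphN. Qed.

Lemma toCB (x y : R) : toC (x - y) = toC x - toC y.
Proof. exact: rmorphB. Qed.

Lemma toCM (x y : R) : toC (x * y) = toC x * toC y.
Proof. exact: rmorphM. Qed.

Lemma toCV (x : R) : toC x^-1 = (toC x)^-1.
Proof. exact: (fmorphV (real_complex R)). Qed.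

Lemma toC0 : toC 0 = 0 :> R[i]. Proof. by []. Qed.

Lemma toC1 : toC 1 = 1 :> R[i]. Proof. by []. Qed.

Lemma toCX (x : R) n : toC (x ^+ n) = toC x ^+ n.
Proof. exact: (rmorphXn (real_complex R)). Qed.

Lemma toC_sum (I : Type) (s : seq I) (P : pred I) (F : I -> R) :
  toC (\sum_(i <- s | P i) F i) = \sum_(i <- s | P i) toC (F i).
Proof. exact: (rmorph_sum (real_complex R)). Qed.

Lemma toC_int (m : int) : toC m%:~R = m%:~R :> R[i].
Proof. exact: (rmorph_int (real_complex R)). Qed.

Lemma cabs_ge0 z : 0 <= cabs z.
Proof. by rewrite -ler_toC -cabsE normr_ge0. Qed.

Lemma cabsD z w : cabs (z + w) <= cabs z + cabs w.
Proof. by rewrite -ler_toC toCD -!cabsE ler_normD. Qed.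

Lemma cabsM z w : cabs (z * w) = cabs z * cabs w.
Proof. by apply: toC_inj; rewrite toCM -!cabsE normrM. Qed.

Lemma cabsN z : cabs (- z) = cabs z.
Proof. by rewrite /cabs normrN. Qed.

Lemma cabsC z w : cabs (z - w) = cabs (w - z).
Proof. by rewrite -cabsN opprB. Qed.

Lemma cabs0 : cabs 0 = 0.
Proof. by rewrite /cabs normr0. Qed.

Lemma cabs1 : cabs 1 = 1.
Proof. by rewrite /cabs normr1. Qed.

Lemma cabs_eq0 z : (cabs z == 0) = (z == 0).
Proof. by rewrite -(inj_eq toC_inj) -cabsE normr_eq0. Qed.

Lemma cabs_gt0 z : (0 < cabs z) = (z != 0).
Proof. by rewrite lt_def cabs_ge0 andbT cabs_eq0. Qed.

Lemma cabsV z : cabs z^-1 = (cabs z)^-1.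
Proof. by apply: toC_inj; rewrite toCV -!cabsE normfV. Qed.

Lemma cabsX z n : cabs (z ^+ n) = cabs z ^+ n.
Proof. by elim: n => [|n IH]; rewrite ?expr0 ?cabs1// !exprS cabsM IH. Qed.

Lemma cabs_toC (x : R) : cabs (toC x) = `|x|.
Proof.
by rewrite /cabs /toC normc_def /= expr0n addr0 sqrtr_sqr.
Qed.

Lemma cabs_sqr z : cabs z ^+ 2 = complex.Re z ^+ 2 + complex.Im z ^+ 2.
Proof. by rewrite /cabs normc_def /= sqr_sqrtr// addr_ge0// sqr_ge0. Qed.

Lemma Re_le_cabs z : `|complex.Re z| <= cabs z.
Proof.
rewrite -(@ler_pXn2r _ 2)// ?nnegrE// ?cabs_ge0// cabs_sqr real_normK ?num_real//.
by rewrite lerDl sqr_ge0.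
Qed.

Lemma Im_le_cabs z : `|complex.Im z| <= cabs z.
Proof.
rewrite -(@ler_pXn2r _ 2)// ?nnegrE// ?cabs_ge0// cabs_sqr real_normK ?num_real//.
by rewrite lerDr sqr_ge0.
Qed.

Lemma cabs_sum (I : Type) (s : seq I) (P : pred I) (F : I -> R[i]) :
  cabs (\sum_(i <- s | P i) F i) <= \sum_(i <- s | P i) cabs (F i).
Proof.
elim/big_rec2: _ => [|i y x _ h]; first by rewrite cabs0.
by apply: le_trans (cabsD _ _) _; rewrite lerD2l.
Qed.

Lemma cabs_prod (I : Type) (s : seq I) (P : pred I) (F : I -> R[i]) :
  cabs (\prod_(i <- s | P i) F i) = \prod_(i <- s | P i) cabs (F i).
Proof.
by elim/big_rec2: _ => [|i y x _ h]; rewrite ?cabs1// cabsM h.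
Qed.

Lemma cabs_triangle z w u : cabs (z - w) <= cabs (z - u) + cabs (u - w).
Proof. by apply: le_trans (cabsD _ _); rewrite addrA subrK. Qed.

Lemma complex_split z : z = toC (complex.Re z) + 'i%C * toC (complex.Im z).
Proof. by case: z => a b; rewrite /toC; simpc. Qed.

End Modulus.

Section UnconditionalSums.
Context {R : realType}.

(** Convergence of the net [upartial] along [totally], in epsilon form with a real epsilon:
    estimates then live in the ordered field [R], while the norm of [R[i]] takes values in
    [R[i]]. *)
Definition hasS (I : choiceType) (A : set I) (f : I -> R[i]) (l : R[i]) :=
  forall e : R, 0 < e -> exists S0 : {fset I}, forall S : {fset I},
    (S0 `<=` S)%fset -> cabs (upartial A f S - l) < e.

(** Applied to nonnegative [g], where bounded finite sums amount to summability; comparison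
    arguments then need not name a limit. *)
Definition absS (I : choiceType) (A : set I) (g : I -> R) :=
  exists M, forall S : {fset I}, \sum_(i <- S | i \in A) g i <= M.

(** The value is arbitrary when no limit exists; it acquires meaning through [csumE] and
    [absS_csum]. *)
Definition csum (I : choiceType) (A : set I) (f : I -> R[i]) : R[i] :=
  get (hasS A f).

Lemma ler_sum_fsubset (I : choiceType) (A : pred I) (g : I -> R)
    (S S' : {fset I}) :
  (forall i, A i -> 0 <= g i) -> (S `<=` S')%fset ->
  \sum_(i <- S | A i) g i <= \sum_(i <- S' | A i) g i.
Proof.
move=> g0 sub; rewrite [leLHS]big_mkcond [leRHS]big_mkcond /=.
rewrite [leRHS](big_fsetID _ (mem S)) /=.
rewrite (_ : [fset x in S' | x \in S]%fset = S); last first.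
  apply/fsetP => x; rewrite !inE /= andbC.
  by case: (boolP (x \in S)) => //= /(fsubsetP sub).
rewrite lerDl; apply: sumr_ge0 => i _; case: ifP => // /g0; exact.
Qed.

Section One.
Variables (I : choiceType) (A : set I).
Implicit Types (f : I -> R[i]) (g : I -> R) (S : {fset I}).

Lemma hasS_uniq f l l' : hasS A f l -> hasS A f l' -> l = l'.
Proof.
move=> h h'; apply/eqP; rewrite -subr_eq0 -cabs_eq0 eq_le cabs_ge0 andbT.
apply/ler_addgt0Pr => e e0.
rewrite add0r; have e2 : 0 < e / 2 by rewrite divr_gt0.
have [S0 hS] := h _ e2; have [S1 hS'] := h' _ e2.
have := hS _ (fsubsetUl S0 S1); have := hS' _ (fsubsetUr S0 S1).
set u := upartial _ _ _ => h1 h2.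
apply: le_trans (cabs_triangle l l' u) _; rewrite [e]splitr lerD//; last exact: ltW.
by rewrite cabsC ltW.
Qed.

Lemma csumE f l : hasS A f l -> csum A f = l.
Proof.
move=> h; have : exists l, hasS A f l by exists l.
by move=> /getPex h'; exact: hasS_uniq h' h.
Qed.

Lemma hasS_ext f f' l : (forall i, A i -> f i = f' i) -> hasS A f l -> hasS A f' l.
Proof.
move=> e h eps /h[S0 hS]; exists S0 => S /hS; rewrite /upartial.
by under eq_bigr => i /set_mem /e -> do [].
Qed.

Lemma csum_ext f f' : (forall i, A i -> f i = f' i) -> csum A f = csum A f'.
Proof.
move=> e; rewrite /csum; congr (get _); apply/funext => l; apply/propext.
by split; apply: hasS_ext => // i /e.
Qed.

Lemma hasSD f f' l l' : hasS A f l -> hasS A f' l' ->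
  hasS A (fun i => f i + f' i) (l + l').
Proof.
move=> h h' e e0; have e2 : 0 < e / 2 by rewrite divr_gt0.
have [S0 hS] := h _ e2; have [S1 hS'] := h' _ e2.
exists (S0 `|` S1)%fset => S; rewrite fsubUset => /andP[/hS a /hS' b].
rewrite /upartial big_split/= opprD addrACA.
by apply: le_lt_trans (cabsD _ _) _; rewrite [e]splitr ltrD.
Qed.

Lemma hasSZ f l c : hasS A f l -> hasS A (fun i => c * f i) (c * l).
Proof.
move=> h e e0; have c0 : 0 < cabs c + 1 by rewrite ltr_wpDl// cabs_ge0.
have [|S0 hS] := h (e / (cabs c + 1)); first by rewrite divr_gt0.
exists S0 => S /hS; rewrite /upartial -mulr_sumr -mulrBr cabsM.
rewrite ltr_pdivlMr// mulrC => /le_lt_trans; apply.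
by rewrite ler_wpM2r ?cabs_ge0// lerDl.
Qed.

Lemma hasSZr f l c : hasS A f l -> hasS A (fun i => f i * c) (l * c).
Proof.
by move=> /(hasSZ c); rewrite mulrC; apply: hasS_ext => i _; rewrite mulrC.
Qed.

Lemma hasSB f f' l l' : hasS A f l -> hasS A f' l' ->
  hasS A (fun i => f i - f' i) (l - l').
Proof.
move=> h /(hasSZ (-1)) h'; rewrite -mulN1r; apply: hasS_ext (hasSD h h') => i _.
by rewrite mulN1r.
Qed.

Lemma hasS0 : hasS A (fun=> 0) 0.
Proof.
by move=> e e0; exists fset0 => S _; rewrite /upartial big1// subrr cabs0.
Qed.

Lemma hasS_sum (J : Type) (s : seq J) (f : J -> I -> R[i]) (l : J -> R[i]) :
  (forall j, hasS A (f j) (l j)) ->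
  hasS A (fun i => \sum_(j <- s) f j i) (\sum_(j <- s) l j).
Proof.
move=> h; elim: s => [|j s IH].
  by rewrite big_nil; apply: hasS_ext hasS0 => i _; rewrite big_nil.
rewrite big_cons; apply: hasS_ext (hasSD (h j) IH) => i _.
by rewrite big_cons.
Qed.

Lemma hasS_le f l M : hasS A f l ->
  (forall S, \sum_(i <- S | i \in A) cabs (f i) <= M) -> cabs l <= M.
Proof.
move=> h hM; apply/ler_addgt0Pr => e /h[S0 /(_ _ (fsubset_refl _)) hS].
rewrite -[l](subrK (upartial A f S0)) addrC.
apply: le_trans (cabsD _ _) _; apply: lerD; last by rewrite cabsC ltW.
by apply: le_trans (hM S0); exact: cabs_sum.
Qed.

Lemma absS_le g g' : (forall i, A i -> g i <= g' i) -> absS A g' -> absS A g.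
Proof.
move=> gg [M hM]; exists M => S; apply: le_trans (hM S).
by apply: ler_sum => i /set_mem /gg.
Qed.

Lemma absSZ g c : 0 <= c -> absS A g -> absS A (fun i => c * g i).
Proof.
move=> c0 [M hM]; exists (c * M) => S; rewrite -mulr_sumr ler_wpM2l//.
Qed.

Lemma absSD g g' : absS A g -> absS A g' -> absS A (fun i => g i + g' i).
Proof.
move=> [M hM] [M' hM']; exists (M + M') => S; rewrite big_split/= lerD//.
Qed.

(** The limit is the supremum of the finite sums: they increase with the finite set, so one set
    close to the supremum controls all larger ones. *)
Lemma absS_ge0_hasS g : (forall i, A i -> 0 <= g i) -> absS A g ->
  exists l, hasS A (fun i => toC (g i)) l.
Proof.
move=> g0 [M hM]; pose E := [set x | exists S, x = \sum_(i <- S | i \in A) g i].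
have supE : has_sup E.
  split; first by exists (\sum_(i <- fset0 | i \in A) g i); exists fset0.
  by exists M => _ [S ->].
exists (toC (sup E)) => e e0.
have [_ [S0 ->] hS] := sup_adherent e0 supE.
exists S0 => S sub.
have -> : upartial A (fun i => toC (g i)) S = toC (\sum_(i <- S | i \in A) g i).
  by rewrite toC_sum.
rewrite -toCB cabs_toC distrC ger0_norm; last first.
  by rewrite subr_ge0; apply: (ub_le_sup supE.2); exists S.
rewrite ltrBlDl -ltrBlDr; apply: lt_le_trans hS _.
by apply: ler_sum_fsubset => // i /set_mem /g0.
Qed.

Lemma absS_real_hasS g : absS A (fun i => `|g i|) ->
  exists l, hasS A (fun i => toC (g i)) l.
Proof.
move=> h.
(* [g] is the difference of the nonnegative families [|g| + g] and [|g|], the first being at most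
   twice the second. *)
have [a ha] : exists l, hasS A (fun i => toC (`|g i| + g i)) l.
  apply: absS_ge0_hasS => [i _|]; first by rewrite -lerBlDr sub0r ler_normr lexx orbT.
  apply: absS_le (absSD h h) => i _; rewrite lerD2l; exact: ler_norm.
have [b hb] : exists l, hasS A (fun i => toC `|g i|) l.
  exact: absS_ge0_hasS.
exists (a - b); apply: hasS_ext (hasSB ha hb) => i _.
by rewrite -toCB addrC addKr.
Qed.

Lemma absS_ex f : absS A (fun i => cabs (f i)) -> exists l, hasS A f l.
Proof.
move=> h.
have [a ha] : exists l, hasS A (fun i => toC (complex.Re (f i))) l.
  by apply: absS_real_hasS; apply: absS_le h => i _; exact: Re_le_cabs.
have [b hb] : exists l, hasS A (fun i => toC (complex.Im (f i))) l.
  by apply: absS_real_hasS; apply: absS_le h => i _; exact: Im_le_cabs.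
exists (a + 'i%C * b); apply: hasS_ext (hasSD ha (hasSZ 'i%C hb)) => i _.
by rewrite -complex_split.
Qed.

Lemma absS_csum f : absS A (fun i => cabs (f i)) -> hasS A f (csum A f).
Proof. by move=> /absS_ex[l h]; rewrite (csumE h). Qed.

Lemma hasS_seq f l (S : nat -> {fset I}) :
  hasS A f l ->
  (forall S0 : {fset I}, exists N, forall n, (N <= n)%N -> (S0 `<=` S n)%fset) ->
  forall e, 0 < e -> exists N, forall n, (N <= n)%N ->
    cabs (upartial A f (S n) - l) < e.
Proof.
move=> h hS e /h[S0 hS0]; have [N hN] := hS S0.
by exists N => n /hN /hS0.
Qed.

End One.

Section Two.
Variables (I J : choiceType) (A : set I) (B : set J).

Lemma upartial_imfset (V : zmodType) (phi : I -> J) (f : J -> V) (S : {fset I}) :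
  set_inj A phi -> (forall i, A i -> B (phi i)) ->
  upartial B f (phi @` [fset i in S | i \in A])%fset = upartial A (f \o phi) S.
Proof.
move=> inj sub; rewrite /upartial [LHS]big_mkcond big_imfset/=; last first.
  move=> x y; rewrite !inE /= => /andP[_ hx] /andP[_ hy].
  exact: inj.
rewrite [RHS]big_fset_condE /= big_seq [RHS]big_seq; apply: eq_bigr => i.
rewrite !inE /= => /andP[_ hi]; rewrite ifT//; apply/mem_set/sub/set_mem.
exact: hi.
Qed.

Lemma upartial_setI (V : zmodType) (f : J -> V) (S : {fset J}) :
  upartial B f [fset i in S | i \in B]%fset = upartial B f S.
Proof.
rewrite /upartial [RHS]big_fset_condE /=.
by rewrite big_fset_condE /=; congr (\sum_(i <- enum_fset _) _); apply/fsetP => x; rewrite !inE /= -andbA andbb.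
Qed.

(** Lifts a finite set on which a sum is tested from the target of a surjection to its source. *)
Lemma fset_section (phi : I -> J) (S : {fset J}) : set_surj A B phi ->
  exists2 T : {fset I}, forall i, i \in T -> A i &
    {subset [fset j in S | j \in B]%fset <= (phi @` T)%fset}.
Proof.
move=> surj; elim/finSet_rect: S => S IH.
have [->|[j hj]] := fset_0Vmem S.
  by exists fset0 => [i|j]; rewrite !inE.
have [T TA hT] := IH (S `\ j)%fset (fproperD1 hj).
have [/surj[i Ai ij]|nB] := pselect (B j).
  exists (i |` T)%fset => [i'|j']; rewrite !inE.
    by move=> /orP[/eqP ->|/TA].
  move=> /= /andP[jS jB]; apply/imfsetP => /=; have [e|ne] := eqVneq j' j.
    by exists i; rewrite ?inE ?eqxx// e.
  have /imfsetP[i' /= iT e'] : j' \in (phi @` T)%fset.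
    by apply: hT; rewrite !inE/= ne jS.
  by exists i'; rewrite // !inE iT orbT.
exists T => // j'; rewrite !inE /= => /andP[jS jB]; apply: hT.
rewrite !inE /= jS jB !andbT; apply/eqP => e; apply: nB.
by rewrite -e; exact: set_mem.
Qed.

Lemma hasS_reindex (phi : I -> J) (f : J -> R[i]) l :
  set_bij A B phi -> hasS B f l -> hasS A (f \o phi) l.
Proof.
move=> [sub inj surj] h e /h[S0 hS0].
have [T TA hT] := fset_section S0 surj.
exists T => S sub0; rewrite -(upartial_imfset f S inj)//.
(* [T'] need not contain [S0]. Adding [S0] is harmless: its elements in [B] already lie in [T'], and
   the others do not count. *)
set T' := (phi @` _)%fset; have := hS0 (S0 `|` T')%fset (fsubsetUl _ _).
suff -> : upartial B f (S0 `|` T')%fset = upartial B f T' by [].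
rewrite -[LHS]upartial_setI -[RHS]upartial_setI.
congr (upartial B f _); apply/fsetP => j; rewrite !inE /=.
have [hB|] := boolP (j \in B); rewrite ?andbF// !andbT.
case: (boolP (j \in T')) => [_|hT']; first by rewrite orbT.
rewrite orbF; apply/negbTE/negP => hj; move/negP: hT'; apply.
have /imfsetP[i /= iT ->] : j \in (phi @` T)%fset by apply: hT; rewrite !inE /= hj.
apply: in_imfset => /=; rewrite !inE /= (fsubsetP sub0)//=.
by rewrite mem_set//; exact: TA.
Qed.

Lemma absS_image (phi : I -> J) (g : J -> R) :
  (forall j, 0 <= g j) -> set_bij A B phi -> absS A (g \o phi) -> absS B g.
Proof.
move=> g0 [sub inj surj] [M hM]; exists M => S.
have [T TA hT] := fset_section S surj.
apply: le_trans (hM T); have := upartial_imfset g T inj.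
rewrite /upartial => <-; last by move=> i Ai; exact: sub.
rewrite big_fset_condE /= [leRHS]big_fset_condE/=.
have := @ler_sum_fsubset _ xpredT g; apply => //.
apply/fsubsetP => j hj; rewrite !inE /=.
have := hT j hj; move: hj; rewrite !inE /= => /andP[_ ->] /imfsetP[i /= iT ->].
by rewrite andbT; apply: in_imfset; rewrite /= !inE iT /= mem_set//; exact: TA.
Qed.

Lemma big_fsetM (V : nmodType) (S : {fset I}) (T : {fset J}) (F : I * J -> V) :
  \sum_(p <- (S `*` T)%fset) F p = \sum_(i <- S) \sum_(j <- T) F (i, j).
Proof.
rewrite -big_allpairs; apply: perm_big; apply: uniq_perm => //.
  by apply: allpairs_uniq => // -[? ?] [? ?].
move=> [i j]; rewrite in_fsetM /=; apply/andP/allpairsP => [[iS jT]|[[i' j'] /= [? ? [-> ->]]]//].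
by exists (i, j).
Qed.

Lemma upartial_fsetM (V : zmodType) (S : {fset I}) (T : {fset J}) (F : I * J -> V) :
  upartial (A `*` B) F (S `*` T)%fset =
  upartial A (fun i => upartial B (fun j => F (i, j)) T) S.
Proof.
rewrite /upartial big_mkcond big_fsetM /= [RHS]big_mkcond/=; apply: eq_bigr => i _.
case: ifPn => [/set_mem hA|/negP hA].
  rewrite [RHS]big_mkcond/=; apply: eq_bigr => j _; congr (if _ then _ else _).
  by apply/idP/idP => /set_mem h; apply/mem_set => //=; case: h.
by rewrite big1// => j _; case: ifP => // /set_mem[/= /mem_set].
Qed.

Lemma fset_subM (S : {fset I * J}) :
  (S `<=` (fst @` S) `*` (snd @` S))%fset.
Proof.
by apply/fsubsetP => -[i j] h; rewrite in_fsetM /=; apply/andP; split;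
  apply/imfsetP; exists (i, j).
Qed.

(** For finitely many rows one finite set of columns serves all of them at once, and the resulting
    rectangle tests the double sum as soon as it contains the given finite set of pairs. *)
Lemma hasS_iterated (F : I * J -> R[i]) (s : I -> R[i]) T :
  hasS (A `*` B) F T ->
  (forall i, A i -> hasS B (fun j => F (i, j)) (s i)) -> hasS A s T.
Proof.
move=> h hs e e0; have e2 : 0 < e / 2 by rewrite divr_gt0.
have [S0 hS0] := h _ e2; exists (fst @` S0)%fset => S subS.
(* The error [e / 2] is shared among the rows of [S]; the [+ 1] covers an empty [S]. *)
pose d := e / 2 / (#|` S|%:R + 1); have d0 : 0 < d.
  by rewrite divr_gt0// ltr_wpDl.
have /choice[Q hQ] : forall i, exists Q : {fset J}, forall Q', (Q `<=` Q')%fset ->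
    A i -> cabs (upartial B (fun j => F (i, j)) Q' - s i) < d.
  move=> i; have [Ai|nA] := pselect (A i); last by exists fset0.
  by have [Q hQ] := hs i Ai _ d0; exists Q => Q' /hQ.
pose T0 := ((snd @` S0) `|` \bigcup_(i <- S) Q i)%fset.
have hS : cabs (upartial (A `*` B) F (S `*` T0)%fset - T) < e / 2.
  apply: hS0; apply: fsubset_trans (fset_subM S0) _; apply/fsubsetP => p.
  rewrite !in_fsetM => /andP[/(fsubsetP subS) -> /=].
  by apply/fsubsetP; exact: fsubsetUl.
apply: le_lt_trans (cabs_triangle _ _ (upartial (A `*` B) F (S `*` T0)%fset)) _.
rewrite [e]splitr; apply: ler_ltD => //.
rewrite upartial_fsetM cabsC /upartial -sumrB; apply: le_trans (cabs_sum _ _ _) _.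
apply: le_trans (_ : \sum_(i <- S) d <= _).
  rewrite [leLHS]big_mkcond /= [leLHS]big_seq [leRHS]big_seq; apply: ler_sum => i iS.
  case: ifP => [/set_mem Ai|_]; last exact: ltW.
  apply/ltW/hQ => //; apply/fsubsetP => j hj; rewrite !inE; apply/orP; right.
  by apply/bigfcupP; exists i; rewrite ?iS.
rewrite big_const_seq count_predT iter_addr_0 -[leLHS]mulr_natr /d mulrAC.
by rewrite ler_pdivrMr ?ltr_wpDl// ler_wpM2l ?(ltW e2)// lerDl.
Qed.

Lemma absS_iterated (g : I * J -> R) (b : I -> R) :
  (forall p, 0 <= g p) ->
  (forall i (S : {fset J}), A i -> \sum_(j <- S | j \in B) g (i, j) <= b i) ->
  absS A b -> absS (A `*` B) g.
Proof.
move=> g0 gb [M hM]; exists M => S.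
apply: le_trans (ler_sum_fsubset _ (fset_subM S)) _ => //.
have := upartial_fsetM (fst @` S)%fset (snd @` S)%fset g; rewrite /upartial => ->.
by apply: le_trans (hM _); apply: ler_sum => i /set_mem; exact: gb.
Qed.

End Two.

(** Summable row bounds make the family absolutely summable over the product, so both iterated sums
    agree with the double one. This permits expanding every exponential of a series into its Taylor
    series and collecting coefficients. *)
Lemma hasS_fubini (I J : choiceType) (A : set I) (B : set J) (F : I -> J -> R[i])
    (b : I -> R) (s : I -> R[i]) T :
  (forall i (S : {fset J}), A i -> \sum_(j <- S | j \in B) cabs (F i j) <= b i) ->
  absS A b ->
  (forall i, A i -> hasS B (F i) (s i)) -> hasS A s T ->
  hasS B (fun j => csum A (F^~ j)) T.
Proof.
move=> Fb hb hs hT.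
have abs : absS (A `*` B) (fun p => cabs (F p.1 p.2)).
  by apply: (absS_iterated (b := b)) => // p; exact: cabs_ge0.
have [T' hT'] := absS_ex abs.
have : hasS A s T' by apply: hasS_iterated hT' _ => i /hs.
move=> /(hasS_uniq hT) e; rewrite -e in hT'.
pose sw (p : J * I) := (p.2, p.1).
have bij : set_bij (B `*` A) (A `*` B) sw.
  split => [[j i] [/= ? ?]|[j i] [j' i'] _ _ [-> ->]|[i j] [/= ? ?]]//.
  by exists (j, i).
apply: hasS_iterated (hasS_reindex bij hT') _ => j Bj /=.
apply: absS_csum; apply: absS_le hb => i Ai.
have := Fb i [fset j]%fset Ai; rewrite big_mkcond big_seq_fset1 ifT//.
exact: mem_set.
Qed.

End UnconditionalSums.

(** * From nets of finite sums to limits in the normed spaces *)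

Section Topological.
Context {R : realType}.

Lemma hasS_cvg_mx (I : choiceType) (A : set I) m n (f : I -> 'M[R[i]]_(m, n)) (L : 'M[R[i]]_(m, n)) :
  (forall i j, hasS A (fun x => f x i j) (L i j)) ->
  upartial A f @ summability.totally --> L.
Proof.
move=> h.
have FF := @summability.totally_filter I.
apply/cvgrPdist_lt => eps eps0.
(* A positive element of [R[i]] is real, so [eps] is the image of a positive real. *)
have [e e0 he] : exists2 e : R, 0 < e & toC e = eps.
  exists (complex.Re eps); first by move: eps0; rewrite ltcE => /andP[].
  by apply: RRe_real; rewrite gtr0_real.
have /choice[S0 hS0] : forall p : 'I_m * 'I_n, exists S0 : {fset I}, forall S, (S0 `<=` S)%fset ->
    cabs (upartial A (fun x => f x p.1 p.2) S - L p.1 p.2) < e.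
  by move=> p; exact: h.
exists (\bigcup_(p <- enum {: 'I_m * 'I_n}) S0 p)%fset => //= S sub.
have entry p : `|(L - upartial A f S) p.1 p.2| < toC e.
  have -> : (L - upartial A f S) p.1 p.2 = L p.1 p.2 - upartial A (fun x => f x p.1 p.2) S.
    by rewrite !mxE /upartial summxE.
  rewrite cabsE ltr_toC cabsC; apply: hS0; apply: fsubset_trans sub.
  by apply/fsubsetP => x hx; apply/bigfcupP; exists p; rewrite ?mem_enum.
rewrite -he; have [/eqP|/mx_norm_neq0[p]] := eqVneq (mx_norm (L - upartial A f S)) 0.
  by rewrite /Num.norm /= => /eqP ->; rewrite -toC0 ltr_toC.
by rewrite /Num.norm /= => ->; exact: entry.
Qed.

End Topological.

(** * The complex exponential *)

Section ScalarCvg.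
Context {R : realType}.

Lemma hasS_cvg (I : choiceType) (A : set I) (f : I -> R[i]) (l : R[i]) :
  hasS A f l -> upartial A f @ summability.totally --> l.
Proof.
move=> h; have FF := @summability.totally_filter I.
apply/cvgrPdist_lt => eps eps0.
have re : toC (complex.Re eps) = eps by apply: RRe_real; rewrite gtr0_real.
have [|S0 hS0] := h (complex.Re eps); first by rewrite -ltr_toC re.
exists S0 => //= S /hS0 hS; rewrite -re cabsE ltr_toC cabsC; exact: hS.
Qed.

Lemma upartialT (I : choiceType) (V : zmodType) (f : I -> V) (S : {fset I}) :
  upartial setT f S = \sum_(i <- S) f i.
Proof. by apply: eq_bigl => i; rewrite in_setT. Qed.

Definition limC (u : nat -> R[i]) (l : R[i]) :=
  forall e : R, 0 < e -> exists N, forall n, (N <= n)%N -> cabs (u n - l) < e.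

Lemma limC_uniq u l l' : limC u l -> limC u l' -> l = l'.
Proof.
move=> h h'; apply/eqP; rewrite -subr_eq0 -cabs_eq0 eq_le cabs_ge0 andbT.
apply/ler_addgt0Pr => e e0; rewrite add0r; have e2 : 0 < e / 2 by rewrite divr_gt0.
have [N hN] := h _ e2; have [N' hN'] := h' _ e2.
apply: le_trans (cabs_triangle l l' (u (N + N')%N)) _; rewrite [e]splitr lerD//.
  by rewrite cabsC ltW// hN// leq_addr.
by rewrite ltW// hN'// leq_addl.
Qed.

Lemma limC_ReIm (a b : nat -> R) (x y : R) : a @ \oo --> x -> b @ \oo --> y ->
  limC (fun n => (a n +i* b n)%C) (x +i* y)%C.
Proof.
move=> /cvgrPdist_lt ha /cvgrPdist_lt hb e e0; have e2 : 0 < e / 2 by rewrite divr_gt0.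
have [N _ hN] := ha _ e2; have [N' _ hN'] := hb _ e2.
exists (N + N')%N => n hn.
rewrite [X in cabs X]complex_split; apply: le_lt_trans (cabsD _ _) _.
rewrite cabsM !cabs_toC [e]splitr /=.
have -> : cabs ('i%C : R[i]) = 1.
  by rewrite /cabs normc_def /= expr0n expr1n add0r sqrtr1.
rewrite mul1r ltrD// distrC; [apply: hN|apply: hN'] => /=; apply: leq_trans hn.
  exact: leq_addr.
exact: leq_addl.
Qed.

Lemma hasS_limC (I : choiceType) (A : set I) (f : I -> R[i]) l (S : nat -> {fset I}) :
  hasS A f l ->
  (forall i, exists N, forall n, (N <= n)%N -> i \in S n) ->
  limC (fun n => upartial A f (S n)) l.
Proof.
move=> h hS; apply: hasS_seq h _ => S0.
have /choice[N hN] : forall i, exists N, forall n, (N <= n)%N -> i \in S n by [].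
exists (\max_(i <- S0) N i)%N => n hn; apply/fsubsetP => i iS0.
apply: hN; apply: leq_trans hn; exact: leq_bigmax_seq.
Qed.

Definition fiota n : {fset nat} := [fset i in iota 0 n]%fset.

Lemma in_fiota n i : (i \in fiota n) = (i < n)%N.
Proof. by rewrite !inE mem_iota. Qed.

Lemma sum_fiota (V : nmodType) n (f : nat -> V) :
  \sum_(i <- fiota n) f i = \sum_(i < n) f i.
Proof.
rewrite -(big_mkord xpredT f) /index_iota subn0; apply: perm_big.
apply: uniq_perm; rewrite ?iota_uniq// => i; by rewrite !inE.
Qed.

Lemma limC_series (f : nat -> R[i]) l :
  hasS setT f l -> limC (fun n => \sum_(i < n) f i) l.
Proof.
move=> h e e0; have [|N hN] := @hasS_limC _ _ _ _ fiota h _ e e0.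
  by move=> i; exists i.+1 => n hn; rewrite in_fiota.
by exists N => n /hN; rewrite upartialT sum_fiota.
Qed.

End ScalarCvg.

Section ComplexExponential.
Context {R : realType}.
Implicit Types z w : R[i].

Definition expterm z n : R[i] := z ^+ n / n`!%:R.

Lemma natC n : toC n%:R = n%:R :> R[i].
Proof. by rewrite /toC rmorph_nat. Qed.

Lemma cabs_expterm z n : cabs (expterm z n) = cabs z ^+ n / n`!%:R.
Proof. by rewrite /expterm cabsM cabsV cabsX -natC cabs_toC normr_nat. Qed.

Lemma sum_exp_le (x : R) (S : {fset nat}) : 0 <= x ->
  \sum_(n <- S) x ^+ n / n`!%:R <= expR x.
Proof.
move=> x0; pose N := (\max_(i <- S) i).+1.
apply: le_trans (_ : \sum_(n <- fiota N) x ^+ n / n`!%:R <= _).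
  apply: (@ler_sum_fsubset _ _ xpredT) => [i _|].
    by rewrite divr_ge0// exprn_ge0.
  by apply/fsubsetP => i iS; rewrite in_fiota ltnS; exact: (leq_bigmax_seq (F := id)).
rewrite sum_fiota -(big_mkord xpredT (fun n => x ^+ n / n`!%:R)).
apply: (nondecreasing_cvgn_le (u_ := series (exp_coeff x)) _ (is_cvg_series_exp_coeff x) N).
by apply: nondecreasing_series => n _; rewrite /exp_coeff/= divr_ge0// exprn_ge0.
Qed.

Lemma sum_expterm_le z (S : {fset nat}) :
  \sum_(n <- S | n \in [set: nat]) cabs (expterm z n) <= expR (cabs z).
Proof.
rewrite (eq_bigl xpredT); last by move=> i; rewrite in_setT.
by under eq_bigr do rewrite cabs_expterm; exact: sum_exp_le (cabs_ge0 z).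
Qed.

(** [cexp] is defined through [expR], [cos] and [sin]; its identification with this series ([cexpE])
    is what gives it Taylor expansions and the addition formula. *)
Definition expC z := csum setT (expterm z).

Lemma hasS_expC z : hasS setT (expterm z) (expC z).
Proof. by apply: absS_csum; exists (expR (cabs z)); exact: sum_expterm_le. Qed.

Lemma expC_real (x : R) : expC (toC x) = toC (expR x).
Proof.
apply: limC_uniq (limC_series (hasS_expC _)) _.
have := limC_ReIm (is_cvg_series_exp_coeff x) (cvg_cst (0 : R)).
rewrite /toC -/(expR x) => h e /h[N hN]; exists N => n /hN.
congr (cabs _ < _); congr (_ - _).
rewrite -[LHS]/(toC _) /series /= big_mkord toC_sum; apply: eq_bigr => i _.
by rewrite /exp_coeff /expterm /= toCM toCV toCX natC.
Qed.

Lemma expC_im (y : R) : expC ('i%C * toC y) = (cos y +i* sin y)%C.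
Proof.
apply: limC_uniq (limC_series (hasS_expC _)) _.
have := limC_ReIm (@is_cvg_series_cos_coeff R y) (@is_cvg_series_sin_coeff R y).
have -> : cos y = limn (series (cos_coeff y)) by rewrite cos.unlock.
have -> : sin y = limn (series (sin_coeff y)) by rewrite sin.unlock.
move=> h e /h[N hN]; exists N => n /hN.
congr (cabs _ < _); congr (_ - _).
rewrite [LHS]complex_split /= /series /= !big_mkord !toC_sum mulr_sumr -big_split /=.
apply: eq_bigr => i _; rewrite cos_coeffE sin_coeffE /expterm exprMn.
rewrite !toCM !toCV !toCX !natC toCN toC1.
have i2 : ('i%C : R[i]) ^+ 2 = -1 by rewrite sqr_i.
(* Even powers of the imaginary unit feed the cosine series, odd ones the sine series. *)
have [k [->|->]] : exists k : nat, i = k.*2 :> nat \/ i = k.*2.+1 :> nat.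
  exists i./2; rewrite -{1 3}(odd_double_half i).
  by case: (odd i); [right|left]; rewrite ?add1n ?add0n.
- rewrite odd_double /= doubleK -mul2n ['i%C ^+ _]exprM i2; ring.
- rewrite /= odd_double /= doubleK -mul2n ['i%C ^+ _]exprSr ['i%C ^+ _]exprM i2; ring.
Qed.

(** Cauchy product: the double series converges unconditionally, so it may be summed row by row,
    giving the product, or along triangles, giving the series of [z + w] by the binomial formula. *)
Lemma expCD z w : expC (z + w) = expC z * expC w.
Proof.
pose F (p : nat * nat) := expterm z p.1 * expterm w p.2.
have [T hT] : exists T, hasS ([set: nat] `*` [set: nat]) F T.
  apply: absS_ex; apply: (absS_iterated (b := fun n => cabs (expterm z n) * expR (cabs w))).
  - by move=> p; exact: cabs_ge0.
  - move=> i S _ /=; rewrite /F /=.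
    under eq_bigr do rewrite cabsM.
    by rewrite -mulr_sumr ler_wpM2l ?cabs_ge0//; exact: sum_expterm_le.
  - exists (expR (cabs z) * expR (cabs w)) => S; rewrite -mulr_suml ler_wpM2r ?expR_ge0//.
    exact: sum_expterm_le.
have -> : expC z * expC w = T.
  apply: hasS_uniq (hasSZr _ (hasS_expC z)) _.
  apply: hasS_iterated hT _ => i _; rewrite /F /=; apply: hasSZ; exact: hasS_expC.
apply: limC_uniq (limC_series (hasS_expC _)) _.
(* The antidiagonals [p + q = m] with [m < n]; these triangles exhaust all pairs. *)
pose tri n : seq (nat * nat) := [seq ((m - j)%N, j) | m <- iota 0 n, j <- iota 0 m.+1].
have tri_uniq n : uniq (tri n).
  apply: allpairs_uniq_dep; rewrite ?iota_uniq//; first by move=> m _; exact: iota_uniq.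
  move=> [m j] [m' j'] /allpairsPdep[a [b [_ hb [-> ->]]]] /allpairsPdep[a' [b' [_ hb' [-> ->]]]] /=.
  case=> e1 e2; subst b'; move: hb hb'; rewrite !mem_iota /= !add0n !ltnS => h h'.
  by rewrite -(subnK h) -(subnK h') e1.
have h : limC (fun n => upartial ([set: nat] `*` [set: nat]) F [fset p in tri n]%fset) T.
  apply: hasS_limC hT _ => -[p q]; exists (p + q).+1 => n hn.
  rewrite !inE; apply/allpairsPdep; exists (p + q)%N, q.
  by rewrite addnK !mem_iota /= !add0n hn ltnS leq_addl.
move=> e /h[N hN]; exists N => n /hN.
congr (cabs _ < _); congr (_ - _).
rewrite /upartial (eq_bigl xpredT); last by move=> p; apply/mem_set.
have -> : \sum_(i <- [fset p in tri n]%fset) F i = \sum_(i <- tri n) F i.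
  by apply: perm_big; apply: uniq_perm => // p; rewrite !inE.
rewrite big_allpairs_dep -(big_mkord xpredT (fun i => expterm (z + w) i)) /index_iota subn0.
apply: eq_bigr => m _; rewrite -[iota 0 m.+1]/(index_iota 0 m.+1) big_mkord.
rewrite /expterm exprDn mulr_suml; apply: eq_bigr => -[j /= hj] _; rewrite /F /expterm /=.
have := bin_fact (n := m) (m := j); rewrite -ltnS => /(_ hj) <-.
rewrite -mulr_natr !natrM; field.
by rewrite !pnatr_eq0 -!lt0n !fact_gt0 bin_gt0 -ltnS hj.
Qed.

Lemma cexpE z : cexp z = expC z.
Proof.
by rewrite [in RHS](complex_split z) expCD expC_real expC_im.
Qed.

Lemma hasS_cexp z : hasS setT (expterm z) (cexp z).
Proof. by rewrite cexpE; exact: hasS_expC. Qed.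

Lemma cexpD z w : cexp (z + w) = cexp z * cexp w.
Proof. by rewrite !cexpE expCD. Qed.

Lemma cexp0 : cexp (0 : R[i]) = 1.
Proof.
by rewrite /cexp /= expR0 cos0 sin0 -[RHS]mul1r.
Qed.

Lemma cabs_cexp z : cabs (cexp z) = expR (complex.Re z).
Proof.
rewrite /cexp cabsM cabs_toC ger0_norm ?expR_ge0// [X in _ * X](_ : _ = 1) ?mulr1//.
apply/eqP; rewrite -(@eqrXn2 _ 2)// ?cabs_ge0// cabs_sqr /= cos2Dsin2 expr1n//.
Qed.

Lemma cexp_sum (I : Type) (s : seq I) (P : pred I) (F : I -> R[i]) :
  cexp (\sum_(i <- s | P i) F i) = \prod_(i <- s | P i) cexp (F i).
Proof.
by elim/big_rec2: _ => [|i y x _ h]; rewrite ?cexp0// cexpD h.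
Qed.

(** The square of [z] factors out of the tail, and (n + 2)! is at least n!. All second order
    remainders of exponentials below, in v as in lambda, come from this bound. *)
Lemma cexp_remainder z : cabs (cexp z - 1 - z) <= cabs z ^+ 2 * expR (cabs z).
Proof.
pose f n := if (n < 2)%N then 0 else expterm z n.
have hf : hasS setT f (cexp z - 1 - z).
  have h0 (m : nat) (c : R[i]) : hasS setT (fun n => if n == m then c else 0 : R[i]) c.
    move=> e e0; exists [fset m]%fset => S sub; rewrite upartialT.
    rewrite (big_fsetD1 m) ?(fsubsetP sub) ?inE//= eqxx big_seq big1 ?addr0 ?subrr ?cabs0//.
    by move=> i; rewrite !inE => /andP[/negbTE ->].
  have := hasSB (hasSB (hasS_cexp z) (h0 0%N 1)) (h0 1%N z).
  apply: hasS_ext => -[|[|n]] _; rewrite /f /expterm /=.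
  - by rewrite expr0 invr1 mulr1 subrr subr0.
  - by rewrite expr1 invr1 mulr1 subr0 subrr.
  - by rewrite !subr0.
apply: (hasS_le hf) => S; rewrite (eq_bigl xpredT); last by move=> i; rewrite in_setT.
pose N := (\max_(i <- S) i).+1.
(* Two extra indices, so that the vanishing terms 0 and 1 can be split off. *)
apply: le_trans (_ : \sum_(n <- fiota N.+2) cabs (f n) <= _).
  apply: (@ler_sum_fsubset _ _ xpredT) => [i _|]; first exact: cabs_ge0.
  apply/fsubsetP => i iS; rewrite in_fiota; apply: leqW; apply: leqW.
  by rewrite ltnS; exact: (leq_bigmax_seq (F := id)).
rewrite sum_fiota 2!big_ord_recl /= /f /= cabs0 !add0r.
apply: le_trans (_ : \sum_(i < N) cabs z ^+ 2 * (cabs z ^+ i / i`!%:R) <= _).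
  apply: ler_sum => i _; rewrite /bump /= !add1n /= cabs_expterm mulrA -exprD add2n.
  rewrite ler_wpM2l ?exprn_ge0 ?cabs_ge0// lef_pV2 ?posrE ?ltr0n ?fact_gt0//.
  rewrite ler_nat !factS mulnA leq_pmull//.
rewrite -mulr_sumr ler_wpM2l ?exprn_ge0 ?cabs_ge0//.
by have := @sum_exp_le (cabs z) (fiota N) (cabs_ge0 z); rewrite sum_fiota.
Qed.

End ComplexExponential.

(** * Calculus and the bilinear form on the hat space *)

Section Calculus.

(** Stated over any [numFieldType], since it serves real directions in v and complex ones in
    lambda. *)
Lemma is_derive_quad (K : numFieldType) (V W : normedModType K) (f : V -> W)
    (x u : V) (L : W) (rho M : K) : 0 < rho -> 0 <= M ->
  (forall t : K, `|t| < rho -> `|f (x + t *: u) - f x - t *: L| <= M * `|t| ^+ 2) ->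
  is_derive x u f L.
Proof.
move=> rho0 M0 h.
suff cv : (fun t : K => t^-1 *: ((f \o shift x) (t *: u) - f x)) @ 0^' --> L.
  by split; [apply/cvg_ex; exists L|exact: cvg_lim cv].
apply/cvgrPdist_le => e e0.
have M1 : 0 < M + 1 by rewrite ltr_wpDl.
pose d := Num.min rho (e / (M + 1)).
near=> t.
have t0 : t != 0 by near: t; exact: nbhs_dnbhs_neq.
have trho : `|t| < rho.
  by near: t; apply: dnbhs0_lt.
have te : `|t| < e / (M + 1).
  by near: t; apply: dnbhs0_lt; rewrite divr_gt0.
rewrite /= [t *: u + x]addrC.
have -> : L - t^-1 *: (f (x + t *: u) - f x) = - (t^-1 *: (f (x + t *: u) - f x - t *: L)).
  by rewrite [in RHS]scalerBr scalerA mulVf// scale1r opprB.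
rewrite normrN normrZ normfV mulrC ler_pdivrMr ?normr_gt0//.
apply: le_trans (h t trho) _.
rewrite expr2 mulrA ler_wpM2r//.
apply: le_trans (_ : (M + 1) * `|t| <= _); first by rewrite ler_wpM2r// lerDl.
by rewrite mulrC -ler_pdivlMr// ltW.
Unshelve. all: by end_near. Qed.

Context {R : realType}.

Lemma int0_FTC (g G : R -> R) (b : R) : continuous g ->
  (forall t : R, is_derive t (1 : R) (G : R -> R^o) (g t)) -> int0 g b = G b - G 0.
Proof.
move=> cg dG.
have cG : continuous G.
  move=> t; apply/differentiable_continuous/derivable1_diffP.
  by have [] := dG t.
have key a c : a < c -> (\int[@lebesgue_measure R]_(t in `[a, c]) g t) = G c - G a.
  move=> ac; rewrite /Rintegral (continuous_FTC2 (F := G) ac)//.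
  - by apply: continuous_subspaceT.
  - split; [|exact: cvg_at_right_filter (cG a)|exact: cvg_at_left_filter (cG c)].
    by move=> t _; have [] := dG t.
  - by move=> t _; rewrite derive1E; have [_ ->] := dG t.
rewrite /int0; case: ifP => [|/negbT]; last first.
  by rewrite -ltNge => /key ->; rewrite opprB.
rewrite le_eqVlt => /orP[/eqP <-|/key//].
by rewrite set_itv1 /Rintegral integral_set1/= subrr.
Qed.

Lemma cint0_FTC (g G : R -> R[i]) (b : R) :
  continuous (fun t => complex.Re (g t)) -> continuous (fun t => complex.Im (g t)) ->
  (forall t : R, is_derive t (1 : R) ((fun t => complex.Re (G t)) : R -> R^o) (complex.Re (g t))) ->
  (forall t : R, is_derive t (1 : R) ((fun t => complex.Im (G t)) : R -> R^o) (complex.Im (g t))) ->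
  cint0 g b = G b - G 0.
Proof.
move=> cr ci dr di; rewrite /cint0.
rewrite (int0_FTC (G := fun t => complex.Re (G t)))//.
rewrite (int0_FTC (G := fun t => complex.Im (G t)))//.
by case: (G b) => ? ?; case: (G 0).
Qed.

End Calculus.

Section HatForm.
Context {K : numFieldType} {r : nat}.
Implicit Types (u v : 'cV[K]_r) (x y z : hat K r) (a : K).

Lemma dotvC u v : dotv u v = dotv v u.
Proof. by apply: eq_bigr => i _; rewrite mulrC. Qed.

Lemma dotvDl u v w : dotv (u + v) w = dotv u w + dotv v w.
Proof. by rewrite /dotv -big_split; apply: eq_bigr => i _; rewrite !mxE mulrDl. Qed.

Lemma dotvZl a u w : dotv (a *: u) w = a * dotv u w.
Proof. by rewrite /dotv mulr_sumr; apply: eq_bigr => i _; rewrite !mxE mulrA. Qed.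

Lemma dotvDr u v w : dotv w (u + v) = dotv w u + dotv w v.
Proof. by rewrite dotvC dotvDl !(dotvC w). Qed.

Lemma dotvZr a u w : dotv w (a *: u) = a * dotv w u.
Proof. by rewrite dotvC dotvZl dotvC. Qed.

Lemma dotvNl u w : dotv (- u) w = - dotv u w.
Proof. by rewrite -scaleN1r dotvZl mulN1r. Qed.

Lemma dotvNr u w : dotv w (- u) = - dotv w u.
Proof. by rewrite -scaleN1r dotvZr mulN1r. Qed.

Lemma dotv0l u : dotv 0 u = 0.
Proof. by rewrite -(scale0r 0) dotvZl mul0r. Qed.

Lemma dotv0r u : dotv u 0 = 0.
Proof. by rewrite dotvC dotv0l. Qed.

Lemma dotv_sumr (I : Type) (s : seq I) (P : pred I) (F : I -> 'cV[K]_r) u :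
  dotv u (\sum_(i <- s | P i) F i) = \sum_(i <- s | P i) dotv u (F i).
Proof. by elim/big_rec2: _ => [|i ? ? _ <-]; rewrite ?dotv0r// dotvDr. Qed.

Lemma hformC x y : hform x y = hform y x.
Proof. by rewrite /hform dotvC; ring. Qed.

Lemma hformDl x y z : hform (x + y) z = hform x z + hform y z.
Proof. by rewrite /hform /= dotvDl; ring. Qed.

Lemma hformZl a x z : hform (a *: x) z = a * hform x z.
Proof. by rewrite /hform /= dotvZl /GRing.scale /=; ring. Qed.

Lemma hformDr x y z : hform z (x + y) = hform z x + hform z y.
Proof. by rewrite hformC hformDl !(hformC z). Qed.

Lemma hformZr a x z : hform z (a *: x) = a * hform z x.
Proof. by rewrite hformC hformZl hformC. Qed.

Lemma hformNl x z : hform (- x) z = - hform x z.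
Proof. by rewrite -scaleN1r hformZl mulN1r. Qed.

Lemma hformNr x z : hform z (- x) = - hform z x.
Proof. by rewrite -scaleN1r hformZr mulN1r. Qed.

Lemma hformBr x y z : hform z (x - y) = hform z x - hform z y.
Proof. by rewrite hformDr hformNr. Qed.

Lemma hformBl x y z : hform (x - y) z = hform x z - hform y z.
Proof. by rewrite hformDl hformNl. Qed.

End HatForm.

Section HatReal.
Context {R : realType} {r : nat}.
Implicit Types (x y h : hat R r) (mu nu : hat R[i] r) (t : R).

Lemma vecCD (u v : 'cV[R]_r) : vecC (u + v) = vecC u + vecC v.
Proof. by apply/matrixP => i j; rewrite !mxE toCD. Qed.

Lemma vecCZ t (v : 'cV[R]_r) : vecC (t *: v) = toC t *: vecC v.
Proof. by apply/matrixP => i j; rewrite !mxE toCM. Qed.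

Lemma vecCN (v : 'cV[R]_r) : vecC (- v) = - vecC v.
Proof. by apply/matrixP => i j; rewrite !mxE toCN. Qed.

Lemma vecC0 : vecC 0 = 0 :> 'cV[R[i]]_r.
Proof. by apply/matrixP => i j; rewrite !mxE toC0. Qed.

Lemma hatCD x y : hatC (x + y) = hatC x + hatC y.
Proof. by rewrite /hatC /= vecCD !toCD. Qed.

Lemma hatCZ t x : hatC (t *: x) = toC t *: hatC x.
Proof. by rewrite /hatC /= vecCZ /GRing.scale /= !toCM. Qed.

Lemma hatCN x : hatC (- x) = - hatC x.
Proof. by rewrite -scaleN1r hatCZ toCN toC1 scaleN1r. Qed.

Lemma hatCB x y : hatC (x - y) = hatC x - hatC y.
Proof. by rewrite hatCD hatCN. Qed.

Lemma dotv_vecC (u v : 'cV[R]_r) : dotv (vecC u) (vecC v) = toC (dotv u v).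
Proof. by rewrite /dotv toC_sum; apply: eq_bigr => i _; rewrite !mxE toCM. Qed.

Lemma hform_hatC x y : hform (hatC x) (hatC y) = toC (hform x y).
Proof. by rewrite /hform /= dotv_vecC !toCD !toCM. Qed.

Lemma hatReK x : hatRe (hatC x) = x.
Proof.
case: x => [[v e] k]; rewrite /hatRe /hatC /=; congr (_, _, _).
by apply/matrixP => i j; rewrite !mxE.
Qed.

(** A real valued l1 norm on the complexified space, dual to the maximum norm of the real one, as
    [hform_le] shows. *)
Definition hn mu : R := \sum_(i < r) cabs (mu.1.1 i 0) + cabs mu.1.2 + cabs mu.2.

Lemma hn_ge0 mu : 0 <= hn mu.
Proof. by rewrite !addr_ge0 ?cabs_ge0// sumr_ge0// => i _; exact: cabs_ge0. Qed.

Lemma hnD mu nu : hn (mu + nu) <= hn mu + hn nu.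
Proof.
rewrite /hn /= [leRHS]addrACA lerD ?cabsD//.
rewrite [leRHS]addrACA lerD ?cabsD// -big_split/=; apply: ler_sum => i _.
by rewrite mxE cabsD.
Qed.

Lemma hnZ (a : R[i]) mu : hn (a *: mu) = cabs a * hn mu.
Proof.
rewrite /hn /= !mulrDr -!cabsM mulr_sumr; congr (_ + _ + _).
by apply: eq_bigr => i _; rewrite mxE cabsM.
Qed.

Lemma normr_prod (K : numDomainType) (U V : normedModType K) (p : U * V) (e : K) :
  `|p| <= e <-> `|p.1| <= e /\ `|p.2| <= e.
Proof.
by rewrite prod_normE comparable_ge_max ?real_comparable ?normr_real//; split=> [/andP[]|[-> ->]].
Qed.

End HatReal.

Section NormBounds.

Lemma le_mxentry (K : numDomainType) m n (M : 'M[K]_(m, n)) i j : `|M i j| <= `|M|.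
Proof.
rewrite {2}/Num.norm /= mx_normE.
rewrite -[leLHS]nngE num_le.
exact: (le_bigmax _ (fun i : 'I_m * 'I_n => `|M i.1 i.2|%:nng) (i, j)).
Qed.

Context {R : realType} {r : nat}.
Implicit Types (x y h : hat R r) (mu nu : hat R[i] r) (t : R).

Lemma hform_le mu h : cabs (hform mu (hatC h)) <= hn mu * `|h|.
Proof.
have [hh h3] : `|h.1| <= `|h| /\ `|h.2| <= `|h| by apply/normr_prod.
have [h1 h2] : `|h.1.1| <= `|h.1| /\ `|h.1.2| <= `|h.1| by apply/normr_prod.
rewrite /hform /hn /= !mulrDl.
apply: le_trans (cabsD _ _) _; apply: lerD; last first.
  by rewrite cabsM cabs_toC ler_wpM2l ?cabs_ge0// (le_trans h2).
apply: le_trans (cabsD _ _) _; apply: lerD; last first.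
  by rewrite cabsM cabs_toC ler_wpM2l ?cabs_ge0//=.
apply: le_trans (cabs_sum _ _ _) _; rewrite mulr_suml; apply: ler_sum => i _.
rewrite cabsM mxE cabs_toC ler_wpM2l ?cabs_ge0//.
by apply: le_trans hh; apply: le_trans h1; exact: le_mxentry.
Qed.

Lemma hn_norm mu (e : R) : `|mu| <= toC e -> hn mu <= (r%:R + 2) * e.
Proof.
move=> /normr_prod[/normr_prod[h1 h2] h3].
rewrite /hn mulrDl -addrA; apply: lerD.
  rewrite -[r in r%:R]card_ord mulr_natl -sumr_const; apply: ler_sum => i _.
  by rewrite -ler_toC -cabsE (le_trans _ h1)// le_mxentry.
by rewrite mulr_natl mulr2n lerD// -ler_toC -cabsE.
Qed.

Lemma hn_norm_le mu : toC (hn mu) <= (r%:R + 2) * `|mu|.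
Proof.
have re : toC (complex.Re `|mu|) = `|mu| by apply: RRe_real; exact: normr_real.
rewrite -re -!natC -toCD -toCM ler_toC; apply: hn_norm; by rewrite re.
Qed.

(** The last two coordinates are exchanged because c pairs with d; [hform] then becomes a plain dot
    product of coordinates. *)
Definition dualcoord mu (i : 'I_(r + 2)) : R[i] :=
  hcoord (mu.1.1, mu.2, mu.1.2) i.

Lemma sum_coord (V : nmodType) (F : 'I_(r + 2) -> V) :
  \sum_i F i = \sum_(i < r) F (lshift 2 i) + F (rshift r 0) + F (rshift r 1).
Proof. by rewrite big_split_ord /= !big_ord_recl big_ord0 addr0 addrA; congr (_ + _ + F _); apply/val_inj. Qed.

Lemma hcoordl (K : numFieldType) (x : hat K r) i : hcoord x (lshift 2 i) = x.1.1 i 0.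
Proof.
rewrite /hcoord; case: (splitP (lshift 2 i)) => [j /= e|k /= e].
  by congr (_ _ _); apply/val_inj.
by have := ltn_ord i; rewrite e ltnNge leq_addr.
Qed.

Lemma hcoordr (K : numFieldType) (x : hat K r) (i : 'I_2) :
  hcoord x (rshift r i) = if i == 0 then x.1.2 else x.2.
Proof.
rewrite /hcoord; case: (splitP (rshift r i)) => [j /= e|k /= e].
  by have := ltn_ord j; rewrite -e ltnNge leq_addr.
by have -> : k = i by apply/val_inj/(@addnI r).
Qed.

Lemma hform_coord mu h :
  hform mu (hatC h) = \sum_i dualcoord mu i * toC (hcoord h i).
Proof.
rewrite sum_coord /dualcoord !hcoordr /= /hform /=.
rewrite [RHS]addrAC; congr (_ + _ + _).
by apply: eq_bigr => i _; rewrite !hcoordl mxE.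
Qed.

Lemma sum_dualcoord mu : \sum_i cabs (dualcoord mu i) = hn mu.
Proof.
rewrite sum_coord /dualcoord !hcoordr /= /hn [RHS]addrAC; congr (_ + _ + _).
by apply: eq_bigr => i _; rewrite hcoordl.
Qed.

Lemma hcoord_le h i : `|hcoord h i| <= `|h|.
Proof.
have [hh h3] : `|h.1| <= `|h| /\ `|h.2| <= `|h| by apply/normr_prod.
have [h1 h2] : `|h.1.1| <= `|h.1| /\ `|h.1.2| <= `|h.1| by apply/normr_prod.
rewrite /hcoord; case: fintype.split => j.
  by apply: le_trans hh; apply: le_trans h1; exact: le_mxentry.
by case: ifP => _ //; apply: le_trans hh.
Qed.

End NormBounds.

(** * The exponential series in several variables *)

Section MultiExponential.
Context {R : realType}.

Lemma limCM (a b : nat -> R[i]) x y : limC a x -> limC b y ->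
  limC (fun n => a n * b n) (x * y).
Proof.
move=> ha hb e e0.
have p0 : 0 < cabs x + cabs y + 1 by rewrite ltr_wpDl ?addr_ge0 ?cabs_ge0.
pose d := Num.min 1 (e / (cabs x + cabs y + 1)).
have d0 : 0 < d by rewrite lt_min ltr01 divr_gt0.
have [N hN] := ha _ d0; have [N' hN'] := hb _ d0.
exists (N + N')%N => n hn.
have {}hN : cabs (a n - x) < d by apply: hN; apply: leq_trans hn; exact: leq_addr.
have {}hN' : cabs (b n - y) < d by apply: hN'; apply: leq_trans hn; exact: leq_addl.
have -> : a n * b n - x * y = (a n - x) * (b n - y) + x * (b n - y) + (a n - x) * y by ring.
have d1 : d <= 1 by rewrite ge_min lexx.
have de : d * (cabs x + cabs y + 1) <= e.
  by rewrite -ler_pdivlMr// ge_min lexx orbT.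
have := cabsD ((a n - x) * (b n - y) + x * (b n - y)) ((a n - x) * y).
have := cabsD ((a n - x) * (b n - y)) (x * (b n - y)).
rewrite !cabsM; have := cabs_ge0 (a n - x); have := cabs_ge0 (b n - y).
have := cabs_ge0 x; have := cabs_ge0 y.
by nra.
Qed.

Lemma limC_cst (x : R[i]) : limC (fun=> x) x.
Proof. by move=> e e0; exists 0%N => n _; rewrite subrr cabs0. Qed.

Lemma limC_prod (I : Type) (s : seq I) (a : I -> nat -> R[i]) (x : I -> R[i]) :
  (forall i, limC (a i) (x i)) ->
  limC (fun n => \prod_(i <- s) a i n) (\prod_(i <- s) x i).
Proof.
move=> h; elim: s => [|i s IH].
  rewrite big_nil => e /(limC_cst 1)[N hN]; exists N => n /hN; by rewrite big_nil.
rewrite big_cons => e /(limCM (h i) IH)[N hN]; exists N => n /hN.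
by rewrite big_cons.
Qed.

Variable d : nat.

(** Multi-indices with all entries in [X]. On such a box a sum of products is a product of sums, and
    the boxes exhaust all multi-indices. *)
Definition fbox (T : choiceType) (X : {fset T}) : {fset {ffun 'I_d -> T}} :=
  [fset nu in [seq [ffun i => val (g i)] | g : {ffun 'I_d -> X}]]%fset.

Lemma sum_fbox (T : choiceType) (V : comPzSemiRingType) (X : {fset T}) (F : 'I_d -> T -> V) :
  \sum_(nu <- fbox X) \prod_i F i (nu i) = \prod_i \sum_(n <- X) F i n.
Proof.
under [RHS]eq_bigr do rewrite big_seq_fsetE.
rewrite bigA_distr_bigA /fbox.
have -> : \sum_(nu <- fbox X) \prod_i F i (nu i) =
    \sum_(nu <- [seq [ffun i => val (g i)] | g : {ffun 'I_d -> X}]) \prod_i F i (nu i).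
  apply: perm_big; apply: uniq_perm => //; last by move=> nu; rewrite !inE.
  rewrite map_inj_uniq ?enum_uniq// => g g' /ffunP e; apply/ffunP => i.
  by apply/val_inj; have := e i; rewrite !ffunE.
rewrite big_map big_enum /=; apply: eq_bigr => g _; apply: eq_bigr => i _.
by rewrite ffunE.
Qed.

Lemma in_fbox (T : choiceType) (X : {fset T}) (nu : {ffun 'I_d -> T}) :
  (forall i, nu i \in X) -> nu \in fbox X.
Proof.
move=> h; rewrite !inE; apply/mapP; exists [ffun i => [` h i]%fset].
  by rewrite mem_enum.
by apply/ffunP => i; rewrite !ffunE.
Qed.

Lemma sum_multiexp_le (x : 'I_d -> R[i]) (S : {fset {ffun 'I_d -> nat}}) :
  \sum_(nu <- S) cabs (\prod_i expterm (x i) (nu i)) <= expR (\sum_i cabs (x i)).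
Proof.
pose N := (\max_(nu <- S) \max_i nu i).+1.
apply: le_trans (_ : \sum_(nu <- fbox (fiota N)) cabs (\prod_i expterm (x i) (nu i)) <= _).
  apply: (@ler_sum_fsubset _ _ xpredT) => [i _|]; first exact: cabs_ge0.
  apply/fsubsetP => nu nuS; apply: in_fbox => i; rewrite in_fiota ltnS.
  apply: leq_trans (_ : (\max_i nu i <= _)%N); first exact: leq_bigmax.
  exact: (leq_bigmax_seq (F := fun nu : {ffun 'I_d -> nat} => (\max_i nu i)%N)).
under eq_bigr do rewrite cabs_prod.
rewrite (sum_fbox (fiota N) (fun i n => cabs (expterm (x i) n))) expR_sum.
apply: ler_prod => i _; apply/andP; split; first by apply: sumr_ge0 => ? _; exact: cabs_ge0.
by have := sum_expterm_le (x i) (fiota N); rewrite -/(upartial _ _ _) upartialT.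
Qed.

(** Absolute summability gives some limit; it is then identified along the boxes, where the sum is a
    product of partial sums in one variable. *)
Lemma hasS_multiexp (x : 'I_d -> R[i]) :
  hasS setT (fun nu : {ffun 'I_d -> nat} => \prod_i expterm (x i) (nu i))
    (cexp (\sum_i x i)).
Proof.
have [T hT] : exists T, hasS setT (fun nu : {ffun 'I_d -> nat} => \prod_i expterm (x i) (nu i)) T.
  apply: absS_ex; exists (expR (\sum_i cabs (x i))) => S.
  by rewrite -/(upartial _ _ _) upartialT; exact: sum_multiexp_le.
suff -> : cexp (\sum_i x i) = T by [].
rewrite cexp_sum.
have := limC_prod (index_enum _) (fun i => limC_series (hasS_cexp (x i))).
move=> /limC_uniq; apply.
have h : limC (fun n => upartial setT (fun nu : {ffun 'I_d -> nat} => \prod_i expterm (x i) (nu i)) (fbox (fiota n))) T.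
  apply: hasS_limC hT _ => nu; exists (\max_i nu i).+1 => n hn; apply: in_fbox => i; rewrite in_fiota.
  by apply: leq_trans hn; rewrite ltnS leq_bigmax.
move=> e /h[N hN]; exists N => n /hN; rewrite upartialT.
by rewrite (sum_fbox (fiota n) (fun i n => expterm (x i) n)); under eq_bigr do rewrite sum_fiota.
Qed.

End MultiExponential.

(** * Series of exponentials of linear forms *)

Section DirichletSeries.
Context {R : realType} {r : nat} (I : choiceType) (A : set I).
Variable mu : I -> hat R[i] r.
Implicit Types (C : I -> R[i]) (x u h : hat R r).

Definition dterm C x i : R[i] := C i * cexp (hform (mu i) (hatC x)).

Definition dseries C x : R[i] := csum A (dterm C x).

(** Dominates the terms at every real [x + h] with [|h| <= rho]. The reserve exp(rho * hn) also
    absorbs the polynomial factors in [mu] produced by differentiation. *)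
Definition dmajor C x (rho : R) i : R :=
  cabs (C i) * expR (complex.Re (hform (mu i) (hatC x)) + rho * hn (mu i)).

Definition good C := forall x, Vplus x -> exists2 rho, 0 < rho & absS A (dmajor C x rho).

Lemma Re_le z : complex.Re z <= cabs (z : R[i]).
Proof. exact: le_trans (ler_norm _) (Re_le_cabs z). Qed.

Lemma cabs_dterm_shift C x h rho i : `|h| <= rho ->
  cabs (dterm C (x + h) i) <= dmajor C x rho i.
Proof.
move=> hr; rewrite /dterm cabsM cabs_cexp ler_wpM2l ?cabs_ge0// ler_expR.
rewrite hatCD hformDr raddfD /= lerD2l; apply: le_trans (Re_le _) _.
apply: le_trans (hform_le _ _) _; by rewrite mulrC ler_wpM2r ?hn_ge0.
Qed.

Lemma dseries_hasS_shift C x h rho : absS A (dmajor C x rho) -> `|h| <= rho ->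
  hasS A (dterm C (x + h)) (dseries C (x + h)).
Proof.
move=> hC hr; apply: absS_csum; apply: absS_le hC => i _; exact: cabs_dterm_shift.
Qed.

Lemma dseries_hasS C x : good C -> Vplus x -> hasS A (dterm C x) (dseries C x).
Proof.
move=> gC /gC[rho r0 hC]; rewrite -[x]addr0; apply: dseries_hasS_shift hC _.
by rewrite normr0 ltW.
Qed.

Lemma one_hn_le (rho s : R) : 0 < rho -> 0 <= s ->
  1 + s <= (1 + 2 / rho) * expR (rho / 2 * s).
Proof.
move=> r0 s0; have e1 : 1 + rho / 2 * s <= expR (rho / 2 * s) by exact: expR_ge1Dx.
have s1 : s = 2 / rho * (rho / 2 * s).
  by rewrite mulrA [2 / rho * _]mulrC mulrA divfK ?pnatr_eq0// mulfV ?gt_eqF// mul1r.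
have p : 0 <= rho / 2 * s by rewrite mulr_ge0// ltW// divr_gt0.
rewrite mulrDl mul1r lerD//; first by apply: le_trans e1; rewrite lerDl.
by rewrite {1}s1 ler_wpM2l// ?(ltW (divr_gt0 _ _))//; apply: le_trans e1; rewrite lerDr.
Qed.

(** Half of the exponential reserve pays for a factor growing linearly in [mu], by [one_hn_le]. So
    convergence survives differentiation, with a smaller radius. *)
Lemma dmajor_mul C (D : I -> R[i]) x rho K : 0 < rho -> 0 <= K ->
  (forall i, A i -> cabs (D i) <= K * (1 + hn (mu i))) ->
  absS A (dmajor C x rho) -> absS A (dmajor (fun i => D i * C i) x (rho / 2)).
Proof.
move=> r0 K0 hD hC; apply: absS_le (absSZ (c := K * (1 + 2 / rho)) _ hC) => [i Ai|]; last first.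
  by rewrite mulr_ge0// addr_ge0// ltW// divr_gt0.
rewrite /dmajor cabsM.
have -> : complex.Re (hform (mu i) (hatC x)) + rho * hn (mu i) =
  rho / 2 * hn (mu i) + (complex.Re (hform (mu i) (hatC x)) + rho / 2 * hn (mu i)).
  by rewrite addrCA -mulrDl -splitr.
rewrite [in leRHS]expRD; set E := expR (complex.Re _ + _); set e2 := expR (rho / 2 * _).
rewrite [leRHS](_ : _ = K * ((1 + 2 / rho) * e2) * (cabs (C i) * E)); last by ring.
rewrite -mulrA ler_wpM2r ?mulr_ge0 ?cabs_ge0 ?expR_ge0//.
apply: le_trans (hD i Ai) _; rewrite ler_wpM2l// one_hn_le ?hn_ge0//.
Qed.

Lemma good_mul C (D : I -> R[i]) K : 0 <= K ->
  (forall i, A i -> cabs (D i) <= K * (1 + hn (mu i))) ->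
  good C -> good (fun i => D i * C i).
Proof.
move=> K0 hD gC x /gC[rho r0 hC]; exists (rho / 2); first by rewrite divr_gt0.
exact: dmajor_mul hD hC.
Qed.

Definition dcoef u C i : R[i] := hform (mu i) (hatC u) * C i.

Lemma good_dcoef C u : good C -> good (dcoef u C).
Proof.
apply: (@good_mul _ _ `|u|) => // i _; apply: le_trans (hform_le _ _) _.
by rewrite mulrC ler_wpM2l// lerDr.
Qed.

Lemma sq_le_expR (s : R) : 0 <= s -> s ^+ 2 <= 2 * expR s.
Proof.
move=> s0; have := expR_ge1Dxn 1 s0; rewrite (_ : 2`!%:R = 2)// => h.
rewrite -ler_pdivrMl//; apply: le_trans h.
by rewrite mulrC lerDr.
Qed.

(** The remainder of each term brings a factor of order [hn ^+ 2], absorbed by half of the reserve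
    in [dmajor]; the other half absorbs the exponential left by [cexp_remainder]. *)
Lemma dseries_quad C x u : good C -> Vplus x ->
  exists rho M, [/\ 0 < rho, 0 <= M & forall t : R, `|t| < rho ->
    cabs (dseries C (x + t *: u) - dseries C x - toC t * dseries (dcoef u C) x)
      <= M * `|t| ^+ 2].
Proof.
move=> gC Vx; have [rho r0 hC] := gC x Vx; have [M hM] := hC.
pose U := `|u| + 1; have U0 : 0 < U by rewrite ltr_wpDl.
(* From (U hn)^2 = 4 (U / rho)^2 (rho hn / 2)^2 and s^2 <= 2 exp(s). The [+ 1] in [U] keeps it
   positive when [u = 0]. *)
pose c := 8 * (U / rho) ^+ 2.
have c0 : 0 <= c by rewrite mulr_ge0// exprn_ge0// ltW// divr_gt0.
exists (rho / 2 / U), (c * M).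
have M0 : 0 <= M by apply: le_trans (hM fset0); rewrite big_mkcond big_seq_fset0.
split; [by rewrite !divr_gt0|exact: mulr_ge0|move=> t ht].
have tu : `|t *: u| <= rho / 2.
  rewrite normrZ; apply: le_trans (_ : `|t| * U <= _); first by rewrite ler_wpM2l// lerDl.
  by rewrite -ler_pdivlMr// ltW.
have tu' : `|t *: u| <= rho.
  by apply: le_trans tu _; rewrite ler_pdivrMr// ler_peMr ?(ltW r0)// ler1n.
have hS := hasSB (hasSB (dseries_hasS_shift hC tu') (dseries_hasS gC Vx))
  (hasSZ (toC t) (dseries_hasS (good_dcoef u gC) Vx)).
apply: (hasS_le hS) => S.
apply: le_trans (_ : \sum_(i <- S | i \in A) (c * `|t| ^+ 2) * dmajor C x rho i <= _); last first.
  by rewrite -mulr_sumr [leRHS]mulrAC ler_wpM2l// mulr_ge0// exprn_ge0.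
apply: ler_sum => i _; rewrite /dterm /dcoef hatCD hformDr cexpD hatCZ hformZr.
set e := cexp _; set s := hform (mu i) (hatC u).
have -> : C i * (e * cexp (toC t * s)) - C i * e - toC t * (s * C i * e) =
  C i * e * (cexp (toC t * s) - 1 - toC t * s) by ring.
rewrite cabsM [cabs (C i * e)]cabsM /dmajor expRD /e cabs_cexp.
rewrite [leRHS](_ : _ = cabs (C i) * expR (complex.Re (hform (mu i) (hatC x))) *
   (c * `|t| ^+ 2 * expR (rho * hn (mu i)))); last by ring.
rewrite ler_wpM2l ?mulr_ge0 ?cabs_ge0 ?expR_ge0//.
apply: le_trans (cexp_remainder _) _.
have hs : cabs (toC t * s) <= `|t| * (U * hn (mu i)).
  rewrite cabsM cabs_toC ler_wpM2l//; apply: le_trans (hform_le _ _) _.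
  by rewrite mulrC ler_wpM2r ?hn_ge0// lerDl.
have hs2 : cabs (toC t * s) <= rho / 2 * hn (mu i).
  apply: le_trans hs _; rewrite mulrA ler_wpM2r ?hn_ge0//.
  by rewrite -ler_pdivlMr// ltW.
apply: le_trans (_ : (`|t| * (U * hn (mu i))) ^+ 2 * expR (rho / 2 * hn (mu i)) <= _).
  apply: ler_pM; rewrite ?exprn_ge0 ?cabs_ge0 ?expR_ge0 ?ler_expR//.
  by apply: lerXn2r; rewrite ?nnegrE ?cabs_ge0 ?mulr_ge0 ?hn_ge0 ?(ltW U0).
have h1 : (rho / 2 * hn (mu i)) ^+ 2 <= 2 * expR (rho / 2 * hn (mu i)).
  by apply: sq_le_expR; rewrite mulr_ge0 ?hn_ge0// ltW// divr_gt0.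
have -> : rho * hn (mu i) = rho / 2 * hn (mu i) + rho / 2 * hn (mu i).
  by rewrite -mulrDl -splitr.
rewrite [in leRHS]expRD [leRHS]mulrA ler_wpM2r ?expR_ge0//.
have -> : (`|t| * (U * hn (mu i))) ^+ 2 =
  4 * (U / rho) ^+ 2 * `|t| ^+ 2 * (rho / 2 * hn (mu i)) ^+ 2.
  by field; rewrite gt_eqF.
have -> : c * `|t| ^+ 2 * expR (rho / 2 * hn (mu i)) =
  4 * (U / rho) ^+ 2 * `|t| ^+ 2 * (2 * expR (rho / 2 * hn (mu i))) by rewrite /c; ring.
by rewrite ler_wpM2l// mulr_ge0 ?sqr_ge0// mulr_ge0 ?sqr_ge0.
Qed.

Lemma is_derive_ReIm_quad (V : normedModType R) (f : V -> R[i]) (x u : V) (L : R[i]) :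
  (exists rho M, [/\ 0 < rho, 0 <= M & forall t : R, `|t| < rho ->
    cabs (f (x + t *: u) - f x - toC t * L) <= M * `|t| ^+ 2]) ->
  is_derive x u ((fun z : V => complex.Re (f z)) : V -> R^o) (complex.Re L) /\
  is_derive x u ((fun z : V => complex.Im (f z)) : V -> R^o) (complex.Im L).
Proof.
move=> [rho [M [r0 M0 h]]].
have reT t (z : R[i]) : complex.Re (toC t * z) = t * complex.Re z.
  by case: z => a b; rewrite /toC /= mul0r subr0.
have imT t (z : R[i]) : complex.Im (toC t * z) = t * complex.Im z.
  by case: z => a b; rewrite /toC /= mul0r addr0.
split; apply: (is_derive_quad r0 M0) => t /h; apply: le_trans.
  rewrite (_ : _ - _ - _ = complex.Re (f (x + t *: u) - f x - toC t * L)); first exact: Re_le_cabs.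
  by rewrite !raddfB /= reT.
rewrite (_ : _ - _ - _ = complex.Im (f (x + t *: u) - f x - toC t * L)); first exact: Im_le_cabs.
by rewrite !raddfB /= imT.
Qed.

Lemma dirder_dseries C x u : good C -> Vplus x ->
  dirder u (dseries C) x = dseries (dcoef u C) x.
Proof.
move=> gC Vx; have [[_ e1] [_ e2]] := is_derive_ReIm_quad (dseries_quad u gC Vx).
by rewrite /dirder e1 e2; case: (dseries _ _).
Qed.

Lemma Vplus_open x u : Vplus x -> exists2 d : R, 0 < d & forall t, `|t| < d -> Vplus (x + t *: u).
Proof.
move=> Vx; have p : 0 < `|u.2| + 1 by rewrite ltr_wpDl.
exists (x.2 / (`|u.2| + 1)) => [|t ht]; first by rewrite divr_gt0.
rewrite /Vplus /= -ltrBlDl sub0r.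
have : `|t *: u.2| < x.2.
  rewrite normrM; apply: le_lt_trans (_ : `|t| * (`|u.2| + 1) < _).
    by rewrite ler_wpM2l// lerDl.
  by rewrite -ltr_pdivlMr.
by rewrite ltr_norml => /andP[].
Qed.

(** The formula for the inner derivative holds on [Vplus], so the outer difference quotient is
    restricted to steps that stay in this open half-space. *)
Lemma dirder2_dseries C x u w : good C -> Vplus x ->
  dirder u (dirder w (dseries C)) x = dseries (dcoef u (dcoef w C)) x.
Proof.
move=> gC Vx; have gw := good_dcoef w gC.
have [rho [M [r0 M0 h]]] := dseries_quad u gw Vx.
have [d d0 hd] := Vplus_open u Vx.
have [] := @is_derive_ReIm_quad _ (dirder w (dseries C)) x u (dseries (dcoef u (dcoef w C)) x).
  exists (Num.min rho d), M; split; rewrite ?lt_min ?r0// => t; rewrite lt_min => /andP[t1 t2].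
  by rewrite !dirder_dseries//; [exact: h|exact: hd].
by move=> [_ e1] [_ e2]; rewrite /dirder e1 e2; case: (dseries _ _).
Qed.

Lemma prod_expterm_coord (m : hat R[i] r) h (nu : {ffun 'I_(r + 2) -> nat}) :
  \prod_i expterm (dualcoord m i * toC (hcoord h i)) (nu i) =
  (\prod_i expterm (dualcoord m i) (nu i)) * toC (monomial h nu).
Proof.
rewrite /monomial (big_morph _ (@toCM R) (@toC1 R)) -big_split /=; apply: eq_bigr => i _.
by rewrite /expterm exprMn toCX; ring.
Qed.

(** The Taylor coefficients are the sums over [A] of those of the single exponentials. [hasS_fubini]
    exchanges the two summations, the majorant being the same for all increments with coordinates
    bounded by [rho]. *)
Lemma analytic_dseries C x : good C -> Vplus x -> analytic_at (dseries C) x.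
Proof.
move=> gC Vx; have [rho r0 hC] := gC x Vx.
pose c (nu : {ffun 'I_(r + 2) -> nat}) := csum A (fun i => dterm C x i *
  \prod_j expterm (dualcoord (mu i) j) (nu j)).
exists rho, c; split => // h hr; apply: hasS_cvg.
pose F i (nu : {ffun 'I_(r + 2) -> nat}) := dterm C x i *
  \prod_j expterm (dualcoord (mu i) j * toC (hcoord h j)) (nu j).
have bound (y : hat R r) i (S : {fset {ffun 'I_(r + 2) -> nat}}) : (forall j, `|hcoord y j| <= rho) ->
   \sum_(nu <- S | nu \in setT) cabs (dterm C x i *
  \prod_j expterm (dualcoord (mu i) j * toC (hcoord y j)) (nu j)) <= dmajor C x rho i.
  move=> hy; rewrite -/(upartial _ _ _) upartialT.
  under eq_bigr do rewrite cabsM.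
  rewrite -mulr_sumr; apply: le_trans (ler_wpM2l (cabs_ge0 _) (sum_multiexp_le _ _)) _.
  rewrite /dterm cabsM cabs_cexp /dmajor expRD -mulrA ler_wpM2l ?cabs_ge0// ler_wpM2l ?expR_ge0//.
  rewrite ler_expR -sum_dualcoord mulr_sumr; apply: ler_sum => j _.
  by rewrite cabsM cabs_toC mulrC ler_wpM2r ?cabs_ge0.
have hh j : `|hcoord h j| <= rho by rewrite (le_trans (hcoord_le _ _))// ltW.
have := @hasS_fubini R _ _ A setT F (dmajor C x rho) (dterm C (x + h)) (dseries C (x + h)).
move=> /(_ _ hC _ _); set G := (fun j => _); suff -> : G = fun nu => c nu * toC (monomial h nu).
  apply.
  - by move=> i S _; exact: bound.
  - move=> i _; rewrite /F.
    have -> : dterm C (x + h) i = dterm C x i * cexp (hform (mu i) (hatC h)).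
      by rewrite /dterm hatCD hformDr cexpD mulrA.
    by apply: hasSZ; rewrite hform_coord; exact: hasS_multiexp.
  - by apply: dseries_hasS_shift hC _; exact: ltW.
apply/funext => nu; rewrite /G /F /c.
apply: csumE.
have -> : (fun i => dterm C x i * \prod_j expterm (dualcoord (mu i) j * toC (hcoord h j)) (nu j)) =
  fun i => (dterm C x i * \prod_j expterm (dualcoord (mu i) j) (nu j)) * toC (monomial h nu).
  by apply/funext => i; rewrite prod_expterm_coord mulrA.
apply: hasSZr; apply: absS_csum.
(* At the corner with all coordinates [rho] the monomial is positive and [bound] still applies;
   dividing by this monomial makes each coefficient series absolutely convergent. *)
pose y : hat R r := (\col_j rho, rho, rho).
have yr j : hcoord y j = rho by rewrite /hcoord; case: fintype.split => k; rewrite /= ?mxE//; case: ifP.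
pose m := monomial y nu; have m0 : 0 < m.
  by apply: prodr_gt0 => j _; rewrite yr exprn_gt0.
apply: absS_le (absSZ (c := m^-1) _ hC) => [i Ai|]; last by rewrite invr_ge0 ltW.
rewrite ler_pdivlMl//.
have := bound y i [fset nu]%fset; rewrite big_mkcond big_seq_fset1 in_setT prod_expterm_coord.
rewrite mulrA cabsM cabs_toC -/m (gtr0_norm m0) mulrC; apply => j.
by rewrite yr gtr0_norm.
Qed.

End DirichletSeries.

(** * The extended affine Weyl group *)

Section Reflections.
Context {K : numFieldType} {r : nat}.
Implicit Types (u v : 'cV[K]_r) (a x y : hat K r).

Lemma hat_eq x y : x.1.1 = y.1.1 -> x.1.2 = y.1.2 -> x.2 = y.2 -> x = y.
Proof. by case: x => [[? ?] ?]; case: y => [[? ?] ?] /= -> -> ->. Qed.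

Lemma hreflD a x y : hrefl a (x + y) = hrefl a x + hrefl a y.
Proof. by rewrite /hrefl hformDl scalerDl opprD addrACA. Qed.

Lemma hreflZ a (c : K) x : hrefl a (c *: x) = c *: hrefl a x.
Proof. by rewrite /hrefl hformZl scalerBr scalerA. Qed.

Lemma hform_hrefl a x y : hform (hrefl a x) (hrefl a y) = hform x y.
Proof.
rewrite /hrefl /hcoroot !(hformBl, hformBr, hformZl, hformZr) (hformC a y).
(* The inverse of 0 being 0, the coroot of an isotropic vector vanishes and its reflection is the
   identity. *)
have [->|a0] := eqVneq (hform a a) 0; first by rewrite invr0; ring.
by field.
Qed.

Lemma hreflK a : involutive (hrefl a).
Proof.
move=> x; rewrite /hrefl /hcoroot !(hformBl, hformZl, hformZr).
have [->|a0] := eqVneq (hform a a) 0.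
  by rewrite invr0 mulr0 !mul0r subr0 scale0r !subr0.
rewrite -addrA -opprD -scalerDl; set c := (X in X *: a).
suff -> : c = 0 by rewrite scale0r subr0.
by rewrite /c; field.
Qed.

Lemma hrefl_self a : hform a a != 0 -> hrefl a a = - a.
Proof.
move=> a0; rewrite /hrefl /hcoroot hformZr divfK// scaler_nat mulr2n opprD.
by rewrite addrA subrr sub0r.
Qed.

Lemma htransD u x y : htrans u (x + y) = htrans u x + htrans u y.
Proof.
apply: hat_eq => //=; first by rewrite scalerDl addrACA.
by rewrite !dotvDl; ring.
Qed.

Lemma htransZ u (c : K) x : htrans u (c *: x) = c *: htrans u x.
Proof.
apply: hat_eq => //=; first by rewrite scalerDr scalerA.
by rewrite !dotvZl /GRing.scale /=; ring.
Qed.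

Lemma hform_htrans u x y : hform (htrans u x) (htrans u y) = hform x y.
Proof.
rewrite /hform /htrans /= !(dotvDl, dotvDr, dotvZl, dotvZr) (dotvC u y.1.1).
by field.
Qed.

Lemma htrans_comp u v x : htrans u (htrans v x) = htrans (u + v) x.
Proof.
apply: hat_eq => //=; first by rewrite [u + v]addrC scalerDr addrA.
rewrite !(dotvDl, dotvDr, dotvZl) (dotvC v u).
by field.
Qed.

Lemma htrans0 x : htrans 0 x = x.
Proof. by apply: hat_eq => //=; rewrite ?scaler0 ?addr0 ?dotv0r ?mulr0 ?subr0. Qed.

Lemma htransK u : cancel (htrans u) (htrans (- u)).
Proof. by move=> x; rewrite htrans_comp addNr htrans0. Qed.

Lemma htransKV u : cancel (htrans (- u)) (htrans u).
Proof. by move=> x; rewrite htrans_comp addrN htrans0. Qed.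

Lemma hform_vhat v x : hform (vhat v) x = dotv v x.1.1.
Proof. by rewrite /hform /= !mul0r !addr0. Qed.

Lemma hform_vhat2 u v : hform (vhat u) (vhat v) = dotv u v.
Proof. by rewrite hform_vhat. Qed.

Lemma hcoroot_vhat v : hcoroot (vhat v) = vhat (coroot v).
Proof. by rewrite /hcoroot hform_vhat2 /coroot; apply: hat_eq; rewrite //= /GRing.scale /= mulr0. Qed.

Lemma hrefl_vhat v x : hrefl (vhat v) x =
  (x.1.1 - dotv x.1.1 (coroot v) *: v, x.1.2, x.2).
Proof.
rewrite /hrefl hcoroot_vhat hformC hform_vhat dotvC.
by apply: hat_eq; rewrite //= /GRing.scale /= mulr0 subr0.
Qed.

(** Conjugating a translation by a reflection translates by the reflected vector; this is the
    semidirect product rule. *)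
Lemma hrefl_htrans v u x :
  hrefl (vhat v) (htrans u x) =
  htrans (u - dotv u (coroot v) *: v) (hrefl (vhat v) x).
Proof.
rewrite !hrefl_vhat; apply: hat_eq => //=.
  rewrite dotvDl dotvZl scalerBr scalerDl opprD addrACA scalerA //.
have [v0|v0] := eqVneq (dotv v v) 0.
  by rewrite /coroot v0 invr0 mulr0 scale0r !dotv0r !scale0r !subr0.
rewrite /coroot !(dotvDl, dotvDr, dotvNl, dotvNr, dotvZl, dotvZr) !(dotvC v).
by field.
Qed.

End Reflections.

Section AffineWeyl.
Context {R : realType} {r : nat} (D : affine_datum R r).
Implicit Types (w u : hatmap R r) (x : hat R[i] r) (a b : hat R r) (y : 'cV[R]_r).

Lemma hatC_hcoroot a : hatC (hcoroot a) = hcoroot (hatC a).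
Proof. by rewrite /hcoroot hatCZ hform_hatC toCM toCV natC. Qed.

Lemma hatC_hrefl a b : hatC (hrefl a b) = sC a (hatC b).
Proof. by rewrite /sC /hrefl hatCB hatCZ -hatC_hcoroot hform_hatC. Qed.

Lemma hatC_vhat y : hatC (vhat y) = vhat (vecC y).
Proof. by []. Qed.

Lemma hatC_htrans y b : hatC (htrans y b) = tC y (hatC b).
Proof.
apply: hat_eq => //=; first by rewrite vecCD vecCZ.
by rewrite !toCB !toCM toCV natC !dotv_vecC.
Qed.

Lemma coroot_vecC y : coroot (vecC y) = vecC (coroot y).
Proof. by rewrite /coroot vecCZ toCM toCV natC dotv_vecC. Qed.

Lemma in_weyl_comp w u : in_weyl D w -> in_weyl D u -> in_weyl D (w \o u).
Proof. by elim=> [//|al {}w hal _ IH /IH]; exact: weyl_refl. Qed.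

Lemma in_weyl_sC al : Phi D al -> in_weyl D (sC (vhat al)).
Proof. by move=> h; have := weyl_refl h (weyl_id D). Qed.

Lemma in_weyl_inv w : in_weyl D w ->
  exists w', [/\ in_weyl D w', cancel w w' & cancel w' w].
Proof.
elim=> [|al {}w hal _ [w' [hw' c1 c2]]]; first by exists id; split => //; exact: weyl_id.
exists (w' \o sC (vhat al)); split.
- by apply: in_weyl_comp => //; exact: in_weyl_sC.
- by move=> x /=; rewrite /sC hreflK c1.
- by move=> x /=; rewrite c2 /sC hreflK.
Qed.

Lemma lattice_coord (b : seq 'cV[R]_r) v :
  Zspan [set` b] v <-> exists z : 'I_(size b) -> int, v = \sum_(i < size b) b`_i *~ z i.
Proof.
split=> [[l [u [z [hu ->]]]]|[z ->]]; last first.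
  exists (size b), (fun i : 'I_(size b) => b`_i), z; split => // i /=; exact: mem_nth.
have hidx i : (index (u i) b < size b)%N by rewrite index_mem; exact: hu.
exists (fun j => \sum_(i < l | Ordinal (hidx i) == j) z i).
under [RHS]eq_bigr do rewrite mulrz_sumr big_mkcond.
rewrite exchange_big /=; apply: eq_bigr => i _.
rewrite -big_mkcond /= (big_pred1 (Ordinal (hidx i))); last by move=> j; rewrite /= eq_sym.
by rewrite /= nth_index//; exact: hu.
Qed.

Lemma Y0 : Y D 0.
Proof.
have [b [_ ->]] := Y_lattice D; apply/lattice_coord; exists (fun=> 0).
by rewrite big1.
Qed.

Lemma YD y y' : Y D y -> Y D y' -> Y D (y + y').
Proof.
have [b [_ ->]] := Y_lattice D => /lattice_coord[z ->] /lattice_coord[z' ->].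
apply/lattice_coord; exists (fun i => z i + z' i); rewrite -big_split /=.
by apply: eq_bigr => i _; rewrite mulrzDr.
Qed.

Lemma YMz y (m : int) : Y D y -> Y D (y *~ m).
Proof.
have [b [_ ->]] := Y_lattice D => /lattice_coord[z ->].
apply/lattice_coord; exists (fun i => z i * m); rewrite mulrz_suml.
by apply: eq_bigr => i _; rewrite mulrzA.
Qed.

Lemma YN y : Y D y -> Y D (- y).
Proof. by move=> /(@YMz _ (-1)); rewrite mulrN1z. Qed.

Lemma Zspan_gen (A : set 'cV[R]_r) v : A v -> Zspan A v.
Proof.
move=> Av; exists 1%N, (fun=> v), (fun=> 1); split => //.
by rewrite big_ord_recl big_ord0 addr0.
Qed.

Lemma Y_dot y al : Y D y -> Phi D al -> exists m : int, dotv y al = m%:~R.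
Proof.
move=> Yy hal; have /intrP[m ->] := Y_integral Yy (Zspan_gen hal); by exists m.
Qed.

(** (y, al^vee) al = (y, al) al^vee, where (y, al) is an integer and al^vee lies in [Y]: stability
    of [Y] under the Weyl group follows from the two lattice assumptions. *)
Lemma Y_refl al y : Phi D al -> Y D y -> Y D (y - dotv y (coroot al) *: al).
Proof.
move=> hal Yy; have [m hm] := Y_dot Yy hal.
have Yc : Y D (coroot al) by apply: (@Y_coroot _ _ D); apply: Zspan_gen; exists al.
have -> : dotv y (coroot al) *: al = coroot al *~ m.
  by rewrite -[RHS]scaler_int /coroot dotvZr hm scalerA mulrC.
by apply: YD => //; apply/YN/YMz.
Qed.

Lemma weyl_tC w y : in_weyl D w -> Y D y ->
  exists2 y', Y D y' & w \o tC y = tC y' \o w.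
Proof.
move=> hw; elim: hw y => [|al {}w hal _ IH] y Yy; first by exists y.
have [y' Yy' e] := IH y Yy; exists (y' - dotv y' (coroot al) *: al); first exact: Y_refl.
apply/funext => x /=; have := congr1 (fun f => f x) e => /= ->.
rewrite /sC /tC hatC_vhat hrefl_htrans; congr (htrans _ _).
by rewrite coroot_vecC dotv_vecC vecCD vecCN vecCZ.
Qed.

Lemma tC_comp y y' : tC y \o tC y' = tC (y + y') :> hatmap R r.
Proof. by apply/funext => x; rewrite /= /tC htrans_comp vecCD. Qed.

Lemma tC0 : tC 0 = id :> hatmap R r.
Proof. by apply/funext => x; rewrite /tC vecC0 htrans0. Qed.

Lemma weylY_comp w u : weylY D w -> weylY D u -> weylY D (w \o u).
Proof.
move=> [y [w0 [Yy hw0 ->]]] [y' [u0 [Yy' hu0 ->]]].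
have [y'' Yy'' e] := weyl_tC hw0 Yy'.
exists (y + y''), (w0 \o u0); split; [exact: YD|exact: in_weyl_comp|].
by rewrite -tC_comp -[LHS]/(tC y \o (w0 \o tC y') \o u0) e.
Qed.

Lemma weylY_weyl w : weyl D w -> weylY D w.
Proof. by move=> hw; exists 0, w; split => //; [exact: Y0|rewrite tC0]. Qed.

Lemma weylY_tC y : Y D y -> weylY D (tC y).
Proof. by move=> Yy; exists y, id; split => //; exact: weyl_id. Qed.

Lemma weylY_id : weylY D id.
Proof. by apply: weylY_weyl; exact: weyl_id. Qed.

Lemma weylY_inv w : weylY D w ->
  exists w', [/\ weylY D w', cancel w w' & cancel w' w].
Proof.
move=> [y [w0 [Yy hw0 ->]]]; have [w' [hw' c1 c2]] := in_weyl_inv hw0.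
exists (w' \o tC (- y)); split.
- by apply: weylY_comp; [exact: weylY_weyl|apply/weylY_tC/YN].
- by move=> x /=; rewrite /tC vecCN htransK c1.
- by move=> x /=; rewrite c2 /tC vecCN htransKV.
Qed.

(** Collects what later arguments use of a group element, so that membership need not be unfolded
    each time. *)
Record rigid w : Prop := {
  rigidD : forall x x', w (x + x') = w x + w x';
  rigidZ : forall (c : R[i]) x, w (c *: x) = c *: w x;
  rigid_form : forall x x', hform (w x) (w x') = hform x x';
  rigid_d : forall x, (w x).2 = x.2;
  rigid_c : w chat = chat;
  rigid_real : forall a, w (hatC a) = hatC (hatRe (w (hatC a)))
}.

Lemma rigid_id : rigid id.
Proof. by split => // a; rewrite hatReK. Qed.

Lemma rigid_comp w u : rigid w -> rigid u -> rigid (w \o u).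
Proof.
move=> [a1 a2 a3 a4 a5 a6] [b1 b2 b3 b4 b5 b6]; split => /=.
- by move=> x x'; rewrite b1 a1.
- by move=> c x; rewrite b2 a2.
- by move=> x x'; rewrite a3 b3.
- by move=> x; rewrite a4 b4.
- by rewrite b5 a5.
- by move=> a; rewrite b6 a6 hatReK.
Qed.

Lemma rigid_sC al : rigid (sC (vhat al)).
Proof.
split; rewrite /sC.
- exact: hreflD.
- exact: hreflZ.
- exact: hform_hrefl.
- by move=> x; rewrite hatC_vhat hrefl_vhat.
- by rewrite hatC_vhat hrefl_vhat /= dotv0l scale0r subr0.
- by move=> a; rewrite -[hrefl _ _]/(sC _ _) -hatC_hrefl hatReK.
Qed.

Lemma rigid_tC y : rigid (tC y).
Proof.
split; rewrite /tC.
- exact: htransD.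
- exact: htransZ.
- exact: hform_htrans.
- by [].
- by apply: hat_eq; rewrite //= ?scale0r ?addr0// mul0r mul0r dotv0l !subr0.
- by move=> a; rewrite -[htrans _ _]/(tC _ _) -hatC_htrans hatReK.
Qed.

Lemma rigid_weyl w : weyl D w -> rigid w.
Proof.
elim=> [|al {}w _ _ IH]; first exact: rigid_id.
by apply: rigid_comp => //; exact: rigid_sC.
Qed.

Lemma rigid_weylY w : weylY D w -> rigid w.
Proof.
move=> [y [w0 [_ /rigid_weyl h ->]]]; apply: rigid_comp => //; exact: rigid_tC.
Qed.

Lemma rigidN w x : rigid w -> w (- x) = - w x.
Proof. by move=> hw; rewrite -scaleN1r (rigidZ hw) scaleN1r. Qed.

Lemma rigid_coroot w x : rigid w -> hcoroot (w x) = w (hcoroot x).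
Proof. by move=> hw; rewrite /hcoroot (rigid_form hw) (rigidZ hw). Qed.

Lemma RhatP a : Rhat D a <-> exists m : int, Phi D a.1.1 /\ a = (a.1.1, m%:~R, 0).
Proof.
split=> [[al [m [hal ->]]]|[m [h ->]]].
  exists m; rewrite /= scaler0 addr0; split => //.
  by apply: hat_eq; rewrite //= ?scaler0 ?addr0 ?add0r /GRing.scale /= ?mulr1 ?mulr0.
exists a.1.1, m; split => //.
by apply: hat_eq; rewrite //= ?scaler0 ?addr0 ?add0r /GRing.scale /= ?mulr1 ?mulr0.
Qed.

Lemma Rhat_sC al a : Phi D al -> Rhat D a -> Rhat D (hrefl (vhat al) a).
Proof.
move=> hal /RhatP[m [ha ->]]; apply/RhatP; exists m; rewrite hrefl_vhat /=; split => //.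
exact: (rs_refl (Phi_root_system D)).
Qed.

Lemma Rhat_tC y a : Y D y -> Rhat D a -> Rhat D (htrans y a).
Proof.
move=> Yy /RhatP[m [ha ->]]; have [n hn] := Y_dot Yy ha.
apply/RhatP; exists (m - n); rewrite /= scale0r addr0; split => //.
by rewrite /htrans /= scale0r addr0 mul0r mul0r subr0 dotvC hn rmorphB.
Qed.

Lemma Rhat_weyl w a : weyl D w -> Rhat D a -> Rhat D (hatRe (w (hatC a))).
Proof.
move=> hw ha; elim: hw => [|al {}w hal hw IH]; first by rewrite hatReK.
by rewrite /= (rigid_real (rigid_weyl hw)) -hatC_hrefl hatReK; exact: Rhat_sC.
Qed.

Lemma Rhat_weylY w a : weylY D w -> Rhat D a -> Rhat D (hatRe (w (hatC a))).
Proof.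
move=> [y [w0 [Yy hw0 ->]]] ha /=.
rewrite (rigid_real (rigid_weyl hw0)) -hatC_htrans hatReK.
by apply: Rhat_tC => //; exact: Rhat_weyl.
Qed.

End AffineWeyl.

(** * Finiteness of the Weyl group and unique factorization in the extended group *)

Section WeylFinite.
Context {R : realType} {r : nat} (D : affine_datum R r).
Implicit Types (w u : hatmap R r) (x : hat R[i] r) (a b : hat R r) (y : 'cV[R]_r).

Lemma Phi_neq0 al : Phi D al -> al != 0.
Proof.
by move=> h; apply/eqP => e; apply: (rs_nonzero (Phi_root_system D)); rewrite -e.
Qed.

Lemma dotv_gt0 y : y != 0 -> 0 < dotv y y.
Proof.
move=> y0; rewrite lt_neqAle sumr_ge0 ?andbT; last by move=> i _; rewrite -expr2 sqr_ge0.
apply: contra y0; rewrite eq_sym psumr_eq0; last by move=> i _; rewrite -expr2 sqr_ge0.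
move=> /allP h; apply/eqP/matrixP => i j; rewrite ord1 mxE.
have := h i; rewrite mem_index_enum => /(_ isT).
by rewrite -expr2 sqrf_eq0 => /eqP.
Qed.

Lemma Phi_dot_neq0 al : Phi D al -> dotv al al != 0.
Proof. by move=> /Phi_neq0/dotv_gt0; rewrite lt0r => /andP[]. Qed.

Lemma PhiN al : Phi D al -> Phi D (- al).
Proof.
move=> h; have := rs_refl (Phi_root_system D) h h.
rewrite /coroot dotvZr divfK ?Phi_dot_neq0// scaler_nat mulr2n opprD addrA.
by rewrite subrr sub0r.
Qed.

Definition Phis : {fset 'cV[R]_r} := fset_set (Phi D).

Lemma in_Phis al : (al \in Phis) = (al \in Phi D).
Proof. by rewrite /Phis in_fset_set//; exact: rs_finite (Phi_root_system D). Qed.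

Lemma PhisP al : reflect (Phi D al) (al \in Phis).
Proof. by rewrite in_Phis; apply: (iffP idP) => [h|h]; [exact: set_mem h|exact: mem_set h]. Qed.

Lemma weyl_span w x : weyl D w -> exists c : 'cV[R]_r -> R[i],
  w x - x = vhat (\sum_(al <- Phis) c al *: vecC al).
Proof.
elim=> [|al {}w hal _ [c IH]].
  by exists (fun=> 0); rewrite subrr big1// => al _; rewrite scale0r.
set d := - hform (w x) (hcoroot (hatC (vhat al))).
exists (fun be => c be + (if be == al then d else 0)).
have -> : \sum_(be <- Phis) (c be + (if be == al then d else 0)) *: vecC be =
   \sum_(be <- Phis) c be *: vecC be + d *: vecC al.
  under eq_bigr do rewrite scalerDl; rewrite big_split /=; congr (_ + _).
  have alP : al \in Phis by apply/PhisP.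
  rewrite (big_fsetD1 _ alP) /= eqxx big_seq big1 ?addr0// => be.
  by rewrite !inE => /andP[/negbTE -> _]; rewrite scale0r.
have -> : vhat (\sum_(be <- Phis) c be *: vecC be + d *: vecC al) =
   vhat (\sum_(be <- Phis) c be *: vecC be) + d *: vhat (vecC al).
  by apply: hat_eq; rewrite //= /GRing.scale /= ?mulr0 ?addr0.
rewrite -IH /= /sC /hrefl /d hatC_vhat scaleNr.
by rewrite addrAC.
Qed.

(** The roots are real, so the conjugate of a complex combination of roots is again one.
    Orthogonality to all roots then gives (z, conj z) = 0, a sum of squared moduli. *)
Lemma vecC_dot_eq0 (c : 'cV[R]_r -> R[i]) :
  (forall al, Phi D al -> dotv (\sum_(be <- Phis) c be *: vecC be) (vecC al) = 0) ->
  \sum_(be <- Phis) c be *: vecC be = 0.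
Proof.
set z := \sum_(be <- _) _ => h.
have h0 : dotv z (map_mx conjc z) = 0.
  have -> : map_mx conjc z = \sum_(be <- Phis) conjc (c be) *: vecC be.
    rewrite /z raddf_sum /=; apply: eq_bigr => be _.
    by apply/matrixP => i j; rewrite !mxE rmorphM; congr (_ * _); exact: conjc_real.
  rewrite dotv_sumr big_seq big1// => be /PhisP hbe.
  by rewrite dotvZr h// mulr0.
apply/matrixP => i j; rewrite ord1 [RHS]mxE.
move/eqP: h0; rewrite /dotv psumr_eq0; last by move=> k _; rewrite mxE mulcJ_ge0.
move=> /allP/(_ i); rewrite mem_index_enum mxE => /(_ isT).
by rewrite mulf_eq0 conjc_eq0 orbb => /eqP.
Qed.

(** [w x - x] lies in the complex span of the roots and, when [w] fixes them, is orthogonal to each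
    by invariance of the form. So the action on the roots is faithful. *)
Lemma weyl_fix w : weyl D w -> (forall al, Phi D al -> w (vhat (vecC al)) = vhat (vecC al)) ->
  w = id.
Proof.
move=> hw fx; apply/funext => x; have [c hc] := weyl_span x hw.
apply/eqP; rewrite -subr_eq0 hc /= vecC_dot_eq0// => al hal.
rewrite -hform_vhat2 -hc hformBl -{1}(fx al hal) (rigid_form (rigid_weyl hw)).
by rewrite subrr.
Qed.

(** The default [p] of [insubd] is not reached for [w] in the Weyl group, which maps roots to
    roots. *)
Definition Phiact w (p : Phis) : Phis := insubd p (hatRe (w (vhat (vecC (val p))))).1.1.

Lemma weyl_Phi w al : weyl D w -> Phi D al ->
  exists2 be, Phi D be & w (vhat (vecC al)) = vhat (vecC be).
Proof.
elim=> [|ga {}w hga _ IH] hal; first by exists al.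
have [be hbe e] := IH hal; exists (be - dotv be (coroot ga) *: ga).
  exact: (rs_refl (Phi_root_system D)).
by rewrite /= e -!hatC_vhat -hatC_hrefl hrefl_vhat.
Qed.

Lemma PhiactE w (p : Phis) : weyl D w ->
  w (vhat (vecC (val p))) = vhat (vecC (val (Phiact w p))).
Proof.
move=> hw; have [|be hbe e] := weyl_Phi (al := val p) hw; first by apply/PhisP; exact: valP.
rewrite e /Phiact e -hatC_vhat hatReK /= insubdK//.
by apply/PhisP.
Qed.

Lemma finite_weyl : finite_set (weyl D).
Proof.
pose f w : {ffun Phis -> Phis} := [ffun p => Phiact w p].
(* A chosen element inducing [phi] on the roots. By faithfulness every [w] is the one chosen for its
   own map, so the group lies in the image of a finite type. *)
pose g (phi : {ffun Phis -> Phis}) := get [set w | weyl D w /\ f w = phi].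
apply: (@sub_finite_set _ _ (g @` [set: {ffun Phis -> Phis}])); last first.
  by apply: finite_image; exact: finite_finset.
move=> w hw; exists (f w) => //.
have : exists w', weyl D w' /\ f w' = f w by exists w.
move=> /getPex; rewrite -/(g (f w)) /= => -[hw' e].
have [w1 [hw1 c1 c2]] := in_weyl_inv hw.
suff e1 : w1 \o g (f w) = id.
  by apply/funext => x; rewrite -[RHS](c2) -[g (f w) x]c2; congr (w _); rewrite -[LHS]/((w1 \o g (f w)) x) e1 c1.
apply: weyl_fix; first exact: in_weyl_comp.
move=> al /PhisP hal /=.
have := PhiactE [` hal]%fset hw'; have := PhiactE [` hal]%fset hw => /= e2 ->.
have -> : Phiact (g (f w)) [` hal]%fset = Phiact w [` hal]%fset.
  by have /ffunP/(_ [` hal]%fset) := e; rewrite !ffunE.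
by rewrite -e2 c1.
Qed.

Lemma weyl_dhat w : weyl D w -> w dhat = dhat.
Proof.
elim=> [//|al {}w _ _ IH] /=; rewrite IH /sC hatC_vhat hrefl_vhat /= dotv0l.
by rewrite scale0r subr0.
Qed.

Lemma vecC_inj : injective (@vecC R r).
Proof.
move=> y y' /matrixP h; apply/matrixP => i j; have := h i j.
by rewrite !mxE => /toC_inj.
Qed.

Lemma weylY_bij : set_bij (weyl D `*` Y D) (weylY D) (fun p => tC p.2 \o p.1).
Proof.
split.
- by move=> [w y] /= [hw hy]; exists y, w.
- move=> [w y] [w' y'] /set_mem[/= hw hy] /set_mem[/= hw' hy'] e.
  (* The Weyl group fixes d, and the h-component of [t_y d] is [y]. *)
  have ey : y = y'.
    have := congr1 (fun f : hatmap R r => (f dhat).1.1) e.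
    by rewrite /= !weyl_dhat// /tC /= !scale1r !add0r => /vecC_inj.
  rewrite -ey in e *; congr (_, _); apply/funext => x.
  by rewrite -[LHS](htransK (vecC y)) -[RHS](htransK (vecC y)); congr (htrans _ _);
    exact: (congr1 (fun f => f x) e).
- by move=> _ [y [w [hy hw ->]]]; exists (w, y).
Qed.

End WeylFinite.

Section Regular.
Context {R : realType} {r : nat} (D : affine_datum R r).
Variable k : hat R r -> R[i].
Hypothesis k_inv : weylY_invariant D k.
Implicit Types (w u : hatmap R r) (x lambda : hat R[i] r) (a b : hat R r) (y : 'cV[R]_r).

Lemma cpair_act w w' a lambda : rigid w -> cancel w w' -> cancel w' w ->
  rigid w' ->
  cpair a (w lambda) = cpair (hatRe (w' (hatC a))) lambda.
Proof.
move=> hw c1 c2 hw'; rewrite /cpair !hatC_hcoroot -(rigid_real hw').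
by rewrite -(rigid_form hw') c1 (rigid_coroot _ hw').
Qed.

(** Moving the point by [w] amounts to moving the affine root by the inverse of [w], and [k] does
    not see the difference. An estimate over all affine roots at one point thereby holds on its
    whole orbit. *)
Lemma cpair_weylY w a lambda : weylY D w -> Rhat D a ->
  exists b, [/\ Rhat D b, k b = k a, forall lambda, cpair a (w lambda) = cpair b lambda &
    w (hatC b) = hatC a].
Proof.
move=> hw ha; have [w' [hw' c1 c2]] := weylY_inv hw.
exists (hatRe (w' (hatC a))); split.
- exact: Rhat_weylY.
- apply: (k_inv hw' ha (Rhat_weylY hw' ha)).
  exact: rigid_real (rigid_weylY hw') a.
- by move=> l; exact: (cpair_act _ _ (rigid_weylY hw) c1 c2 (rigid_weylY hw')).
- by rewrite -(rigid_real (rigid_weylY hw')) c2.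
Qed.

Lemma hreg_weylY w lambda : weylY D w -> hreg D k lambda -> hreg D k (w lambda).
Proof.
move=> hw hl a ha; have [b [hb <- e _]] := cpair_weylY lambda hw ha.
by rewrite e; exact: hl.
Qed.

Lemma hreg_plus_weylY w lambda : weylY D w -> hreg_plus D k lambda ->
  hreg_plus D k (w lambda).
Proof.
move=> hw [h1 h2]; split; first exact: hreg_weylY.
by rewrite (rigid_d (rigid_weylY hw)).
Qed.

End Regular.

(** * Generation by affine simple reflections and Omega *)

Section Generation.
Context {R : realType} {r : nat} (D : affine_datum R r).
Implicit Types (w u : hatmap R r) (x : hat R[i] r) (a b : hat R r) (y : 'cV[R]_r).
Local Notation n := (rank D).

(** [None] indexes [a0], so the affine simple roots form one family over a finite type. *)
Definition fsimple (o : option 'I_n) : hat R r :=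
  if o is Some i then vhat (simple D i) else a0 D.

Lemma FhatP a : Fhat D a <-> exists o, a = fsimple o.
Proof.
split=> [[->|[i ->]]|[[i|] ->]]; [by exists None|by exists (Some i)|right|left] => //.
by exists i.
Qed.

Lemma sum_option (V : nmodType) (F : option 'I_n -> V) :
  \sum_o F o = F None + \sum_i F (Some i).
Proof.
rewrite (bigD1 None)//=; congr (_ + _).
rewrite (reindex_omap Some id) => [|[]//] /=.
by apply: eq_bigl => i; rewrite eqxx.
Qed.

Lemma Rhat_posE a : Rhat_pos D a <->
  Rhat D a /\ exists c : option 'I_n -> nat, a = \sum_o fsimple o *+ c o.
Proof.
split=> -[ha]; [move=> [c0 [c e]]|move=> [c e]]; split => //.
  by exists (fun o => if o is Some i then c i else c0); rewrite sum_option.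
by exists (c None), (fun i => c (Some i)); rewrite e sum_option.
Qed.

Definition comb (c : option 'I_n -> int) : hat R r := \sum_o fsimple o *~ c o.

Lemma hat_sum (I : Type) (s : seq I) (F : I -> hat R r) :
  \sum_(i <- s) F i = (\sum_(i <- s) (F i).1.1, \sum_(i <- s) (F i).1.2, \sum_(i <- s) (F i).2).
Proof. by elim: s => [|i s IH]; rewrite ?big_nil// !big_cons IH. Qed.

Lemma hat_mulz a (m : int) : a *~ m = (a.1.1 *~ m, a.1.2 *~ m, a.2 *~ m).
Proof.
rewrite -[LHS]scaler_int; by apply: hat_eq; rewrite /= ?scaler_int.
Qed.

Lemma combE c : comb c =
  (- (theta D *~ c None) + \sum_i simple D i *~ c (Some i), (c None)%:~R, 0).
Proof.
rewrite /comb sum_option hat_sum hat_mulz; apply: hat_eq => /=.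
- rewrite addr0 mulNrz; congr (_ + _); apply: eq_bigr => i _.
  by rewrite hat_mulz.
- by rewrite oppr0 add0r big1 ?addr0// => i _; rewrite hat_mulz /= mul0rz.
- by rewrite oppr0 addr0 mul0rz add0r big1// => i _; rewrite hat_mulz /= mul0rz.
Qed.

Lemma simple_free (c : 'I_n -> R) : \sum_i c i *: simple D i = 0 -> forall i, c i = 0.
Proof.
move=> e i; have /freeP h := sr_free (simpleP D).
have := h (fun j => c (enum_val j)) _ (enum_rank i).
rewrite enum_rankK; apply; rewrite -[RHS]e (reindex (@enum_rank 'I_n)) /=; last first.
  by exists enum_val => j _; rewrite ?enum_rankK ?enum_valK.
apply: eq_bigr => j _; rewrite enum_rankK; congr (_ *: _).
rewrite (nth_map j); last by rewrite -cardE ltn_ord.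
by congr (simple D _); rewrite -[RHS](enum_rankK j) (enum_val_nth j).
Qed.

(** The coefficient of [a0] is the c-coordinate; once it is removed, freeness of the simple roots
    yields the others. *)
Lemma comb_inj c c' : comb c = comb c' -> c =1 c'.
Proof.
rewrite !combE => -[e1 /intr_inj e2] [i|//].
apply: (@intr_inj R); apply/eqP; rewrite -subr_eq0; apply/eqP.
apply: (@simple_free (fun i => (c (Some i))%:~R - (c' (Some i))%:~R)).
under eq_bigr do rewrite scalerBl !scaler_int.
rewrite sumrB; apply/eqP; rewrite subr_eq0; apply/eqP.
by move: e1; rewrite e2 => /addrI.
Qed.

Lemma Rhat_pos_comb a : Rhat_pos D a <->
  Rhat D a /\ exists2 c, a = comb c & forall o, 0 <= c o.
Proof.
rewrite Rhat_posE; split=> -[ha]; [move=> [c e]|move=> [c e h]]; split => //.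
  by exists (fun o => (c o)%:Z).
exists (fun o => `|c o|%N); rewrite e /comb; apply: eq_bigr => o _.
by rewrite -[in LHS](gez0_abs (h o)).
Qed.

Lemma combD c c' : comb c + comb c' = comb (fun o => c o + c' o).
Proof. by rewrite /comb -big_split /=; apply: eq_bigr => o _; rewrite mulrzDr. Qed.

Lemma combN c : - comb c = comb (fun o => - c o).
Proof. by rewrite /comb -sumrN; apply: eq_bigr => o _; rewrite mulrNz. Qed.

Lemma combZ c (m : int) : comb c *~ m = comb (fun o => c o * m).
Proof. by rewrite /comb mulrz_suml; apply: eq_bigr => o _; rewrite mulrzA. Qed.

Definition delta (o : option 'I_n) (o' : option 'I_n) : int := (o == o')%:R.

Lemma comb_delta o : comb (delta o) = fsimple o.
Proof.
rewrite /comb (bigD1 o)//= /delta eqxx big1 ?addr0// => o' h.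
by rewrite eq_sym (negbTE h).
Qed.

Lemma Rhat_fsimple o : Rhat D (fsimple o).
Proof.
case: o => [i|] /=; apply/RhatP.
  by exists 0; split; [exact: sr_root (simpleP D) i|].
exists 1; rewrite /a0 /= addr0; split; first by apply: PhiN; case: (thetaP D).
by apply: hat_eq; rewrite //= ?addr0 ?oppr0 ?add0r.
Qed.

Lemma Rhat_pos_fsimple o : Rhat_pos D (fsimple o).
Proof.
apply/Rhat_pos_comb; split; first exact: Rhat_fsimple.
by exists (delta o); rewrite ?comb_delta// => o'; rewrite /delta; case: eqP.
Qed.

Lemma RhatN a : Rhat D a -> Rhat D (- a).
Proof.
move=> /RhatP[m [h ->]]; apply/RhatP; exists (- m); split; first exact: PhiN.
by apply: hat_eq; rewrite //= ?rmorphN ?oppr0.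
Qed.

Lemma Rhat_neq0 a : Rhat D a -> a != 0.
Proof. by move=> /RhatP[m [h ->]]; apply/eqP => -[e]; have := Phi_neq0 h; rewrite e eqxx. Qed.

Lemma Rhat_pos_neg a : Rhat_pos D a -> Rhat_pos D (- a) -> False.
Proof.
move=> /Rhat_pos_comb[ha [c e hc]] /Rhat_pos_comb[_ [c' e' hc']].
have : comb (fun o => - c o) = comb c' by rewrite -combN -e e'.
move=> /comb_inj h; have c0 o : c o = 0.
  by apply/le_anti; rewrite hc andbT -oppr_ge0 h hc'.
have := Rhat_neq0 ha; rewrite e /comb big1 ?eqxx// => o _.
by rewrite c0 mulr0z.
Qed.

Lemma theta_coef al : Phi D al -> exists c : 'I_n -> nat,
  theta D + al = \sum_i simple D i *+ c i.
Proof. by move=> /PhiN h; have [_ /(_ _ h)] := thetaP D; rewrite opprK. Qed.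

Lemma theta_pos : exists c : 'I_n -> nat, theta D = \sum_i simple D i *+ c i.
Proof.
have [ht _] := thetaP D; have [c [//|]] := sr_span (simpleP D) ht; first by exists c.
(* Case of a nonpositive combination: [theta + theta] is also a nonnegative one, as [- theta] is a
   root below [theta]. Comparing the two makes all coefficients vanish. *)
move=> e; exists c; have [c' e'] := theta_coef ht.
have z i : ((c' i + 2 * c i)%N%:R : R) = 0.
  apply: (@simple_free (fun i => (c' i + 2 * c i)%N%:R)).
  under eq_bigr do rewrite scaler_nat mulrnDr.
  rewrite big_split /= -e' e.
  under [X in _ + X]eq_bigr do rewrite mulnC mulrnA.
  by rewrite sumrMnl mulr2n addrACA addNr addr0.
have cz i : c i = 0%N.
  by move/eqP: (z i); rewrite pnatr_eq0 addn_eq0 muln_eq0 /= => /andP[_ /eqP].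
by rewrite e !big1 ?oppr0// => i _; rewrite cz.
Qed.

Lemma Rhat_pos_or a : Rhat D a -> Rhat_pos D a \/ Rhat_pos D (- a).
Proof.
(* al + (m + 1) c = (m + 1) a0 + (theta + al) + m theta, where theta + al and theta are nonnegative
   combinations of simple roots. *)
have pos al (m : nat) : Phi D al -> Rhat_pos D (al, m.+1%:R, 0).
  move=> hal; apply/Rhat_pos_comb; split; first by apply/RhatP; exists m.+1%:Z.
  have [c e] := theta_coef hal; have [d e'] := theta_pos.
  exists (fun o => if o is Some i then (c i + m * d i)%:Z else m.+1%:Z); last by case.
  rewrite combE /=; congr (_, _, _).
  under eq_bigr do rewrite -pmulrn mulrnDr mulnC mulrnA.
  rewrite big_split /= -e sumrMnl -e' -pmulrn mulrS.
  by rewrite [theta D + al]addrC -addrA [RHS]addrC addrK.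
move=> ha; have /RhatP[m [hal e]] := ha; case: m e => [[|m]|m] e.
- have [c [ec|ec]] := sr_span (simpleP D) hal; [left|right]; apply/Rhat_pos_comb; split=> //.
  + exists (fun o => if o is Some i then (c i)%:Z else 0); last by case.
    rewrite combE /= mulr0z oppr0 add0r e /=.
    by apply: hat_eq => //=; rewrite ec.
  + exact: RhatN.
  + exists (fun o => if o is Some i then (c i)%:Z else 0); last by case.
    rewrite combE /= mulr0z oppr0 add0r e /=.
    by apply: hat_eq => //=; rewrite ?oppr0// ec opprK.
- by left; rewrite e; exact: pos.
- right; have -> : - a = (- a.1.1, m.+1%:R, 0).
    by rewrite {1}e; apply: hat_eq => //=; rewrite ?oppr0// NegzE rmorphN opprK.
  exact/pos/PhiN.
Qed.

Lemma Phi_coroot_int al be : Phi D al -> Phi D be ->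
  exists m : int, dotv be (coroot al) = m%:~R.
Proof. by move=> h1 h2; exact/intrP/(rs_integral (Phi_root_system D)). Qed.

Lemma hform_Rhat a b : Rhat D a -> Rhat D b -> hform a b = dotv a.1.1 b.1.1.
Proof.
move=> /RhatP[m [_ ->]] /RhatP[m' [_ ->]]; rewrite /hform /=.
by rewrite mulr0 mul0r !addr0.
Qed.

Lemma hrefl_Rhat a b : Rhat D a -> Rhat D b -> exists m : int, hrefl a b = b - a *~ m.
Proof.
move=> ha hb; have /RhatP[_ [h1 _]] := ha; have /RhatP[_ [h2 _]] := hb.
have [m hm] := Phi_coroot_int h1 h2; exists m; rewrite /hrefl -scaler_int; congr (_ - _ *: _).
by rewrite -hm /hcoroot /coroot hformZr dotvZr !hform_Rhat.
Qed.

(** The reflection in al + m c is the reflection in al followed by the translation by - m al^vee. *)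
Lemma sC_weylY a : Rhat D a -> weylY D (sC a).
Proof.
move=> /RhatP[m [hal ea]]; set al := a.1.1 in hal ea.
exists (coroot al *~ (- m)), (sC (vhat al)); split.
- by apply: YMz; apply: (@Y_coroot _ _ D); apply: Zspan_gen; exists al.
- exact: in_weyl_sC.
apply/funext => x; rewrite /= /sC /tC hatC_vhat hrefl_vhat.
have nz : dotv (vecC al) (vecC al) != 0.
  by rewrite dotv_vecC; apply/eqP => /(@toC_inj R _ 0)/eqP; apply/negP; exact: Phi_dot_neq0 hal.
have -> : vecC (coroot al *~ (- m)) = (- m%:~R * (2 / dotv (vecC al) (vecC al))) *: vecC al.
  by rewrite -scaler_int vecCZ toC_int rmorphN -coroot_vecC /coroot scalerA.
have -> : hatC a = vhat (vecC al) + m%:~R *: chat.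
  rewrite ea; apply: hat_eq; rewrite //= ?scaler0 ?addr0// /GRing.scale /=.
    by rewrite mulr1 add0r toC_int.
have e1 : hform x (vhat (vecC al) + m%:~R *: chat) = dotv x.1.1 (vecC al) + m%:~R * x.2.
  rewrite hformDr hformZr hformC hform_vhat dotvC; congr (_ + _ * _).
  by rewrite /hform /= dotv0r mulr0 mulr1 !add0r.
have e2 : hform (vhat (vecC al) + m%:~R *: chat) (vhat (vecC al) + m%:~R *: chat) =
   dotv (vecC al) (vecC al).
  by rewrite /hform /= scaler0 addr0 /GRing.scale /= !mulr0 !addr0 !mul0r mulr0 !addr0.
rewrite /hrefl /hcoroot e2 hformZr e1.
apply: hat_eq => /=.
- rewrite scaler0 addr0 /coroot dotvZr; apply/matrixP => i j.
  by rewrite !mxE; ring.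
- rewrite /GRing.scale /= /coroot !(dotvDl, dotvNl, dotvZl, dotvZr).
  by rewrite mulr1 add0r; field.
- by rewrite /GRing.scale /= mulr0 addr0 mulr0 subr0.
Qed.

(** The reflection alters only the coefficient at [o]. Were the image negative, all other
    coefficients would vanish, making [b] a multiple of the simple affine root, hence that root
    itself as the root system is reduced. *)
Lemma hrefl_pos o b : Rhat_pos D b -> b != fsimple o ->
  Rhat_pos D (hrefl (fsimple o) b).
Proof.
move=> hb ne; have /Rhat_pos_comb[rb [c e hc]] := hb.
have ro := Rhat_fsimple o; have [m em] := hrefl_Rhat ro rb.
have rr : Rhat D (hrefl (fsimple o) b).
  have := Rhat_weylY (sC_weylY ro) rb; by rewrite -hatC_hrefl hatReK.
have [//|neg] := Rhat_pos_or rr; exfalso.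
have /Rhat_pos_comb[_ [d ed hd]] := neg.
have {}ed : comb d = comb (fun o' => - (c o' - delta o o' * m)).
  rewrite -ed em e -(comb_delta o) combZ combN combD combN.
  by [].
have cz o' : o' != o -> c o' = 0.
  move=> h; have := comb_inj ed o'; rewrite /delta eq_sym (negbTE h) mul0r subr0 => e'.
  by apply/le_anti; rewrite hc andbT -oppr_ge0 -e' hd.
have eb : b = fsimple o *~ c o.
  rewrite e -(comb_delta o) combZ; apply: eq_bigr => o' _; congr (_ *~ _).
  rewrite /delta; have [->|h] := eqVneq o o'; first by rewrite mul1r.
  by rewrite mul0r cz// eq_sym.
have /RhatP[_ [h1 _]] := ro; have /RhatP[_ [h2 _]] := rb.
have : Phi D ((c o)%:~R *: (fsimple o).1.1) by move: h2; rewrite {1}eb hat_mulz /= scaler_int.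
move=> /(rs_reduced (Phi_root_system D) h1)[] h.
  have c1 : c o = 1 by apply: (@intr_inj R).
  by move: ne; rewrite eb c1 eqxx.
by have := hc o; rewrite -(ler_int R) h oppr_ge0 ler10.
Qed.

(** Reflections are appended on the right, which fits the cocycle rule: the new factor is evaluated
    at the point itself, the rest at its reflection. *)
Inductive generated : hatmap R r -> Prop :=
| generated_omega o : Omega D o -> generated o
| generated_refl a w : Fhat D a -> generated w -> generated (w \o sC a).

Lemma Fhat_Rhat a : Fhat D a -> Rhat D a.
Proof. by move=> /FhatP[ o ->]; exact: Rhat_fsimple. Qed.

Lemma generated_weylY w : generated w -> weylY D w.
Proof.
elim=> [ o []//|a {}w /Fhat_Rhat ha _ hw].
by apply: weylY_comp => //; exact: sC_weylY.
Qed.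

Definition inversion w a := Rhat_pos D a /\ Rhat_pos D (- hatRe (w (hatC a))).

Lemma hatRe_sum w (c : option 'I_n -> nat) : rigid w ->
  w (hatC (\sum_o fsimple o *+ c o)) = hatC (\sum_o hatRe (w (hatC (fsimple o))) *+ c o).
Proof.
move=> hw; elim/big_rec2: _ => [|o x y _ e].
  have -> : hatC 0 = 0 :> hat R[i] r by rewrite -(scale0r 0) hatCZ toC0 scale0r.
  by rewrite -{1}(scale0r (0 : hat R[i] r)) (rigidZ hw) scale0r.
rewrite !hatCD (rigidD hw) e; congr (_ + _).
by rewrite -[X in _ = hatC X]scaler_nat -[X in w (hatC X)]scaler_nat !hatCZ (rigidZ hw) -(rigid_real hw).
Qed.

(** An element without simple inversions sends the affine simple roots to nonnegative combinations,
    and nonnegative combinations of those are again nonnegative. *)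
Lemma Omega_of w : weylY D w -> (forall a, Fhat D a -> ~ inversion w a) -> Omega D w.
Proof.
move=> hw h; split => // b /Rhat_posE[rb [c e]].
exists (hatRe (w (hatC b))); last exact: rigid_real (rigid_weylY hw) b.
apply/Rhat_pos_comb; split; first exact: Rhat_weylY.
have /choice[d hd] : forall o, exists d, hatRe (w (hatC (fsimple o))) = comb d /\ forall o', 0 <= d o'.
  move=> o; have [] := Rhat_pos_or (Rhat_weylY hw (Rhat_fsimple o)).
    by move=> /Rhat_pos_comb[_ [d ? ?]]; exists d.
  move=> neg; exfalso; apply: (h (fsimple o)); first by apply/FhatP; exists o.
  by split => //; exact: Rhat_pos_fsimple.
exists (fun o' => \sum_o d o o' * (c o)%:Z); last first.
  by move=> o'; apply: sumr_ge0 => o _; apply: mulr_ge0 => //; have [_] := hd o; apply.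
rewrite e hatRe_sum ?hatReK; last exact: rigid_weylY hw.
rewrite /comb; under [RHS]eq_bigr do rewrite mulrz_sumr.
rewrite exchange_big /=; apply: eq_bigr => o _.
have [-> _] := hd o; rewrite -[_ *+ _]/(_ *~ (c o)%:Z) combZ.
by [].
Qed.

(** If the simple root [a] is an inversion of [w], reflecting in [a] carries the inversions of
    [w \o sC a] to inversions of [w] other than [a], so a list containing them gets shorter. *)
Lemma generated_bounded (N : nat) (s : seq (hat R r)) w : weylY D w -> (size s <= N)%N ->
  (forall a, inversion w a -> a \in s) -> generated w.
Proof.
elim: N s w => [|N IH] s w hw sN hs.
  apply: generated_omega; apply: Omega_of => // a _ /hs.
  by move: sN; rewrite leqn0 => /nilP ->.
have [|] := pselect (exists2 a, Fhat D a & inversion w a); last first.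
  move=> h; apply: generated_omega; apply: Omega_of => // a ha ia; apply: h.
  by exists a.
move=> [a ha ia]; have /FhatP[ o eo] := ha.
have ra : Rhat D a by rewrite eo; exact: Rhat_fsimple.
have sa : hrefl a a = - a.
  by apply: hrefl_self; rewrite hform_Rhat//; have /RhatP[m [h _]] := ra; exact: Phi_dot_neq0 h.
have -> : w = (w \o sC a) \o sC a by apply/funext => x /=; rewrite /sC hreflK.
apply: generated_refl => //.
apply: (IH (map (hrefl a) (rem a s))).
- by apply: weylY_comp => //; exact: sC_weylY.
- rewrite size_map size_rem; last exact: hs.
  by move: sN; case: (s) => //=.
- move=> b [pb nb]; move: nb; rewrite /= -hatC_hrefl => nb.
  have nab : b != a.
    apply/eqP => e; move: nb; rewrite e sa hatCN.
    have -> : hatRe (w (- hatC a)) = - hatRe (w (hatC a)).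
      rewrite (rigidN _ (rigid_weylY hw)) {1}(rigid_real (rigid_weylY hw)) -hatCN hatReK.
      by [].
    rewrite opprK => p; exact: (Rhat_pos_neg p ia.2).
  have pb' : Rhat_pos D (hrefl a b) by rewrite eo; apply: hrefl_pos => //; rewrite -eo.
  have nab' : hrefl a b != a.
    apply/eqP => e; have eb : b = - a by rewrite -[b](hreflK a) e sa.
    rewrite eb in pb; exact: (Rhat_pos_neg ia.1 pb).
  apply/mapP; exists (hrefl a b); last by rewrite hreflK.
  by apply: rem_mem => //; exact: hs.
Qed.

Lemma weylY_generated w : weylY D w -> generated w.
Proof.
move=> hw; have := hw => -[y [w0 [Yy hw0 ew]]].
(* With w = t_y w0 and be = w0 al, the root al + m c goes to be + (m - (be, y)) c. Positivity of the
   first gives 0 <= m and negativity of the second gives m <= (be, y): there are finitely many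
   inversions. *)
pose B := (\max_(al <- Phis D) Num.truncn `|dotv al y|).+1.
pose s := [seq (al, m%:R, 0) : hat R r | al <- Phis D, m <- iota 0 B].
apply: (@generated_bounded (size s) s) => // a [pa na].
have /Rhat_pos_comb[ra [c ec hc]] := pa; have /Rhat_pos_comb[_ [d ed hd]] := na.
have /RhatP[m [ha ea]] := ra.
have em : m = c None.
  by apply: (@intr_inj R); have := congr1 (fun z : hat R r => z.1.2) ec; rewrite combE ea.
have m0 : 0 <= m by rewrite em.
have [be hbe ebe] := weyl_Phi hw0 ha.
have ewa : hatRe (w (hatC a)) = (be, m%:~R - dotv be y, 0).
  rewrite ew /= ea.
  have -> : hatC (a.1.1, m%:~R, 0) = vhat (vecC a.1.1) + m%:~R *: chat.
    apply: hat_eq; rewrite //= ?scaler0 ?addr0// /GRing.scale /=.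
      by rewrite mulr1 add0r toC_int.
  rewrite (rigidD (rigid_weyl hw0)) (rigidZ (rigid_weyl hw0)) (rigid_c (rigid_weyl hw0)) ebe.
  have -> : vhat (vecC be) + m%:~R *: chat = hatC (be, m%:~R, 0).
    apply/esym/hat_eq; rewrite //= ?scaler0 ?addr0// /GRing.scale /=.
      by rewrite mulr1 add0r toC_int.
  rewrite -hatC_htrans hatReK; apply: hat_eq => //=; first by rewrite scale0r addr0.
  by rewrite mul0r mul0r subr0.
have le : m%:~R <= dotv be y.
  have := congr1 (fun z : hat R r => z.1.2) ed; rewrite combE ewa /= opprB => e.
  by rewrite -subr_ge0 e ler0z.
apply/allpairsP; exists (a.1.1, `|m|%N); split; first exact/PhisP.
  rewrite mem_iota /= add0n /B ltnS.
  apply: leq_trans (_ : (Num.truncn `|dotv be y| <= _)%N); last first.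
    apply: (leq_bigmax_seq (F := fun al => Num.truncn `|dotv al y|)) => //; exact/PhisP.
  rewrite truncn_ge_nat//.
  by rewrite natr_absz ger0_norm// (le_trans le)// ler_norm.
by rewrite ea /= natr_absz ger0_norm.
Qed.

End Generation.

(** * Matrices of the cocycle *)

Section GroupAlgebra.
Context {R : realType} {r m : nat} (D : affine_datum R r).
Variable pi : hatmap R r -> 'M[R[i]]_m.
Hypothesis pi_module : is_module D pi.
Implicit Types (w u : hatmap R r) (f g : galg R r) (S : {fset hatmap R r}).

Definition supported S f := (forall u, u \in S -> weylY D u) /\ (forall u, u \notin S -> f u = 0).

Lemma galg_End_fset S f : supported S f -> galg_End D pi f = \sum_(u <- S) f u *: pi u.
Proof.
move=> [SW Sf]; rewrite /galg_End.
have <- : \sum_(u \in [set` S]) f u *: pi u = \sum_(u \in weylY D) f u *: pi u.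
  apply: fsbig_widen => //= u [_ /= /negP uS]; by rewrite Sf ?scale0r.
by rewrite fsbig_finite//= set_fsetK.
Qed.

Lemma sum_gelt S w (F : hatmap R r -> 'M[R[i]]_m) : w \in S ->
  \sum_(u <- S) gelt w u *: F u = F w.
Proof.
move=> wS; rewrite (big_fsetD1 _ wS) /= /gelt eqxx scale1r big_seq big1 ?addr0// => u.
by rewrite !inE => /andP[/negbTE -> _]; rewrite scale0r.
Qed.

Lemma galg_End_lin2 w u (a b : R[i]) : weylY D w -> weylY D u ->
  galg_End D pi (fun x => a * gelt w x + b * gelt u x) = a *: pi w + b *: pi u.
Proof.
move=> hw hu; rewrite (@galg_End_fset [fset w; u]%fset); last first.
  split=> x; first by rewrite !inE => /orP[] /eqP ->.
  by rewrite !inE negb_or /gelt => /andP[/negbTE -> /negbTE ->]; rewrite !mulr0 addr0.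
under eq_bigr do rewrite scalerDl -!scalerA.
by rewrite big_split /= -!scaler_sumr !sum_gelt// !inE eqxx ?orbT.
Qed.

Lemma galg_End_gelt w : weylY D w -> galg_End D pi (gelt w) = pi w.
Proof.
move=> hw; have := galg_End_lin2 1 0 hw hw; rewrite scale1r scale0r addr0 => <-.
by congr galg_End; apply/funext => u; rewrite mul1r mul0r addr0.
Qed.

Lemma gmul_fset S T f g w : supported S f -> supported T g ->
  gmul f g w = \sum_(p <- (S `*` T)%fset | p.1 \o p.2 == w) f p.1 * g p.2.
Proof.
move=> [SW Sf] [TW Tg]; rewrite /gmul.
pose Q := [fset p in (S `*` T)%fset | p.1 \o p.2 == w]%fset.
have <- : \sum_(p \in [set` Q]) f p.1 * g p.2 =
   \sum_(p \in [set p : hatmap R r * hatmap R r | p.1 \o p.2 = w]) f p.1 * g p.2.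
  apply: fsbig_widen => [p /=|p [/= pw /negP]].
    by rewrite !inE => /andP[_ /eqP].
  rewrite !inE pw eqxx andbT negb_and => /orP[h|h].
    by rewrite Sf ?mul0r.
  by rewrite Tg ?mulr0.
by rewrite fsbig_finite//= set_fsetK [RHS]big_fset_condE.
Qed.

(** Known finite supports turn the sums over all self-maps in [gmul] and over the group in
    [galg_End] into finite sums, which may be exchanged. *)
Lemma galg_End_mul S T f g : supported S f -> supported T g ->
  galg_End D pi (gmul f g) = galg_End D pi f *m galg_End D pi g.
Proof.
move=> hS hT; pose cmp (p : hatmap R r * hatmap R r) : hatmap R r := p.1 \o p.2.
pose Q := (cmp @` (S `*` T))%fset.
have sQ : supported Q (gmul f g).
  split=> [u /imfsetP[p /=]|u uQ].
    rewrite in_fsetM => /andP[h1 h2] ->; apply: weylY_comp; [exact: hS.1|exact: hT.1].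
  rewrite (gmul_fset u hS hT) big1_seq// => p /andP[/eqP e pS].
  by case/negP: uQ; apply/imfsetP; exists p.
rewrite (galg_End_fset sQ) (galg_End_fset hS) (galg_End_fset hT).
under eq_bigr do rewrite (gmul_fset _ hS hT) scaler_suml big_mkcond /=.
rewrite exchange_big /=.
rewrite [LHS]big_seq mulmx_suml.
under [RHS]eq_bigr do rewrite mulmx_sumr.
rewrite -(big_fsetM S T (fun p => (f p.1 *: pi p.1) *m (g p.2 *: pi p.2))) [RHS]big_seq.
apply: eq_bigr => p pST; have pQ : p.1 \o p.2 \in Q by apply/imfsetP; exists p.
rewrite (big_fsetD1 _ pQ) /= eqxx big_seq big1 ?addr0; last first.
  by move=> u; rewrite !inE => /andP[h _]; rewrite eq_sym (negbTE h).
move: pST; rewrite in_fsetM => /andP[h1 h2]; have {}h1 := hS.1 _ h1; have {}h2 := hT.1 _ h2.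
by rewrite pi_module.2// -scalemxAl -scalemxAr scalerA.
Qed.

End GroupAlgebra.

Section CocycleMatrices.
Context {R : realType} {r m : nat} (D : affine_datum R r).
Variable k : hat R r -> R[i].
Hypothesis k_inv : weylY_invariant D k.
Variable J : hatmap R r -> hat R[i] r -> galg R r.
Hypothesis J_cocycle : is_cocycle D k J.
Variable pi : hatmap R r -> 'M[R[i]]_m.
Hypothesis pi_module : is_module D pi.
Implicit Types (w u : hatmap R r) (lambda : hat R[i] r).

Local Notation JMw := (JM D pi J).

Lemma J_supported w : weylY D w -> exists S, forall lambda, hreg D k lambda ->
  supported D S (J w lambda).
Proof.
move=> hw; have [S [/finite_fsetP[T ->] SW] h] := J_supp J_cocycle hw.
exists T => lambda hl; split=> u; first exact: SW.
by move=> /negP uT; exact: h.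
Qed.

Lemma JM_mul u w lambda : weylY D u -> weylY D w -> hreg D k lambda ->
  JMw (u \o w) lambda = JMw u (w lambda) *m JMw w lambda.
Proof.
move=> hu hw hl; rewrite /JM (J_mul J_cocycle)//.
have [S hS] := J_supported hu; have [T hT] := J_supported hw.
apply: (@galg_End_mul _ _ _ _ _ pi_module S T); last exact: hT.
apply: hS; exact: hreg_weylY.
Qed.

Lemma JM_omega o lambda : Omega D o -> hreg D k lambda -> JMw o lambda = pi o.
Proof.
move=> ho hl; rewrite /JM (J_omega J_cocycle)// galg_End_gelt//.
by case: ho.
Qed.

Lemma Omega_id : Omega D id.
Proof. by split=> [|a ha]; [exact: weylY_id|exists a]. Qed.

Lemma JM_id lambda : hreg D k lambda -> JMw id lambda = 1%:M.
Proof. by move=> hl; rewrite JM_omega//; [case: pi_module|exact: Omega_id]. Qed.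

Lemma JM_refl a lambda : Fhat D a -> hreg D k lambda ->
  JMw (sC a) lambda = pi (sC a) +
    (k a / (cpair a lambda - k a)) *: (pi (sC a) + 1%:M).
Proof.
move=> ha hl; have ra := Fhat_Rhat ha.
rewrite /JM (J_refl J_cocycle ha hl).
set z := cpair a lambda.
have zk : z - k a != 0 by rewrite subr_eq0; case: (hl a ra).
have -> : (fun u => (z * gelt (sC a) u + k a * gelt id u) / (z - k a)) =
   fun u => (z / (z - k a)) * gelt (sC a) u + (k a / (z - k a)) * gelt id u.
  by apply/funext => u; field.
rewrite galg_End_lin2//; [|exact: sC_weylY|exact: weylY_id].
rewrite pi_module.1 scalerDr addrA; congr (_ + _).
by rewrite -[X in _ = X + _]scale1r -scalerDl; congr (_ *: _); field.
Qed.

Lemma chat_weylY w (s : R[i]) lambda : weylY D w -> w (lambda + s *: chat) = w lambda + s *: chat.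
Proof.
move=> hw; have hr := rigid_weylY hw.
by rewrite (rigidD hr) (rigidZ hr) (rigid_c hr).
Qed.

Lemma cpair_chat a (s : R[i]) lambda : Rhat D a -> cpair a (lambda + s *: chat) = cpair a lambda.
Proof.
move=> /RhatP[n [_ ->]]; rewrite /cpair hformDr hformZr [X in _ + _ * X](_ : _ = 0) ?mulr0 ?addr0//.
by rewrite /hform /= /hcoroot /= /GRing.scale /= dotv0r !mulr0 toC0 mul0r !addr0.
Qed.

Lemma hreg_chat (s : R[i]) lambda : hreg D k lambda -> hreg D k (lambda + s *: chat).
Proof. by move=> hl a ha; rewrite cpair_chat//; exact: hl. Qed.

(** Affine roots have no d-component, so their pairings, and with them the generator matrices, are
    constant along c. The dependence on this direction sits in the exponential alone. *)
Lemma JM_chat w (s : R[i]) lambda : weylY D w -> hreg D k lambda ->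
  JMw w (lambda + s *: chat) = JMw w lambda.
Proof.
move=> /weylY_generated gw; elim: gw lambda => [ o ho|a {}w ha gw IH] lambda hl.
  by rewrite !JM_omega//; exact: hreg_chat.
have hw := generated_weylY gw.
have hs := sC_weylY (Fhat_Rhat ha).
rewrite (JM_mul hw hs hl) (JM_mul hw hs (hreg_chat s hl)).
rewrite (JM_refl ha hl) (JM_refl ha (hreg_chat s hl)).
rewrite cpair_chat; last exact: Fhat_Rhat.
by rewrite chat_weylY// IH//; exact: hreg_weylY.
Qed.

End CocycleMatrices.

(** * Functions with a controlled second order expansion *)

Section MatrixNorm.
Context {R : realType} {m : nat}.
Implicit Types M N : 'M[R[i]]_m.

(** An l1 norm on entries: real valued, submultiplicative, and at least the modulus of every
    entry. *)
Definition mn M : R := \sum_i \sum_j cabs (M i j).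

Lemma mn_ge0 M : 0 <= mn M.
Proof. by do 2 (apply: sumr_ge0 => ? _); exact: cabs_ge0. Qed.

Lemma mnD M N : mn (M + N) <= mn M + mn N.
Proof.
rewrite /mn -big_split; apply: ler_sum => i _ /=; rewrite -big_split.
by apply: ler_sum => j _; rewrite mxE cabsD.
Qed.

Lemma mnZ (c : R[i]) M : mn (c *: M) = cabs c * mn M.
Proof.
rewrite /mn mulr_sumr; apply: eq_bigr => i _; rewrite mulr_sumr.
by apply: eq_bigr => j _; rewrite mxE cabsM.
Qed.

Lemma mnM M N : mn (M *m N) <= mn M * mn N.
Proof.
rewrite /mn mulr_suml; apply: ler_sum => i _.
apply: le_trans (_ : \sum_j \sum_l cabs (M i l) * cabs (N l j) <= _).
  apply: ler_sum => j _; rewrite mxE; apply: le_trans (cabs_sum _ _ _) _.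
  by apply: ler_sum => l _; rewrite cabsM.
rewrite exchange_big /= mulr_suml; apply: ler_sum => l _.
rewrite -mulr_sumr ler_wpM2l ?cabs_ge0//.
by rewrite [leRHS](bigD1 l)//= lerDl sumr_ge0// => ? _; apply: sumr_ge0 => ? _; exact: cabs_ge0.
Qed.

Lemma cabs_le_mn M i j : cabs (M i j) <= mn M.
Proof.
rewrite /mn (bigD1 i)//= (bigD1 j)//= -addrA lerDl addr_ge0 ?sumr_ge0// => [? _|? _].
  exact: cabs_ge0.
by apply: sumr_ge0 => ? _; exact: cabs_ge0.
Qed.

End MatrixNorm.

Section Controlled.
Context {R : realType} {r m : nat}.
Implicit Types (lambda h : hat R[i] r) (G : hat R[i] r -> 'M[R[i]]_m) (rho A : R).

Definition linear_map (L : hat R[i] r -> 'M[R[i]]_m) :=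
  (forall h h', L (h + h') = L h + L h') /\ (forall c h, L (c *: h) = c *: L h).

(* One constant bounds value, differential and second order remainder, because
   such bounds multiply under products. *)
Definition ctrl lambda rho A G := exists L, [/\ linear_map L,
  mn (G lambda) <= A, forall h, mn (L h) <= A * hn h &
  forall h, hn h <= rho -> mn (G (lambda + h) - G lambda - L h) <= A * hn h ^+ 2].

Lemma ctrl_ge0 lambda rho A G : ctrl lambda rho A G -> 0 <= A.
Proof. by move=> [L [_ h _ _]]; exact: le_trans (mn_ge0 _) h. Qed.

Lemma ctrl_le lambda rho A A' G : A <= A' -> ctrl lambda rho A G -> ctrl lambda rho A' G.
Proof.
move=> AA [L [lL h1 h2 h3]]; exists L; split => //.
- exact: le_trans h1 AA.
- by move=> h; apply: le_trans (h2 h) _; rewrite ler_wpM2r ?hn_ge0.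
- by move=> h /h3 h'; apply: le_trans h' _; rewrite ler_wpM2r ?exprn_ge0 ?hn_ge0.
Qed.

Lemma ctrl_radius lambda rho rho' A G : rho' <= rho -> ctrl lambda rho A G -> ctrl lambda rho' A G.
Proof.
move=> rr [L [lL h1 h2 h3]]; exists L; split => // h hh; apply: h3; exact: le_trans rr.
Qed.

Lemma hn0 : hn (0 : hat R[i] r) = 0.
Proof. by rewrite -(scale0r 0) hnZ cabs0 mul0r. Qed.

Lemma ctrl_ext lambda rho A G G' : 0 <= rho ->
  (forall h, hn h <= rho -> G (lambda + h) = G' (lambda + h)) ->
  ctrl lambda rho A G -> ctrl lambda rho A G'.
Proof.
move=> r0 e [L [lL h1 h2 h3]].
have e0 : G lambda = G' lambda by have := e 0; rewrite addr0 hn0 => /(_ r0).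
exists L; split => //; first by rewrite -e0.
by move=> h hh; rewrite -e0 -e//; exact: h3.
Qed.

Lemma ctrl_cst lambda rho M : ctrl lambda rho (mn M) (fun=> M).
Proof.
exists (fun=> 0); have z : mn (0 : 'M[R[i]]_m) = 0.
  by rewrite -(scale0r 0) mnZ cabs0 mul0r.
split => //.
- by split=> *; rewrite ?addr0 ?scaler0.
- by move=> h; rewrite z mulr_ge0 ?mn_ge0 ?hn_ge0.
- by move=> h _; rewrite subrr subr0 z mulr_ge0 ?mn_ge0 ?exprn_ge0 ?hn_ge0.
Qed.

(** Each factor is value plus differential plus remainder; six of the nine products are of order at
    least two, whence the 6. The condition [rho <= 1] reduces the powers 3 and 4 of [hn h] to 2. *)
Lemma ctrl_mul lambda rho A1 A2 G1 G2 : rho <= 1 ->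
  ctrl lambda rho A1 G1 -> ctrl lambda rho A2 G2 ->
  ctrl lambda rho (6 * A1 * A2) (fun l => G1 l *m G2 l).
Proof.
move=> r1 c1 c2; have A10 := ctrl_ge0 c1; have A20 := ctrl_ge0 c2.
have [L1 [[lD1 lZ1] a1 b1 q1]] := c1; have [L2 [[lD2 lZ2] a2 b2 q2]] := c2.
have A12 : 0 <= A1 * A2 by exact: mulr_ge0.
exists (fun h => L1 h *m G2 lambda + G1 lambda *m L2 h); split.
- split=> [h h'|c h]; first by rewrite lD1 lD2 mulmxDl mulmxDr addrACA.
  by rewrite lZ1 lZ2 -scalemxAl -scalemxAr scalerDr.
- apply: le_trans (mnM _ _) _; apply: le_trans (ler_pM (mn_ge0 _) (mn_ge0 _) a1 a2) _.
  by rewrite -mulrA ler_peMl// ler1n.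
- move=> h; apply: le_trans (mnD _ _) _.
  have := le_trans (mnM (L1 h) (G2 lambda)) (ler_pM (mn_ge0 _) (mn_ge0 _) (b1 h) a2).
  have := le_trans (mnM (G1 lambda) (L2 h)) (ler_pM (mn_ge0 _) (mn_ge0 _) a1 (b2 h)).
  have p : 0 <= A1 * A2 * hn h by rewrite mulr_ge0// hn_ge0.
  move=> e1 e2; apply: le_trans (lerD e2 e1) _; nra.
- move=> h hh; have {}q1 := q1 h hh; have {}q2 := q2 h hh.
  have {}b1 := b1 h; have {}b2 := b2 h.
  set R1 := G1 (lambda + h) - G1 lambda - L1 h in q1.
  set R2 := G2 (lambda + h) - G2 lambda - L2 h in q2.
  have e1 : G1 (lambda + h) = G1 lambda + L1 h + R1 by apply/matrixP => i j; rewrite !mxE; ring.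
  have e2 : G2 (lambda + h) = G2 lambda + L2 h + R2 by apply/matrixP => i j; rewrite !mxE; ring.
  have -> : G1 (lambda + h) *m G2 (lambda + h) - G1 lambda *m G2 lambda -
     (L1 h *m G2 lambda + G1 lambda *m L2 h) =
     R1 *m G2 lambda + R1 *m L2 h + R1 *m R2 + (G1 lambda *m R2 + L1 h *m R2 + L1 h *m L2 h).
    rewrite e1 e2 !(mulmxDl, mulmxDr) !opprD.
    set x1 := G1 lambda *m G2 lambda; set x2 := G1 lambda *m L2 h.
    set x3 := G1 lambda *m R2; set x4 := L1 h *m G2 lambda; set x5 := L1 h *m L2 h.
    set x6 := L1 h *m R2; set x7 := R1 *m G2 lambda; set x8 := R1 *m L2 h; set x9 := R1 *m R2.
    by apply/matrixP => i j; rewrite !mxE; ring.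
  have t0 := hn_ge0 h; have t1 : hn h <= 1 by exact: le_trans hh r1.
  set t := hn h in q1 q2 b1 b2 t0 t1 *.
  have mm := mnM.
  have P X Y (a b : R) : mn X <= a -> mn Y <= b -> mn (X *m Y : 'M[R[i]]_m) <= a * b.
    by move=> ha hb; apply: le_trans (mnM _ _) (ler_pM (mn_ge0 _) (mn_ge0 _) ha hb).
  pose K := A1 * A2 * t ^+ 2.
  have K0 : 0 <= K by rewrite mulr_ge0// exprn_ge0.
  have Kt : K * t <= K by rewrite ler_piMr.
  have Ktt : K * t * t <= K by apply: le_trans Kt; rewrite ler_piMr// mulr_ge0.
  have p1 : mn (R1 *m G2 lambda) <= K.
    by apply: le_trans (P _ _ _ _ q1 a2) _; rewrite /K mulrAC.
  have p2 : mn (R1 *m L2 h) <= K.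
    by apply: le_trans (P _ _ _ _ q1 b2) _; rewrite (_ : _ * _ = K * t)// /K; ring.
  have p3 : mn (R1 *m R2) <= K.
    by apply: le_trans (P _ _ _ _ q1 q2) _; rewrite (_ : _ * _ = K * t * t)// /K; ring.
  have p4 : mn (G1 lambda *m R2) <= K.
    by apply: le_trans (P _ _ _ _ a1 q2) _; rewrite /K mulrA.
  have p5 : mn (L1 h *m R2) <= K.
    by apply: le_trans (P _ _ _ _ b1 q2) _; rewrite (_ : _ * _ = K * t)// /K; ring.
  have p6 : mn (L1 h *m L2 h) <= K.
    by apply: le_trans (P _ _ _ _ b1 b2) _; rewrite (_ : _ * _ = K)// /K; ring.
  rewrite (_ : 6 * A1 * A2 * t ^+ 2 = K + K + K + (K + K + K)); last by rewrite /K; ring.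
  apply: le_trans (mnD _ _) (lerD _ _).
    apply: le_trans (mnD _ _) (lerD _ p3); exact: le_trans (mnD _ _) (lerD p1 p2).
  apply: le_trans (mnD _ _) (lerD _ p6); exact: le_trans (mnD _ _) (lerD p4 p5).
Qed.

(** With Q = exp(rho N), the summands of the constant come from 1 <= Q, N <= Q / rho and N^2 <= 2 Q
    / rho^2; a second Q bounds the exponential in the remainder. [N] will grow quadratically with
    the translation, so [rho] stays a parameter to be taken small. *)
Lemma ctrl_cexp lambda rho (l : hat R[i] r -> R[i]) (N : R) :
  (forall h h', l (h + h') = l h + l h') -> (forall c h, l (c *: h) = c * l h) ->
  (forall h, cabs (l h) <= N * hn h) -> 0 < rho -> 0 <= N ->
  ctrl lambda rho ((1 + rho^-1 + 2 / rho ^+ 2) * expR (complex.Re (l lambda) + 2 * rho * N) * mn (1%:M : 'M[R[i]]_m))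
    (fun x => (cexp (l x))%:M).
Proof.
move=> lD lZ lN r0 N0; set e := cexp (l lambda).
have rN : 0 <= rho * N by rewrite mulr_ge0// ltW.
have e1 : 1 + rho * N <= expR (rho * N) by exact: expR_ge1Dx.
have e2 := sq_le_expR rN.
have E1 : 1 <= expR (rho * N) by apply: le_trans e1; rewrite lerDl.
have sc (c : R[i]) : c%:M = c *: (1%:M : 'M[R[i]]_m) by rewrite scale_scalar_mx mulr1.
pose Q := expR (rho * N).
have E2 : expR (complex.Re (l lambda) + 2 * rho * N) = cabs e * (Q * Q).
  by rewrite /e cabs_cexp -!expRD /Q; congr expR; ring.
have Q0 : 0 <= Q by exact: expR_ge0.
have i0 : 0 <= rho^-1 by rewrite invr_ge0 ltW.
have i2 : 0 <= 2 / rho ^+ 2 by rewrite divr_ge0// exprn_ge0// ltW.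
have bN : N <= rho^-1 * Q.
  by rewrite ler_pdivlMl//; apply: le_trans e1; rewrite lerDr.
have bN2 : N ^+ 2 <= 2 / rho ^+ 2 * Q.
  rewrite mulrAC ler_pdivlMr ?exprn_gt0// mulrC -exprMn; exact: e2.
pose c := 1 + rho^-1 + 2 / rho ^+ 2; rewrite -/c E2.
have m0 := mn_ge0 (1%:M : 'M[R[i]]_m); have ce := cabs_ge0 e.
have QQ : Q <= Q * Q by rewrite ler_peMl.
have c1 : 1 <= c by rewrite /c; lra.
have c2 : rho^-1 <= c by rewrite /c; lra.
have c3 : 2 / rho ^+ 2 <= c by rewrite /c; lra.
have c0 : 0 <= c by lra.
have fin (X : R) : X <= c * (Q * Q) -> cabs e * X * mn (1%:M : 'M[R[i]]_m) <=
    c * (cabs e * (Q * Q)) * mn (1%:M : 'M[R[i]]_m).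
  by move=> hX; rewrite ler_wpM2r// mulrCA ler_wpM2l.
exists (fun h => (e * l h)%:M); split.
- split=> [h h'|a h]; first by rewrite lD mulrDr raddfD.
  by rewrite lZ mulrCA scale_scalar_mx.
- rewrite sc mnZ -/e; have := fin 1; rewrite mulr1; apply.
  by rewrite -[1]mulr1 ler_pM// (le_trans E1).
- move=> h; rewrite sc mnZ cabsM; apply: le_trans (_ : cabs e * N * mn (1%:M : 'M[R[i]]_m) * hn h <= _).
    by rewrite [leRHS]mulrAC ler_wpM2r// -[leRHS]mulrA ler_wpM2l.
  rewrite ler_wpM2r ?hn_ge0//; apply: fin; apply: le_trans bN _; apply: ler_pM => //.
- move=> h hh; rewrite lD cexpD -/e -!raddfB /= sc mnZ.
  have -> : e * cexp (l h) - e - e * l h = e * (cexp (l h) - 1 - l h) by ring.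
  have lr : cabs (l h) <= rho * N.
    by apply: le_trans (lN h) _; rewrite mulrC ler_wpM2r.
  rewrite cabsM; apply: le_trans (_ : cabs e * (N ^+ 2 * Q) * mn (1%:M : 'M[R[i]]_m) * hn h ^+ 2 <= _).
    rewrite [leRHS]mulrAC ler_wpM2r// -[leRHS]mulrA ler_wpM2l//.
    apply: le_trans (cexp_remainder _) _; rewrite [leRHS]mulrAC -exprMn; apply: ler_pM.
    + by rewrite exprn_ge0 ?cabs_ge0.
    + exact: expR_ge0.
    + by apply: lerXn2r; rewrite ?nnegrE ?cabs_ge0 ?mulr_ge0 ?hn_ge0.
    + by rewrite ler_expR.
  rewrite ler_wpM2r ?exprn_ge0 ?hn_ge0//; apply: fin; rewrite mulrA ler_wpM2r//.
  by apply: le_trans bN2 _; rewrite ler_wpM2r.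
Qed.

End Controlled.

(** * Uniform bounds on the orbit of a regular point *)

Section RegularBounds.
Context {R : realType} {r m : nat} (D : affine_datum R r).
Variable k : hat R r -> R[i].
Hypothesis k_inv : weylY_invariant D k.
Implicit Types (w u : hatmap R r) (lambda h : hat R[i] r) (a b : hat R r).

Lemma uniform_constant (T : eqType) (s : seq T) (P : T -> R -> Prop) :
  (forall x c c', 0 < c' -> c' <= c -> P x c -> P x c') ->
  (forall x, x \in s -> exists2 c, 0 < c & P x c) ->
  exists2 c, 0 < c & forall x, x \in s -> P x c.
Proof.
move=> mono; elim: s => [_|x s IH h]; first by exists 1.
have [|c c0 hc] := IH; first by move=> y ys; apply: h; rewrite inE ys orbT.
have [d d0 hd] := h x (mem_head _ _).
have m0 : 0 < Num.min c d by rewrite lt_min c0 d0.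
exists (Num.min c d) => // y; rewrite inE => /orP[/eqP ->|/hc].
  by apply: mono hd => //; rewrite ge_min lexx orbT.
by apply: mono => //; rewrite ge_min lexx.
Qed.

(** For large indices [n q] dominates [p]; the finitely many others contribute a minimum of positive
    quantities. *)
Lemma arith_progression_bound (p q : R[i]) : q != 0 -> exists2 c : R, 0 < c &
  forall n : int, p + n%:~R * q != 0 -> c * (1 + `|n|%:~R) <= cabs (p + n%:~R * q).
Proof.
move=> q0; have cq : 0 < cabs q by rewrite cabs_gt0.
(* For |n| >= B, |p| is at most (|n| - 1) |q| / 2, which leaves |p + n q| >= (|n| + 1) |q| / 2. *)
pose B := 2 * cabs p / cabs q + 1.
pose N := (Num.truncn B).+1.
have BN : B < N%:R by exact: truncnS_gt.
have cn (n : int) : cabs (n%:~R * q) = `|n|%:~R * cabs q.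
  by rewrite cabsM -toC_int cabs_toC intr_norm.
have [c c0 hc] : exists2 c : R, 0 < c & forall n, n \in [seq (x%:Z - N%:Z) | x <- iota 0 (2 * N).+1] ->
   p + n%:~R * q != 0 -> c * (1 + `|n|%:~R) <= cabs (p + n%:~R * q).
  apply: uniform_constant => [n c c' _ cc h /h|n _].
    by apply: le_trans; rewrite ler_wpM2r// addr_ge0.
  have [->|nz] := eqVneq (p + n%:~R * q) 0; first by exists 1 => //; rewrite eqxx.
  have n1 : 0 < 1 + `|n|%:~R :> R by rewrite ltr_pwDl// ler0z.
  by exists (cabs (p + n%:~R * q) / (1 + `|n|%:~R)); rewrite ?divr_gt0 ?cabs_gt0// divfK ?gt_eqF.
exists (Num.min c (cabs q / 4)) => [|n nz]; first by rewrite lt_min c0 divr_gt0.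
have n0 : 0 <= `|n|%:~R :> R by rewrite ler0z.
have [hN|hN] := lerP `|n| N%:Z.
  apply: le_trans (hc n _ nz); first by rewrite ler_wpM2r ?addr_ge0// ge_min lexx.
  move: hN; rewrite ler_norml => /andP[h1 h2].
  apply/mapP; exists (absz (n + N%:Z)%R); first by rewrite mem_iota /=; lia.
  by lia.
apply: le_trans (_ : cabs q / 4 * (1 + `|n|%:~R) <= _).
  by rewrite ler_wpM2r ?addr_ge0// ge_min lexx orbT.
have nN : (N%:R : R) <= `|n|%:~R by rewrite -[N%:R]/((N%:Z)%:~R) ler_int ltW.
have nB : B <= `|n|%:~R by rewrite (le_trans (ltW BN)).
have t : cabs (n%:~R * q) <= cabs (p + n%:~R * q) + cabs p.
  by rewrite -{1}(addKr p (n%:~R * q)) addrC; apply: le_trans (cabsD _ _) _; rewrite cabsN.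
rewrite cn in t.
have : 2 * cabs p + cabs q <= `|n|%:~R * cabs q.
  rewrite -ler_pdivrMr//; apply: le_trans nB.
  by rewrite mulrDl divff// gt_eqF.
move: t; set X := cabs (p + _); set Y := `|n|%:~R; nra.
Qed.

Lemma modz2 (n : int) : (n %% 2)%Z = 0 \/ (n %% 2)%Z = 1.
Proof.
have := @modz_ge0 n 2 isT; have := @ltz_pmod n 2 isT.
by case: (modz _ _) => [[|[|]]|] //; [left|right].
Qed.

(** As (al, al^vee) = 2, translation by a multiple of the coroot brings [n] to its remainder modulo
    2. *)
Lemma k_even (al : 'cV[R]_r) (n : int) : Phi D al ->
  k (al, n%:~R, 0) = k (al, ((n %% 2)%Z)%:~R, 0).
Proof.
move=> hal.
have ra (n' : int) : Rhat D (al, n'%:~R, 0) by apply/RhatP; exists n'.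
apply: (k_inv (w := tC (coroot al *~ - (n %/ 2)%Z)) _ (ra _) (ra _)).
  apply/weylY_tC/YMz; apply: (@Y_coroot _ _ D); apply: Zspan_gen; exists al => //.
rewrite -hatC_htrans; congr hatC; apply: hat_eq => //=; first by rewrite scale0r addr0.
have es (z : int) : coroot al *~ z = z%:~R *: coroot al by rewrite scaler_int.
rewrite mul0r mul0r subr0 es dotvZr /coroot dotvZr divfK ?(Phi_dot_neq0 hal)//.
have -> : n%:~R = (n %/ 2)%Z%:~R * 2 + (n %% 2)%Z%:~R :> R by rewrite {1}(divz_eq n 2) intrD intrM.
by rewrite mulrNz; ring.
Qed.

Lemma cpair_root (al : 'cV[R]_r) (n : int) lambda : Phi D al ->
  cpair (al, n%:~R, 0) lambda = dotv (vecC (coroot al)) lambda.1.1 +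
    n%:~R * (toC (2 / dotv al al) * lambda.2).
Proof.
move=> hal; rewrite /cpair /hcoroot /hform /= mulr0 mul0r !addr0.
by rewrite /GRing.scale /= mulr0 toC0 mul0r addr0 toCM toC_int; ring.
Qed.

Lemma cabs_cpair_le (al : 'cV[R]_r) : Phi D al -> exists2 c : R, 0 < c &
  forall (n : int) h, c * cabs (cpair (al, n%:~R, 0) h) <= (1 + `|n|%:~R) * hn h.
Proof.
move=> hal; pose q := `|2 / dotv al al|.
have q0 : 0 < q by rewrite normr_gt0 mulf_neq0// ?invr_eq0 ?(Phi_dot_neq0 hal)// pnatr_eq0.
have a1 : 0 < `|al| + 1 by rewrite ltr_wpDl.
exists (q * (`|al| + 1))^-1 => [|n h]; first by rewrite invr_gt0 mulr_gt0.
rewrite ler_pdivrMl ?mulr_gt0// /cpair hformC.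
apply: le_trans (hform_le _ _) _.
rewrite /hcoroot normrZ /=.
have -> : hform ((al, n%:~R, 0) : hat R r) (al, n%:~R, 0) = dotv al al.
  by rewrite /hform /= mulr0 mul0r !addr0.
rewrite -/q mulrC [leRHS]mulrA ler_wpM2r ?hn_ge0// -[leRHS]mulrA ler_wpM2l ?(ltW q0)//.
have n0 : 0 <= `|n|%:~R :> R by rewrite ler0z.
have a0 : 0 <= `|al| by [].
apply/normr_prod; split; [apply/normr_prod; split|] => /=.
- nra.
- by rewrite -intr_norm; nra.
- by rewrite normr0 mulr_ge0// addr_ge0.
Qed.

(** Uniform regularity at [lambda]. The form [cpair a] grows with the c-coordinate of [a], so its
    variation is measured relative to its distances from 0 and [k a]. With [C * rho <= 1 / 2] these
    lose at most half on the ball of radius [rho]; the bound by [lambda.2] keeps the ball in the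
    right half-space. *)
Definition reg_const lambda (rho C : R) := [/\ 0 < rho, rho <= 1, 0 < C /\ C * rho <= 1 / 2,
  rho <= complex.Re lambda.2 / 2 &
  forall a, Rhat D a -> [/\
    forall h, cabs (cpair a h) <= C * hn h * cabs (cpair a lambda - k a),
    forall h, cabs (cpair a h) <= C * hn h * cabs (cpair a lambda),
    1 <= C * cabs (cpair a lambda - k a) & 1 <= C * cabs (cpair a lambda)]].

Lemma reg_constP lambda : hreg_plus D k lambda -> exists rho C, reg_const lambda rho C.
Proof.
move=> [hl l2].
have l20 : lambda.2 != 0 by apply: contraTneq l2 => ->; rewrite ltxx.
have [c c0 hc] : exists2 c : R, 0 < c & forall al, al \in Phis D ->
  forall n : int, [/\ c * (1 + `|n|%:~R) <= cabs (cpair (al, n%:~R, 0) lambda - k (al, n%:~R, 0)),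
     c * (1 + `|n|%:~R) <= cabs (cpair (al, n%:~R, 0) lambda) &
     forall h, c * cabs (cpair (al, n%:~R, 0) h) <= (1 + `|n|%:~R) * hn h].
  apply: uniform_constant => [al c c' c0 cc h n|al /PhisP hal].
    have n0 : 0 <= 1 + `|n|%:~R :> R by rewrite addr_ge0// ler0z.
    have [h1 h2 h3] := h n; split.
    + by apply: le_trans h1; rewrite ler_wpM2r.
    + by apply: le_trans h2; rewrite ler_wpM2r.
    + by move=> x; apply: le_trans (h3 x); rewrite ler_wpM2r ?cabs_ge0.
  pose p := dotv (vecC (coroot al)) lambda.1.1; pose q := toC (2 / dotv al al) * lambda.2.
  have q0 : q != 0.
    rewrite mulf_neq0// -cabs_gt0 cabs_toC normr_gt0 mulf_neq0 ?pnatr_eq0//.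
    by rewrite invr_eq0 (Phi_dot_neq0 hal).
  (* Three progressions: the pairing itself, and its difference with [k] for even and for odd
     indices. *)
  have [c1 c10 h1] := arith_progression_bound p q0.
  have [c2 c20 h2] := arith_progression_bound (p - k (al, 0%:~R, 0)) q0.
  have [c3 c30 h3] := arith_progression_bound (p - k (al, 1%:~R, 0)) q0.
  have [c4 c40 h4] := cabs_cpair_le hal.
  pose c := Num.min (Num.min c1 c2) (Num.min c3 c4).
  have cc1 : c <= c1 by rewrite /c !ge_min lexx.
  have cc2 : c <= c2 by rewrite /c !ge_min lexx ?orbT.
  have cc3 : c <= c3 by rewrite /c !ge_min lexx ?orbT.
  have cc4 : c <= c4 by rewrite /c !ge_min lexx ?orbT.
  exists c => [|n]; first by rewrite !lt_min c10 c20 c30 c40.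
  have n0 : 0 <= 1 + `|n|%:~R :> R by rewrite addr_ge0// ler0z.
  have ra : Rhat D (al, n%:~R, 0) by apply/RhatP; exists n.
  have [z0 zk] := hl _ ra; rewrite cpair_root// -/p -/q in z0 zk *.
  split.
  - rewrite (k_even n hal) in zk *.
    have e x : p + n%:~R * q - x = p - x + n%:~R * q by ring.
    rewrite -subr_eq0 e in zk; rewrite e.
    have [en|en] : (n %% 2)%Z = 0 \/ (n %% 2)%Z = 1 by exact: modz2.
      by rewrite en in zk *; apply: le_trans (h2 _ zk); rewrite ler_wpM2r.
    by rewrite en in zk *; apply: le_trans (h3 _ zk); rewrite ler_wpM2r.
  - by apply: le_trans (h1 _ z0); rewrite ler_wpM2r.
  - by move=> h; apply: le_trans (h4 n h); rewrite ler_wpM2r ?cabs_ge0.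
(* The first summand serves the lower bounds on the distances, the second the relative bound on the
   differential, which combines two estimates with constant [c]. *)
pose C := c^-1 + (c ^+ 2)^-1.
have ci : 0 < c^-1 by rewrite invr_gt0.
have ci2 : 0 < (c ^+ 2)^-1 by rewrite invr_gt0 exprn_gt0.
have C0 : 0 < C by rewrite addr_gt0.
exists (Num.min (Num.min 1 (1 / 2 / C)) (complex.Re lambda.2 / 2)), C.
have D2 : 0 < 1 / 2 / C by rewrite !divr_gt0.
split; rewrite ?lt_min ?ltr01 ?D2 ?divr_gt0//.
- by rewrite !ge_min lexx.
- by split => //; rewrite mulrC -ler_pdivlMr// !ge_min lexx orbT.
- by rewrite !ge_min lexx orbT.
move=> a /RhatP[n [/PhisP ha ->]]; have [h1 h2 h3] := hc _ ha n.
have n1 : 1 <= 1 + `|n|%:~R :> R by rewrite lerDl ler0z.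
have n0 : 0 <= 1 + `|n|%:~R :> R by exact: le_trans n1.
have low X : c * (1 + `|n|%:~R) <= X -> 1 <= C * X.
  move=> hX; have cX : c <= X by apply: le_trans hX; rewrite ler_peMr// ltW.
  apply: le_trans (_ : c^-1 * X <= _); first by rewrite ler_pdivlMl ?mulr1.
  by rewrite ler_wpM2r ?(le_trans (ltW c0))// lerDl ltW.
have up X h : c * (1 + `|n|%:~R) <= X -> cabs (cpair ((a.1.1, n%:~R, 0) : hat R r) h) <= C * hn h * X.
  move=> hX; have := h3 h; rewrite -ler_pdivlMl// => /le_trans; apply.
  have X0 : 0 <= X by apply: le_trans hX; rewrite mulr_ge0// ltW.
  apply: le_trans (_ : (c ^+ 2)^-1 * hn h * X <= _); last first.
    by rewrite ler_wpM2r// ler_wpM2r ?hn_ge0// lerDr ltW.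
  have -> : (c ^+ 2)^-1 * hn h * X = c^-1 * (c^-1 * X * hn h) by rewrite expr2 invfM; ring.
  rewrite ler_wpM2l ?(ltW ci)// ler_wpM2r ?hn_ge0//.
  by rewrite ler_pdivlMl.
by split; [move=> h; exact: up|move=> h; exact: up|exact: low|exact: low].
Qed.

Lemma cpairD a lambda h : cpair a (lambda + h) = cpair a lambda + cpair a h.
Proof. exact: hformDr. Qed.

Lemma cpairZ a (c : R[i]) h : cpair a (c *: h) = c * cpair a h.
Proof. exact: hformZr. Qed.

Lemma cabs_shift_ge (s sigma : R[i]) (t : R) : t <= 1 / 2 -> cabs sigma <= t * cabs s ->
  cabs s / 2 <= cabs (s + sigma).
Proof.
move=> t2 h; have := cabs_triangle s 0 (- sigma); rewrite !subr0 opprK cabsN.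
have := cabs_ge0 s; nra.
Qed.

Lemma hreg_plus_near lambda rho C h : hreg_plus D k lambda -> reg_const lambda rho C ->
  hn h <= rho -> hreg_plus D k (lambda + h).
Proof.
move=> [hl l2] [r0 r1 [C0 Cr] r2 hC] hh.
have Ch : C * hn h <= 1 / 2 by apply: le_trans Cr; rewrite ler_wpM2l// ltW.
have Ch0 a X : Rhat D a -> 1 <= C * cabs X -> cabs (cpair a h) <= C * hn h * cabs X ->
    X + cpair a h != 0.
  move=> ha X1 hX; rewrite -cabs_gt0; apply: lt_le_trans (cabs_shift_ge Ch hX).
  rewrite divr_gt0// -(pmulr_rgt0 _ C0); exact: lt_le_trans X1.
split.
  move=> a ha; have [h1 h2 h3 h4] := hC a ha; rewrite cpairD; split; first exact: Ch0.
  by rewrite -subr_eq0 addrAC; apply: Ch0.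
have : `|complex.Re h.2| <= rho.
  apply: le_trans (Re_le_cabs _) _; apply: le_trans hh.
  by rewrite /hn lerDr addr_ge0 ?cabs_ge0// sumr_ge0// => ? _; exact: cabs_ge0.
rewrite /= raddfD /= ler_norml => /andP[]; lra.
Qed.

(** k / (s + g) has value k / s, differential - k g / s^2 and remainder k g^2 / (s^2 (s + g)). From
    1 / |s| <= C and |g| <= C |h| |s| they contribute [C], [C ^+ 2] and [2 * C ^+ 3], the 2 because
    |s + g| >= |s| / 2. The root [a] enters the constant only through [kk]. *)
Lemma ctrl_inverse lambda rho C a (N : 'M[R[i]]_m) (kk : R[i]) : reg_const lambda rho C ->
  Rhat D a -> k a = kk ->
  ctrl lambda rho (cabs kk * (C + C ^+ 2 + 2 * C ^+ 3) * mn N)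
    (fun l => (kk / (cpair a l - kk)) *: N).
Proof.
move=> [r0 r1 [C0 Cr] r2 hC] ha <-; have [h1 _ h3 _] := hC a ha.
set s := cpair a lambda - k a in h1 h3 *.
have s0 : 0 < cabs s by rewrite -(pmulr_rgt0 _ C0) (lt_le_trans _ h3).
have sn : s != 0 by rewrite -cabs_gt0.
have is_ : (cabs s)^-1 <= C by rewrite -div1r ler_pdivrMr.
have m0 := mn_ge0 N; have k0 := cabs_ge0 (k a).
have C3 : 0 <= C ^+ 3 by rewrite exprn_ge0// ltW.
have C2 : 0 <= C ^+ 2 by rewrite exprn_ge0// ltW.
pose A := C + C ^+ 2 + 2 * C ^+ 3.
have fin (X t : R) : 0 <= t -> X <= A * t -> cabs (k a) * X * mn N <= cabs (k a) * A * mn N * t.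
  move=> t0 hX; rewrite [leRHS]mulrAC ler_wpM2r// -mulrA ler_wpM2l//.
exists (fun h => (- k a * cpair a h / s ^+ 2) *: N); split.
- split=> [h h'|c h]; first by rewrite cpairD -scalerDl; congr (_ *: _); ring.
  by rewrite cpairZ scalerA; congr (_ *: _); ring.
- rewrite mnZ !cabsM cabsV; have := fin (cabs s)^-1 1 ler01; rewrite !mulr1; apply.
  by rewrite /A; lra.
- move=> h; rewrite mnZ !cabsM cabsN cabsV cabsX -[X in X * mn N]mulrA.
  apply: fin; first exact: hn_ge0.
  apply: le_trans (_ : C ^+ 2 * hn h <= _); last by rewrite ler_wpM2r ?hn_ge0// /A; lra.
  rewrite ler_pdivrMr ?exprn_gt0//; apply: le_trans (h1 h) _.
  rewrite (_ : C ^+ 2 * hn h * cabs s ^+ 2 = C * hn h * cabs s * (C * cabs s)); last by ring.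
  by rewrite ler_peMr// !mulr_ge0 ?hn_ge0// ltW.
- move=> h hh; have {}h1 := h1 h; rewrite cpairD; set g := cpair a h in h1 *.
  have -> : cpair a lambda + g - k a = s + g by rewrite /s; ring.
  have Ch : C * hn h <= 1 / 2 by apply: le_trans Cr; rewrite ler_wpM2l// ltW.
  have sg := cabs_shift_ge Ch h1.
  have sg0 : 0 < cabs (s + g) by apply: lt_le_trans sg; rewrite divr_gt0.
  have sgn : s + g != 0 by rewrite -cabs_gt0.
  rewrite -!scalerBl mnZ.
  have -> : k a / (s + g) - k a / s - - k a * g / s ^+ 2 = k a * (g ^+ 2 / (s ^+ 2 * (s + g))).
    by field; rewrite sn sgn.
  rewrite cabsM; apply: fin; first by rewrite exprn_ge0// hn_ge0.
  rewrite cabsM cabsV cabsM !cabsX.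
  apply: le_trans (_ : 2 * C ^+ 3 * hn h ^+ 2 <= _); last first.
    by rewrite ler_wpM2r ?exprn_ge0 ?hn_ge0// /A; lra.
  rewrite ler_pdivrMr ?mulr_gt0 ?exprn_gt0//.
  apply: le_trans (_ : (C * hn h * cabs s) ^+ 2 <= _).
    by apply: lerXn2r; rewrite ?nnegrE ?cabs_ge0 // !mulr_ge0 ?hn_ge0 ?cabs_ge0 ?(ltW C0).
  have -> : 2 * C ^+ 3 * hn h ^+ 2 * (cabs s ^+ 2 * cabs (s + g)) =
     (C * hn h * cabs s) ^+ 2 * (2 * C * cabs (s + g)) by ring.
  rewrite ler_peMr ?sqr_ge0//; apply: le_trans h3 _.
  rewrite (_ : 2 * C * cabs (s + g) = C * (2 * cabs (s + g))); last by ring.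
  by rewrite ler_pM2l//; lra.
Qed.

End RegularBounds.

(** * Gaussian sums and growth of translations *)

Section GaussianSums.
Context {R : realType}.

Lemma expR1_ge2 : 2 <= expR (1 : R).
Proof. by have := expR_ge1Dx (1 : R); rewrite (_ : 1 + 1 = 2)//; ring. Qed.

Lemma expR_Nnat (n : nat) : expR (- n%:R : R) <= (1 / 2) ^+ n.
Proof.
rewrite -[n%:R]mulr1 -mulrN expRM_natl; apply: lerXn2r; rewrite ?nnegrE ?expR_ge0//.
by rewrite expRN div1r lef_pV2 ?posrE ?expR_gt0// expR1_ge2.
Qed.

Lemma sum_geom_half (n : nat) : \sum_(i < n) (1 / 2) ^+ i <= 2 :> R.
Proof.
suff -> : \sum_(i < n) (1 / 2) ^+ i = 2 - 2 * (1 / 2) ^+ n :> R.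
  by rewrite gerBl mulr_ge0// exprn_ge0.
elim: n => [|n IH]; first by rewrite big_ord0 expr0; ring.
by rewrite big_ord_recr /= IH exprS; field.
Qed.

Lemma absS_int_geometric (d : nat) :
  absS setT (fun z : {ffun 'I_d -> int} => \prod_i (1 / 2 : R) ^+ `|z i|%N).
Proof.
exists (\prod_(i < d) 4) => S; rewrite -/(upartial _ _ _) upartialT.
pose N := (\max_(z <- S) \max_i `|z i|%N).+1.
pose L : seq int := [seq n%:Z | n <- iota 0 N] ++ [seq - n%:Z | n <- iota 0 N].
pose X : {fset int} := [fset x in L]%fset.
have XL x : (x \in X) = (x \in L) by rewrite in_fset.
apply: le_trans (_ : \sum_(z <- fbox d X) \prod_i (1 / 2 : R) ^+ `|z i|%N <= _).
  apply: (@ler_sum_fsubset _ _ xpredT) => [z _|].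
    by apply: prodr_ge0 => i _; exact: exprn_ge0.
  apply/fsubsetP => z zS; apply: in_fbox => i.
  have h : (`|z i| < N)%N.
    rewrite ltnS; apply: leq_trans (_ : (\max_i `|z i| <= _)%N); first exact: (leq_bigmax (F := fun i => `|z i|%N)).
    exact: (leq_bigmax_seq (F := fun z : {ffun 'I_d -> int} => (\max_i `|z i|)%N)).
  rewrite XL mem_cat; apply/orP; case: (z i) h => n h.
    by left; apply/mapP; exists n; rewrite ?mem_iota.
  by right; apply/mapP; exists n.+1; rewrite ?mem_iota// NegzE.
rewrite (sum_fbox X (fun _ x => (1 / 2 : R) ^+ `|x|%N)).
apply: ler_prod => _ _; apply/andP; split; first by apply: sumr_ge0 => x _; exact: exprn_ge0.
have half (g : nat -> int) : (forall n, `|g n|%N = n) ->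
    \sum_(x <- [seq g n | n <- iota 0 N]) (1 / 2 : R) ^+ `|x|%N <= 2.
  move=> gn; rewrite big_map -[iota 0 N]/(index_iota 0 N) big_mkord.
  by under eq_bigr do rewrite gn; exact: sum_geom_half.
apply: le_trans (_ : \sum_(x <- L) (1 / 2 : R) ^+ `|x|%N <= _).
  have -> : \sum_(x <- X) (1 / 2 : R) ^+ `|x|%N = \sum_(x <- undup L) (1 / 2 : R) ^+ `|x|%N.
    apply: perm_big; apply: uniq_perm => //; first exact: undup_uniq.
    by move=> x; rewrite mem_undup XL.
  elim: L {X XL} => [//|x s IH] /=; case: ifP => _; rewrite !big_cons.
    by apply: le_trans IH _; rewrite lerDr exprn_ge0.
  by rewrite lerD2l.
(* The nonnegative and the nonpositive integers give 2 each; 0 is counted twice. *)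
rewrite /L big_cat /= (_ : 4 = 2 + 2)//; last by ring.
apply: lerD; first by apply: half => n.
by apply: half => n; rewrite abszN.
Qed.

(** Completing the square gives a1 s - a2 s^2 <= c - K s, which is at most c minus the l1 length of
    [z]; what remains is a product of geometric series. *)
Lemma absS_gaussian (d : nat) (s : {ffun 'I_d -> int} -> R) (K a1 a2 : R) :
  (forall z : {ffun 'I_d -> int}, (\sum_i `|z i|%N)%:R <= K * s z) -> 0 < a2 ->
  absS setT (fun z => expR (a1 * s z - a2 * s z ^+ 2)).
Proof.
move=> hs a20; pose c := (a1 + K) ^+ 2 / (4 * a2).
apply: absS_le (absSZ (c := expR c) (expR_ge0 _) (absS_int_geometric d)) => z _.
apply: le_trans (_ : expR (c + - (\sum_i `|z i|%N)%:R) <= _).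
  rewrite ler_expR; apply: le_trans (_ : c - K * s z <= _); last by rewrite lerD2l lerN2.
  rewrite -subr_ge0 /c (_ : _ - _ = (2 * a2 * s z - (a1 + K)) ^+ 2 / (4 * a2)).
    by rewrite divr_ge0 ?sqr_ge0// mulr_ge0// ltW.
  by field; rewrite gt_eqF.
rewrite expRD ler_wpM2l ?expR_ge0// natr_sum -sumrN expR_sum.
by apply: ler_prod => i _; rewrite expR_ge0 expR_Nnat.
Qed.

End GaussianSums.

Section GrowthBounds.
Context {R : realType} {r : nat} (D : affine_datum R r).
Implicit Types (w u : hatmap R r) (lambda h x : hat R[i] r) (v : hat R r) (y : 'cV[R]_r).

Definition l1 y : R := \sum_i `|y i 0|.

Lemma l1_ge0 y : 0 <= l1 y.
Proof. by apply: sumr_ge0. Qed.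

Lemma hn_weyl w : weyl D w -> exists2 K : R, 0 < K & forall x, hn (w x) <= K * hn x.
Proof.
elim=> [|al {}w hal _ [K K0 IH]]; first by exists 1 => // x; rewrite mul1r.
pose c := `|hcoroot (vhat al : hat R r)| * hn (hatC (vhat al)).
have c0 : 0 <= c by rewrite mulr_ge0// hn_ge0.
exists ((1 + c) * K) => [|x /=]; first by rewrite mulr_gt0// ltr_pwDl.
rewrite -mulrA; apply: le_trans (_ : (1 + c) * hn (w x) <= _); last first.
  by rewrite ler_wpM2l// addr_ge0.
rewrite /sC /hrefl -scaleNr; apply: le_trans (hnD _ _) _.
rewrite mulrDl mul1r lerD2l hnZ cabsN -hatC_hcoroot /c -mulrA [X in _ <= _ * X]mulrC mulrA.
by rewrite ler_wpM2r ?hn_ge0// mulrC hform_le.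
Qed.

Lemma cabs_dotv_le (p : 'cV[R[i]]_r) y :
  cabs (dotv p (vecC y)) <= (\sum_i cabs (p i 0)) * l1 y.
Proof.
apply: le_trans (cabs_sum _ _ _) _; rewrite mulr_suml; apply: ler_sum => i _.
rewrite cabsM mxE cabs_toC ler_wpM2l ?cabs_ge0//.
by rewrite /l1 (bigD1 i)//= lerDl sumr_ge0.
Qed.

(** Cauchy-Schwarz against the vector of ones, from 2 a b <= a^2 + b^2 for each pair of
    coordinates. *)
Lemma l1_sq y : l1 y ^+ 2 <= r%:R * dotv y y.
Proof.
rewrite expr2 /l1 mulr_suml.
apply: le_trans (_ : \sum_(i < r) \sum_(j < r) (y i 0 ^+ 2 + y j 0 ^+ 2) / 2 <= _).
  apply: ler_sum => i _; rewrite mulr_sumr; apply: ler_sum => j _.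
  have := sqr_ge0 (`|y i 0| - `|y j 0|).
  rewrite sqrrB !real_normK ?num_real//; lra.
have e : \sum_(i < r) y i 0 ^+ 2 = dotv y y by apply: eq_bigr => i _; rewrite expr2.
have -> : \sum_(i < r) \sum_(j < r) (y i 0 ^+ 2 + y j 0 ^+ 2) / 2 =
   \sum_(i < r) (y i 0 ^+ 2 * r%:R + dotv y y) / 2.
  apply: eq_bigr => i _; rewrite -mulr_suml big_split /= e; congr ((_ + _) / _).
  by rewrite sumr_const card_ord mulr_natr.
rewrite -mulr_suml big_split /= -mulr_suml e sumr_const card_ord -[dotv y y *+ r]mulr_natl.
by rewrite [dotv _ _ * _]mulrC -mulrDl -mulr2n -mulr_natl; lra.
Qed.

Lemma dotv_le_l1 y : dotv y y <= l1 y ^+ 2.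
Proof.
rewrite expr2 [in leRHS]/l1 mulr_suml; apply: ler_sum => i _.
rewrite -expr2 -(real_normK (num_real (y i 0))) expr2 ler_wpM2l//.
by rewrite /l1 (bigD1 i)//= lerDl sumr_ge0.
Qed.

Lemma cabs_dotvC y : cabs (dotv (vecC y) (vecC y)) <= l1 y ^+ 2.
Proof.
rewrite dotv_vecC cabs_toC ger0_norm; first exact: dotv_le_l1.
by apply: sumr_ge0 => i _; rewrite -expr2 sqr_ge0.
Qed.

Lemma hn_htrans y x : hn (tC y x) <= 2 * (1 + l1 y) ^+ 2 * hn x.
Proof.
have s0 := l1_ge0 y; set s := l1 y in s0 *.
have p1 : \sum_i cabs ((tC y x).1.1 i 0) <= \sum_i cabs (x.1.1 i 0) + cabs x.2 * s.
  rewrite /s /l1 mulr_sumr -big_split; apply: ler_sum => i _ /=.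
  by rewrite !mxE; apply: le_trans (cabsD _ _) _; rewrite cabsM cabs_toC.
have p2 : cabs (tC y x).1.2 <= cabs x.1.2 + cabs x.2 * s ^+ 2 + (\sum_i cabs (x.1.1 i 0)) * s.
  rewrite /=; apply: le_trans (cabsD _ _) _; rewrite cabsN lerD ?cabs_dotv_le//.
  apply: le_trans (cabsD _ _) _; rewrite cabsN lerD2l cabsM.
  apply: le_trans (ler_wpM2l (cabs_ge0 _) (cabs_dotvC y)) _.
  rewrite ler_wpM2r ?sqr_ge0// cabsM cabsV -natC cabs_toC normr_nat.
  by have := cabs_ge0 x.2; lra.
rewrite /hn [(tC y x).2]/=.
have := sumr_ge0 (index_enum 'I_r) (P := xpredT) (F := fun i => cabs (x.1.1 i 0)) (fun i _ => cabs_ge0 _).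
move: p1 p2; have := cabs_ge0 x.1.2; have := cabs_ge0 x.2.
move: (\sum_i cabs (x.1.1 i 0)) (\sum_i cabs ((tC y x).1.1 i 0)) (cabs (tC y x).1.2) (cabs x.1.2) (cabs x.2).
move=> X X' E' E Y Y0 E0 p1 p2 X0.
have : X' + E' + Y <= X + Y * s + (E + Y * s ^+ 2 + X * s) + Y by lra.
move=> /le_trans; apply.
have -> : 2 * (1 + s) ^+ 2 * (X + E + Y) = X + Y * s + (E + Y * s ^+ 2 + X * s) + Y +
  (X * (1 + 3 * s + 2 * s ^+ 2) + E * (1 + 4 * s + 2 * s ^+ 2) + Y * (1 + 3 * s + s ^+ 2)) by ring.
have s2 := sqr_ge0 s.
by rewrite lerDl !addr_ge0// mulr_ge0//; lra.
Qed.

(** In (t_y x, v) the only term quadratic in y is - x.2 v.2 (y, y) / 2, whose real part is negative;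
    the others are constant or linear. *)
Lemma Re_hform_htrans x v : Vplus v -> 0 < complex.Re x.2 ->
  exists a0 a1 a2, [/\ 0 < a2 & forall y,
    complex.Re (hform (tC y x) (hatC v)) <= a0 + a1 * l1 y - a2 * l1 y ^+ 2].
Proof.
move=> Vv x20.
(* Dividing by [r + 1] instead of [r] covers dimension 0. *)
pose a2 := complex.Re x.2 * v.2 / 2 / (r%:R + 1).
pose a1 := cabs x.2 * `|v| + (\sum_i cabs (x.1.1 i 0)) * v.2.
exists (hn x * `|v|), a1, a2.
have r1 : 0 < r%:R + 1 :> R by rewrite ltr_wpDl.
have V0 : 0 < v.2 := Vv.
split; first by rewrite !divr_gt0 ?mulr_gt0.
move=> y.
have -> : hform (tC y x) (hatC v) = hform x (hatC v) +
  (x.2 * toC (dotv y v.1.1) - dotv x.1.1 (vecC y) * toC v.2)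
  - toC (v.2 * dotv y y / 2) * x.2.
  rewrite /hform /tC /htrans /= dotvDl dotvZl !dotv_vecC !toCM toCV natC.
  by field.
rewrite !raddfD !raddfN /=.
have -> : complex.Re (toC (v.2 * dotv y y / 2) * x.2) = v.2 * dotv y y / 2 * complex.Re x.2.
  by case: (x.2) => a b; rewrite /toC /= mul0r subr0.
have h1 : complex.Re (hform x (hatC v)) <= hn x * `|v| by exact: le_trans (Re_le _) (hform_le _ _).
have v1 : `|v.1.1| <= `|v| by have /normr_prod[/normr_prod[h2 h3] _] := lexx `|v|; exact: le_trans h2 _.
have h2 : complex.Re (x.2 * toC (dotv y v.1.1)) <= cabs x.2 * `|v| * l1 y.
  apply: le_trans (Re_le _) _; rewrite cabsM -mulrA ler_wpM2l ?cabs_ge0// cabs_toC.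
  apply: le_trans (ler_norm_sum _ _ _) _; rewrite /l1 mulr_sumr; apply: ler_sum => i _.
  rewrite normrM mulrC ler_wpM2r//; apply: le_trans v1; exact: le_mxentry.
have h3 : - complex.Re (dotv x.1.1 (vecC y) * toC v.2) <= (\sum_i cabs (x.1.1 i 0)) * v.2 * l1 y.
  rewrite -raddfN /=; apply: le_trans (Re_le _) _; rewrite cabsN cabsM cabs_toC gtr0_norm//.
  by rewrite [leRHS]mulrAC ler_wpM2r ?(ltW V0)// cabs_dotv_le.
have h4 : a2 * l1 y ^+ 2 <= v.2 * dotv y y / 2 * complex.Re x.2.
  have := l1_sq y; have y0 : 0 <= dotv y y by apply: sumr_ge0 => i _; rewrite -expr2 sqr_ge0.
  move=> hy; have hy' : l1 y ^+ 2 / (r%:R + 1) <= dotv y y.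
    by rewrite ler_pdivrMr//; nra.
  rewrite (_ : a2 * l1 y ^+ 2 = complex.Re x.2 * v.2 / 2 * (l1 y ^+ 2 / (r%:R + 1))); last first.
    by rewrite /a2; field; rewrite gt_eqF.
  rewrite (_ : v.2 * _ / 2 * _ = complex.Re x.2 * v.2 / 2 * dotv y y); last by field.
  by rewrite ler_wpM2l// ltW// !divr_gt0 ?mulr_gt0.
by move: h1; rewrite /hform !raddfD /= /a1; lra.
Qed.

End GrowthBounds.

Section LatticeBasis.
Context {R : realType} {r : nat} (D : affine_datum R r).

(** Coordinates in a basis of [Y] are restrictions of linear forms on V, so the word length of y is
    at most a multiple of [l1 y]. *)
Lemma lattice_basis : exists (d : nat) (b : 'I_d -> 'cV[R]_r) (K : R),
  [/\ forall i, Y D (b i), 0 <= K,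
    set_bij [set: {ffun 'I_d -> int}] (Y D) (fun z => \sum_i b i *~ z i) &
    forall z : {ffun 'I_d -> int},
      (\sum_i `|z i|%N)%:R <= K * l1 (\sum_i b i *~ z i)].
Proof.
have [s [fr YE]] := Y_lattice D.
have fr' : free (in_tuple s) by [].
pose co (i : 'I_(size s)) (y : 'cV[R]_r) : R := coord (in_tuple s) i y.
have coE (z : {ffun 'I_(size s) -> int}) j : co j (\sum_(i < size s) s`_i *~ z i) = (z j)%:~R.
  rewrite /co -(coord_sum_free (fun i => (z i)%:~R) j fr'); congr (coord _ _ _).
  by apply: eq_bigr => i _; rewrite scaler_int.
pose K := \sum_j \sum_(i < r) `|co j (delta_mx i 0)|.
have coB j y : `|co j y| <= (\sum_(i < r) `|co j (delta_mx i 0)|) * l1 y.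
  have {1}-> : y = \sum_(i < r) y i 0 *: delta_mx i 0.
    rewrite {1}(matrix_sum_delta y); apply: eq_bigr => i _.
    by rewrite big_ord_recl big_ord0 addr0; congr (_ *: delta_mx _ _); rewrite ?ord1.
  rewrite /co linear_sum; apply: le_trans (ler_norm_sum _ _ _) _.
  rewrite mulr_suml; apply: ler_sum => i _.
  rewrite linearZ /= normrM mulrC ler_wpM2l//.
  by rewrite /l1 (bigD1 i)//= lerDl sumr_ge0.
exists (size s), (fun i : 'I_(size s) => s`_i), K; split.
- by move=> i; rewrite YE; apply: Zspan_gen; rewrite /= mem_nth.
- by apply: sumr_ge0 => j _; apply: sumr_ge0.
- split.
  + by move=> z _ /=; rewrite YE; apply/lattice_coord; exists z.
  + move=> z z' _ _ /= e; apply/ffunP => i; apply: (@intr_inj R).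
    by rewrite -!coE e.
  + move=> y; rewrite YE => /lattice_coord[z ->]; exists [ffun i => z i] => //.
    by apply: eq_bigr => i _; rewrite ffunE.
- move=> z; rewrite natr_sum /K mulr_suml; apply: ler_sum => j _.
  by apply: le_trans (coB _ _); rewrite coE natr_absz intr_norm.
Qed.

End LatticeBasis.

(** * Growth of the cocycle on translations, and convergence on each coset of the lattice *)

Section CocycleBounds.
Context {R : realType} {r m : nat} (D : affine_datum R r).
Variable k : hat R r -> R[i].
Hypothesis k_inv : weylY_invariant D k.
Variable J : hatmap R r -> hat R[i] r -> galg R r.
Hypothesis J_cocycle : is_cocycle D k J.
Variable pi : hatmap R r -> 'M[R[i]]_m.
Hypothesis pi_module : is_module D pi.
Implicit Types (w u : hatmap R r) (lambda h : hat R[i] r).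
Local Notation JMw := (JM D pi J).

Lemma ctrl_add lambda rho A1 A2 (G1 G2 : hat R[i] r -> 'M[R[i]]_m) :
  ctrl lambda rho A1 G1 -> ctrl lambda rho A2 G2 ->
  ctrl lambda rho (A1 + A2) (fun l => G1 l + G2 l).
Proof.
move=> [L1 [[lD1 lZ1] a1 b1 q1]] [L2 [[lD2 lZ2] a2 b2 q2]].
exists (fun h => L1 h + L2 h); split.
- by split=> [h h'|c h]; rewrite ?lD1 ?lD2 ?lZ1 ?lZ2 ?scalerDr// addrACA.
- by apply: le_trans (mnD _ _) _; rewrite lerD.
- by move=> h; apply: le_trans (mnD _ _) _; rewrite mulrDl lerD.
- move=> h hh; rewrite mulrDl; apply: le_trans (lerD (q1 h hh) (q2 h hh)).
  apply: le_trans (mnD _ _); rewrite le_eqVlt; apply/orP; left; apply/eqP; congr mn.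
  by apply/matrixP => i j; rewrite !mxE; ring.
Qed.

(** The constant depends on [w] but not on the orbit point: at each letter the affine root pulls
    back to another one with the same [k], to which [reg_const] applies with the same [C]. *)
Lemma ctrl_JM w lambda rho C : weylY D w -> hreg_plus D k lambda -> reg_const D k lambda rho C ->
  exists A, forall u, weylY D u -> ctrl lambda rho A (fun l => JMw w (u l)).
Proof.
move=> /weylY_generated gw hl hC; have [r0 r1 _ _ _] := hC.
have near h : hn h <= rho -> hreg D k (lambda + h) by move=> /(hreg_plus_near hl hC)[].
elim: gw => [ o ho|a {}w ha gw [A hA]].
  exists (mn (pi o)) => u hu; apply: ctrl_ext (ctrl_cst _ _ _); first exact: ltW.
  by move=> h /near hh; rewrite (JM_omega J_cocycle)//; exact: hreg_weylY.
have hw' := generated_weylY gw.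
have ra := Fhat_Rhat ha; have hs := sC_weylY ra.
pose N := pi (sC a) + 1%:M.
exists (6 * A * (mn (pi (sC a)) + cabs (k a) * (C + C ^+ 2 + 2 * C ^+ 3) * mn N)) => u hu.
have [b [hb kb eb _]] := cpair_weylY k_inv lambda hu ra.
have c1 := ctrl_mul r1 (hA _ (weylY_comp hs hu)) (ctrl_add (ctrl_cst lambda rho (pi (sC a)))
   (ctrl_inverse N hC hb kb)).
apply: ctrl_ext c1; first exact: ltW.
move=> h /near hh; have hu' := hreg_weylY k_inv hu hh.
rewrite (JM_mul k_inv J_cocycle pi_module hw' hs hu').
by rewrite (JM_refl J_cocycle pi_module ha hu') eb.
Qed.

Variables (d : nat) (b : 'I_d -> 'cV[R]_r).
Hypothesis bY : forall i, Y D (b i).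

Definition lpt (z : {ffun 'I_d -> int}) : 'cV[R]_r := \sum_i b i *~ z i.

Lemma Y_lpt z : Y D (lpt z).
Proof. by apply: (big_ind (Y D)) => [|? ? ? ?|i _]; [exact: Y0|exact: YD|exact: YMz]. Qed.

Definition zlen (z : {ffun 'I_d -> int}) : nat := \sum_i `|z i|%N.

Lemma zlen_step (z : {ffun 'I_d -> int}) n : zlen z = n.+1 ->
  exists i (s : bool) z', zlen z' = n /\ lpt z = (if s then b i else - b i) + lpt z'.
Proof.
move=> hz; have [i zi] : exists i, z i != 0.
  apply/existsP; apply: contraPT hz; rewrite negb_exists => /forallP h.
  by rewrite /zlen big1// => i _; have := h i; rewrite negbK => /eqP ->.
pose e : int := if 0 <= z i then 1 else -1.
pose z' := [ffun j => if j == i then z i - e else z j].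
have zi' : (`|z i|%N = `|z i - e|%N.+1) by rewrite /e; case: ifP zi; lia.
exists i, (0 <= z i), z'; split.
  apply: succn_inj; rewrite -hz /zlen (bigD1 i)//= [RHS](bigD1 i)//= ffunE eqxx zi' addSn.
  by congr (_ + _).+1; apply: eq_bigr => j /negbTE ji; rewrite ffunE ji.
rewrite /lpt (bigD1 i)//= [X in _ + X = _](_ : _ = \sum_(j < d | j != i) b j *~ z' j); last first.
  by apply: eq_bigr => j /negbTE ji; rewrite ffunE ji.
rewrite [X in _ = _ + X](bigD1 i)//= addrA; congr (_ + _).
rewrite ffunE eqxx /e; case: ifP => _; rewrite mulrzBr ?mulr1z ?mulrN1z.
  by rewrite addrC subrK.
by rewrite opprK addrC addrK.
Qed.

(** Each generator stripped from the word costs at most 6 T <= exp(6 T), where [T] bounds the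
    constants of the finitely many lattice generators and their inverses; hence the rate [6 * T]. *)
Lemma ctrl_word lambda rho C : hreg_plus D k lambda -> reg_const D k lambda rho C ->
  exists beta : R, 0 <= beta /\ forall z u, weylY D u ->
    ctrl lambda rho (mn (1%:M : 'M[R[i]]_m) * expR (beta * (zlen z)%:R))
      (fun l => JMw (tC (lpt z)) (u l)).
Proof.
move=> hl hC; have [r0 r1 _ _ _] := hC.
have near h : hn h <= rho -> hreg D k (lambda + h) by move=> /(hreg_plus_near hl hC)[].
have Yg (p : 'I_d * bool) : Y D (if p.2 then b p.1 else - b p.1).
  by case: p => i [] /=; [|apply: YN].
have /choice[A hA] : forall p : 'I_d * bool, exists A, forall u, weylY D u ->
    ctrl lambda rho A (fun l => JMw (tC (if p.2 then b p.1 else - b p.1)) (u l)).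
  by move=> p; exact: ctrl_JM (weylY_tC (Yg p)) hl hC.
have A0 p : 0 <= A p by exact: ctrl_ge0 (hA p id (weylY_id D)).
pose T := \sum_p A p; have AT p : A p <= T.
  by rewrite /T (bigD1 p)//= lerDl sumr_ge0.
have T0 : 0 <= T by apply: sumr_ge0.
exists (6 * T); split; first by rewrite mulr_ge0.
move=> z; move en : (zlen z) => n; elim: n z en => [|n IH] z en u hu.
  have -> : lpt z = 0.
    rewrite /lpt big1// => i _; move/eqP: en; rewrite sum_nat_eq0 => /forallP/(_ i).
    by rewrite absz_eq0 => /eqP ->.
  rewrite mulr0 expR0 mulr1 tC0; apply: ctrl_ext (ctrl_cst _ _ _); first exact: ltW.
  by move=> h /near hh; rewrite (JM_id J_cocycle pi_module)//; exact: hreg_weylY.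
have [i [s [z' [en' ->]]]] := zlen_step en.
have hg := weylY_tC (Yg (i, s)); have hz := weylY_tC (Y_lpt z').
have c1 := ctrl_mul r1 (hA (i, s) _ (weylY_comp hz hu)) (IH z' en' u hu).
apply: ctrl_le (ctrl_ext (ltW r0) _ c1).
  have -> : 6 * T * n.+1%:R = 6 * T + 6 * T * n%:R by rewrite -nat1r; ring.
  rewrite expRD; set M := mn _; set E := expR (6 * T * _).
  have -> : M * (expR (6 * T) * E) = expR (6 * T) * (M * E) by ring.
  rewrite ler_wpM2r ?mulr_ge0 ?mn_ge0 ?expR_ge0//.
  apply: le_trans (_ : 1 + 6 * T <= _); last exact: expR_ge1Dx.
  by have := AT (i, s); lra.
move=> h /near hh; have hu' := hreg_weylY k_inv hu hh.
rewrite -tC_comp; exact/esym/(JM_mul k_inv J_cocycle pi_module hg hz hu').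
Qed.

Hypothesis b_len : exists2 K : R, 0 <= K & forall z, (zlen z)%:R <= K * l1 (lpt z).

Lemma cocycle_estimates lambda w0 : hreg_plus D k lambda -> weyl D w0 ->
  exists rho C (beta A : R), [/\ reg_const D k lambda rho C, 0 <= beta, 0 <= A &
    forall z, ctrl lambda rho (A * expR (beta * l1 (lpt z)))
      (fun l => JMw (tC (lpt z) \o w0) l)].
Proof.
move=> hl hw0; have hw := weylY_weyl hw0.
have [rho [C hC]] := reg_constP k_inv hl; have [r0 r1 _ _ _] := hC.
have near h : hn h <= rho -> hreg D k (lambda + h) by move=> /(hreg_plus_near hl hC)[].
have [beta [beta0 hb]] := ctrl_word hl hC.
have [A hA] := ctrl_JM hw hl hC.
have A0 : 0 <= A := ctrl_ge0 (hA id (weylY_id D)).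
have [K K0 hK] := b_len.
exists rho, C, (beta * K), (6 * mn (1%:M : 'M[R[i]]_m) * A); split => //.
- exact: mulr_ge0.
- by rewrite !mulr_ge0 ?mn_ge0.
move=> z; have c1 := ctrl_mul r1 (hb z w0 hw) (hA id (weylY_id D)).
apply: ctrl_le (ctrl_ext (ltW r0) _ c1).
  rewrite -!mulrA ler_wpM2l// ler_wpM2l ?mn_ge0// mulrC ler_wpM2l// ler_expR.
  by rewrite ler_wpM2l.
move=> h /near hh; exact/esym/(JM_mul k_inv J_cocycle pi_module (weylY_tC (Y_lpt z)) hw hh).
Qed.

Lemma l1_quad (s : R) : (1 + s) ^+ 2 <= 2 + 2 * s ^+ 2.
Proof. by have := sqr_ge0 (1 - s); rewrite !expr2; lra. Qed.

Lemma absS_majorant (K0 q1 q2 : R) : 0 < q2 ->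
  absS setT (fun z => K0 * expR (q1 * l1 (lpt z) - q2 * l1 (lpt z) ^+ 2)).
Proof.
move=> q20; have [K _ hK] := b_len.
apply: absS_le (absSZ (c := `|K0|) (normr_ge0 _) (absS_gaussian q1 hK q20)) => z _.
by rewrite ler_wpM2r ?expR_ge0// ler_norm.
Qed.

Definition muw lambda w0 z : hat R[i] r := (tC (lpt z) \o w0) lambda.

(** The orbit points have size of order (1 + |y|)^2, so the reserve exp(rho * hn) in [dmajor] is a
    Gaussian of the wrong sign; a small radius makes it cost half of the decay [a2]. *)
Lemma good_cocycle lambda w0 i j : hreg_plus D k lambda -> weyl D w0 ->
  good setT (muw lambda w0) (fun z => JMw (tC (lpt z) \o w0) lambda i j).
Proof.
move=> hl hw0 x Vx; have [K K0 hK] := hn_weyl hw0.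
have [rho [C [beta [A [_ beta0 A0 hc]]]]] := cocycle_estimates hl hw0.
have l20 : 0 < complex.Re (w0 lambda).2 by rewrite (rigid_d (rigid_weyl hw0)); case: hl.
have [a0 [a1 [a2 [a20 ha]]]] := Re_hform_htrans Vx l20.
(* The 4 comes from 2 (1 + s)^2 <= 4 (1 + s^2); the [+ 1] keeps [H] positive. *)
pose H := 4 * (K * hn lambda) + 1.
have Kn : 0 <= K * hn lambda by rewrite mulr_ge0 ?hn_ge0// ltW.
have H0 : 0 < H by rewrite /H; lra.
exists (a2 / 2 / H); first by rewrite !divr_gt0.
have a4 : 0 < a2 / 2 by rewrite divr_gt0.
apply: absS_le (absS_majorant (A * expR (a0 + a2 / 2)) (beta + a1) a4) => z _.
rewrite /dmajor; have [L [_ h1 _ _]] := hc z.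
have cJ := le_trans (cabs_le_mn _ i j) h1.
set s := l1 (lpt z) in h1 cJ *.
have e : a2 / 2 / H * hn (muw lambda w0 z) <= a2 / 2 + a2 / 2 * s ^+ 2.
  rewrite mulrAC ler_pdivrMr//.
  apply: le_trans (_ : a2 / 2 * (2 * (1 + s) ^+ 2 * (K * hn lambda)) <= _).
    rewrite ler_wpM2l ?(ltW a4)//; apply: le_trans (hn_htrans _ _) _.
    by rewrite ler_wpM2l// mulr_ge0// sqr_ge0.
  rewrite (_ : _ * H = a2 / 2 * ((1 + s ^+ 2) * H)); last by ring.
  rewrite ler_wpM2l ?(ltW a4)//.
  have := l1_quad s; have := sqr_ge0 s; rewrite /H; nra.
apply: le_trans (_ : A * expR (beta * s) * expR (a0 + a1 * s - a2 * s ^+ 2 + (a2 / 2 + a2 / 2 * s ^+ 2)) <= _).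
  apply: ler_pM; rewrite ?cabs_ge0 ?expR_ge0// ler_expR lerD//; exact: ha.
rewrite -!mulrA -!expRD ler_wpM2l// ler_expR; lra.
Qed.

(** The differential of the exponent has size of order (1 + |y|)^2, which [ctrl_cexp] turns into
    exp(2 rho N). Shrinking the radius once, independently of y, leaves half of the Gaussian to sum
    the constants. *)
Lemma ctrl_E_term lambda w0 (v : hat R r) : hreg_plus D k lambda -> weyl D w0 -> Vplus v ->
  exists (rho : R) (g : {ffun 'I_d -> int} -> R), [/\ 0 < rho,
    forall h, hn h <= rho -> hreg_plus D k (lambda + h), absS setT g &
    forall z, ctrl lambda rho (g z) (fun l => E_term D pi J v l (tC (lpt z) \o w0))].
Proof.
move=> hl hw0 Vv; have [K K0 hK] := hn_weyl hw0.
have [rho [C [beta [A [hC beta0 A0 hc]]]]] := cocycle_estimates hl hw0.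
have [r0 r1 _ _ _] := hC; have rg0 := rigid_weyl hw0.
have l20 : 0 < complex.Re (w0 lambda).2 by rewrite (rigid_d (rigid_weyl hw0)); case: hl.
have [a0 [a1 [a2 [a20 ha]]]] := Re_hform_htrans Vv l20.
have a4 : 0 < a2 / 2 by rewrite divr_gt0.
have v0 : 0 <= `|v| by [].
have Kv : 0 <= K * `|v| by rewrite mulr_ge0// ltW.
(* The 8 comes from 2 N <= 8 (1 + s^2) K |v|. *)
pose H := 8 * (K * `|v|) + 1; have H0 : 0 < H by rewrite /H; lra.
pose rho' := Num.min rho (a2 / 2 / H).
have rr : rho' <= rho by rewrite ge_min lexx.
have rH : rho' <= a2 / 2 / H by rewrite ge_min lexx orbT.
have r'0 : 0 < rho' by rewrite lt_min r0 !divr_gt0.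
have r'1 := le_trans rr r1.
pose c := 1 + rho'^-1 + 2 / rho' ^+ 2.
pose mm := mn (1%:M : 'M[R[i]]_m).
have c0 : 0 <= c.
  have p1 : 0 <= rho'^-1 by rewrite invr_ge0 ltW.
  have p2 : 0 <= 2 / rho' ^+ 2 by rewrite divr_ge0// sqr_ge0.
  by rewrite /c; lra.
have mm0 : 0 <= mm by exact: mn_ge0.
exists rho', (fun z => 6 * c * mm * A * expR (a0 + a2 / 2) *
  expR ((beta + a1) * l1 (lpt z) - a2 / 2 * l1 (lpt z) ^+ 2)); split => //.
- move=> h hh; apply: (hreg_plus_near hl hC); exact: le_trans rr.
- exact: absS_majorant.
move=> z; set s := l1 (lpt z).
have rig : rigid (tC (lpt z) \o w0) by apply: rigid_comp => //; exact: rigid_tC.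
pose l x := hform ((tC (lpt z) \o w0) x) (hatC v).
pose N := 2 * (1 + s) ^+ 2 * K * `|v|.
have N0 : 0 <= N by rewrite /N -mulrA mulr_ge0// mulr_ge0// sqr_ge0.
have lN h : cabs (l h) <= N * hn h.
  apply: le_trans (hform_le _ _) _.
  rewrite (_ : N * hn h = 2 * (1 + s) ^+ 2 * (K * hn h) * `|v|); last by rewrite /N; ring.
  rewrite ler_wpM2r//; apply: le_trans (hn_htrans _ _) _; rewrite ler_wpM2l//.
  by rewrite mulr_ge0// sqr_ge0.
have lD h h' : l (h + h') = l h + l h' by rewrite /l (rigidD rig) hformDl.
have lZ a h : l (a *: h) = a * l h by rewrite /l (rigidZ rig) hformZl.
have c1 := @ctrl_cexp R r m lambda rho' l N lD lZ lN r'0 N0.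
have c2 := ctrl_mul r'1 c1 (ctrl_radius rr (hc z)).
apply: ctrl_le (ctrl_ext (ltW r'0) _ c2); last first.
  by move=> h _; rewrite /E_term mul_scalar_mx.
rewrite -/c -/mm -/s.
have lb : complex.Re (l lambda) <= a0 + a1 * s - a2 * s ^+ 2 by exact: ha.
have eN : 2 * rho' * N <= a2 / 2 + a2 / 2 * s ^+ 2.
  apply: le_trans (_ : a2 / 2 / H * (2 * N) <= _).
    by rewrite (_ : 2 * rho' * N = rho' * (2 * N)); [rewrite ler_wpM2r// mulr_ge0|ring].
  rewrite mulrAC ler_pdivrMr// (_ : _ * H = a2 / 2 * ((1 + s ^+ 2) * H)); last by ring.
  rewrite ler_wpM2l ?(ltW a4)//.
  rewrite /N /H; have := l1_quad s; have := sqr_ge0 s; nra.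
set E1 := expR (_ + _); set E2 := expR (beta * s).
have -> : 6 * (c * E1 * mm) * (A * E2) = 6 * c * mm * A * (E1 * E2) by ring.
rewrite -[leRHS]mulrA ler_wpM2l ?mulr_ge0// /E1 /E2 -!expRD ler_expR; lra.
Qed.

End CocycleBounds.

(** * Matrix valued sums over the extended affine Weyl group *)

Section MatrixSums.
Context {R : realType}.

Definition hasM (I : choiceType) (A : set I) m n (f : I -> 'M[R[i]]_(m, n)) (L : 'M[R[i]]_(m, n)) :=
  forall i j, hasS A (fun x => f x i j) (L i j).

Section OneIndex.
Variables (I : choiceType) (A : set I).

Lemma hasM_usum m n (f : I -> 'M[R[i]]_(m, n)) L : hasM A f L ->
  usummable A f /\ usum A f = L.
Proof.
move=> /hasS_cvg_mx h; have FF := @summability.totally_filter I; split.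
  by rewrite /usummable; apply/cvg_ex; exists L.
by rewrite /usum; apply: cvg_lim => //; exact: norm_hausdorff.
Qed.

Lemma hasM_uniq m n (f : I -> 'M[R[i]]_(m, n)) L L' : hasM A f L -> hasM A f L' -> L = L'.
Proof. by move=> h h'; apply/matrixP => i j; exact: hasS_uniq (h i j) (h' i j). Qed.

Lemma hasM_ext m n (f g : I -> 'M[R[i]]_(m, n)) L : (forall x, A x -> f x = g x) ->
  hasM A f L -> hasM A g L.
Proof. by move=> e h i j; apply: hasS_ext (h i j) => x /e ->. Qed.

Lemma hasM_mulr m n p (f : I -> 'M[R[i]]_(m, n)) L (N : 'M[R[i]]_(n, p)) :
  hasM A f L -> hasM A (fun x => f x *m N) (L *m N).
Proof.
move=> h i j; rewrite mxE.
apply: hasS_ext (hasS_sum (index_enum 'I_n) (fun l => hasSZr (N l j) (h i l))) => x _.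
by rewrite mxE.
Qed.

Lemma hasM_mull m n p (f : I -> 'M[R[i]]_(m, n)) L (N : 'M[R[i]]_(p, m)) :
  hasM A f L -> hasM A (fun x => N *m f x) (N *m L).
Proof.
move=> h i j; rewrite mxE.
apply: hasS_ext (hasS_sum (index_enum 'I_m) (fun l => hasSZ (N i l) (h l j))) => x _.
by rewrite mxE.
Qed.

Lemma hasM_reindex (J : choiceType) (B : set J) (phi : I -> J) m n (f : J -> 'M[R[i]]_(m, n)) L :
  set_bij A B phi -> hasM B f L -> hasM A (f \o phi) L.
Proof. by move=> bij h i j; exact: hasS_reindex bij (h i j). Qed.

Lemma hasM_abs m (f : I -> 'M[R[i]]_m) : absS A (fun x => mn (f x)) ->
  hasM A f (\matrix_(i, j) csum A (fun x => f x i j)).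
Proof.
move=> h i j; rewrite mxE; apply: absS_csum; apply: absS_le h => x _.
exact: cabs_le_mn.
Qed.

Lemma hasS_finite (f : I -> R[i]) : finite_set A -> hasS A f (\sum_(x \in A) f x).
Proof.
move=> fA e e0; exists (fset_set A) => S sub; rewrite fsbig_finite//= /upartial.
rewrite [X in X - _](_ : _ = \sum_(x <- fset_set A) f x) ?subrr ?cabs0//.
rewrite [LHS]big_fset_condE; apply/esym/big_fset_incl => [|x].
  apply/fsubsetP => x xA; rewrite !inE /= (fsubsetP sub)//=.
  by move: xA; rewrite in_fset_set.
by rewrite in_fset_set// !inE /= => /andP[_ ->].
Qed.

Lemma absS_finite (g : I -> R) : finite_set A -> (forall x, 0 <= g x) -> absS A g.
Proof.
move=> fA g0; exists (\sum_(x <- fset_set A) g x) => S.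
rewrite [leLHS]big_fset_condE; apply: (@ler_sum_fsubset _ _ xpredT) => //.
by apply/fsubsetP => x; rewrite !inE /= in_fset_set// => /andP[].
Qed.

Lemma absS_inj (J : choiceType) (B : set J) (phi : I -> J) (g : J -> R) :
  set_inj A phi -> (forall x, A x -> B (phi x)) -> absS B g -> absS A (g \o phi).
Proof.
move=> inj AB [M hM]; exists M => S.
have := upartial_imfset g S inj AB; rewrite /upartial => <-; exact: hM.
Qed.

End OneIndex.
End MatrixSums.

Section WeylSums.
Context {R : realType} {r m : nat} (D : affine_datum R r).
Variables (d : nat) (b : 'I_d -> 'cV[R]_r).
Hypothesis b_bij : set_bij [set: {ffun 'I_d -> int}] (Y D) (lpt b).

Lemma absS_weylY (g : hatmap R r -> R) : (forall w, 0 <= g w) ->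
  (forall w0, weyl D w0 -> absS setT (fun z => g (tC (lpt b z) \o w0))) ->
  absS (weylY D) g.
Proof.
move=> g0 h.
apply: (absS_image g0 (weylY_bij D)).
have /choice[M hM] : forall w0, exists M, 0 <= M /\ (weyl D w0 ->
    forall S : {fset 'cV[R]_r}, \sum_(y <- S | y \in Y D) g (tC y \o w0) <= M).
  move=> w0; have [hw|nw] := pselect (weyl D w0); last by exists 0.
  have [M hM] := absS_image (g := fun y => g (tC y \o w0)) (fun y => g0 _) b_bij (h w0 hw).
  exists M; split => //; apply: le_trans (hM fset0).
  by rewrite big_mkcond big_seq_fset0.
apply: (@absS_iterated _ _ _ _ _ _ M) => [p|w0 S hw|]; first exact: g0.
  by have [_] := hM w0; apply.
by apply: absS_finite; [exact: finite_weyl|move=> w0; case: (hM w0)].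
Qed.

Lemma weylY_split w : weylY D w -> exists z w0, weyl D w0 /\ w = tC (lpt b z) \o w0.
Proof.
move=> [y [w0 [Yy hw ->]]]; have [_ _ surj] := b_bij.
by have [z _ <-] := surj y Yy; exists z, w0.
Qed.

Lemma weylY_split_uniq z w0 z' w0' : weyl D w0 -> weyl D w0' ->
  tC (lpt b z) \o w0 = tC (lpt b z') \o w0' -> z = z' /\ w0 = w0'.
Proof.
move=> hw hw' e; have [_ inj _] := weylY_bij D; have [sub injb _] := b_bij.
have : (w0, lpt b z) = (w0', lpt b z').
  by apply: inj; [apply/mem_set; split => //=; exact: sub|apply/mem_set; split => //=; exact: sub|].
by case=> -> /injb ->; rewrite ?in_setT.
Qed.

(** Bounds obtained separately on the finitely many cosets of the lattice are glued into one
    summable function and one radius, the minimum. [P] is asserted at some larger radius; the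
    applications shrink it afterwards. *)
Lemma weyl_family (P : hatmap R r -> R -> ({ffun 'I_d -> int} -> R) -> Prop) :
  (forall w0, weyl D w0 -> exists rho g, [/\ 0 < rho, forall z, 0 <= g z, absS setT g & P w0 rho g]) ->
  exists rho g, [/\ 0 < rho, forall w, 0 <= g w, absS (weylY D) g &
    forall w0, weyl D w0 -> exists2 rho', rho <= rho' & P w0 rho' (fun z => g (tC (lpt b z) \o w0))].
Proof.
move=> h.
have /choice[rg hrg] : forall w0, exists rg : R * ({ffun 'I_d -> int} -> R), (0 < rg.1 /\ forall z, 0 <= rg.2 z) /\
   (weyl D w0 -> absS setT rg.2 /\ P w0 rg.1 rg.2).
  move=> w0; have [/h[rho [g [? ? ? ?]]]|nw] := pselect (weyl D w0); first by exists (rho, g).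
  by exists (1, fun=> 0); split.
have /choice[sp hsp] : forall w, exists zw : {ffun 'I_d -> int} * hatmap R r, weylY D w ->
    weyl D zw.2 /\ w = tC (lpt b zw.1) \o zw.2.
  move=> w; have [/weylY_split[z [w0 ?]]|nw] := pselect (weylY D w); first by exists (z, w0).
  by exists ([ffun=> 0], id).
pose g w := (rg (sp w).2).2 (sp w).1.
have gE z w0 : weyl D w0 -> g (tC (lpt b z) \o w0) = (rg w0).2 z.
  move=> hw; have hW : weylY D (tC (lpt b z) \o w0).
    by apply: weylY_comp; [apply/weylY_tC; have [sub _ _] := b_bij; exact: sub|exact: weylY_weyl].
  have [h1 h2] := hsp _ hW; have [e1 e2] := weylY_split_uniq hw h1 h2.
  by rewrite /g -e1 -e2.
have [c c0 hc] : exists2 c : R, 0 < c & forall w0, w0 \in (fset_set (weyl D) : seq _) -> c <= (rg w0).1.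
  apply: uniform_constant => [w0 c c' _ cc hcc|w0 _]; first exact: le_trans hcc.
  by have [[h0 _] _] := hrg w0; exists (rg w0).1.
exists c, g; split => //.
- by move=> w; have [[_ h1] _] := hrg (sp w).2; exact: h1.
- apply: absS_weylY => [w|w0 hw]; first by have [[_ h1] _] := hrg (sp w).2; exact: h1.
  have [_ /(_ hw)[h1 _]] := hrg w0; apply: absS_le h1 => z _; by rewrite gE.
- move=> w0 hw; exists (rg w0).1.
    by apply: hc; rewrite in_fset_set ?mem_set//; exact: finite_weyl.
  have [_ /(_ hw)[_ hP]] := hrg w0.
  by rewrite (_ : (fun z => g (tC (lpt b z) \o w0)) = (rg w0).2)//; apply/funext => z; rewrite gE.
Qed.

End WeylSums.

Section WeylFamilies.
Context {R : realType} {r m : nat} (D : affine_datum R r).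
Variable k : hat R r -> R[i].
Hypothesis k_inv : weylY_invariant D k.
Variable J : hatmap R r -> hat R[i] r -> galg R r.
Hypothesis J_cocycle : is_cocycle D k J.
Variable pi : hatmap R r -> 'M[R[i]]_m.
Hypothesis pi_module : is_module D pi.
Implicit Types (w u : hatmap R r) (lambda h : hat R[i] r).
Local Notation JMw := (JM D pi J).

Lemma basis_exists : exists (d : nat) (b : 'I_d -> 'cV[R]_r),
  [/\ forall i, Y D (b i), set_bij [set: {ffun 'I_d -> int}] (Y D) (lpt b) &
   exists2 K : R, 0 <= K & forall z, (zlen z)%:R <= K * l1 (lpt b z)].
Proof.
by have [d [b [K [h1 h2 h3 h4]]]] := lattice_basis D; exists d, b; split => //; exists K.
Qed.

Lemma ctrl_E_weylY lambda (v : hat R r) : hreg_plus D k lambda -> Vplus v ->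
  exists rho g, [/\ 0 < rho, forall h, hn h <= rho -> hreg_plus D k (lambda + h),
    absS (weylY D) g &
    forall w, weylY D w -> ctrl lambda rho (g w) (fun l => E_term D pi J v l w)].
Proof.
move=> hl Vv; have [d [b [bY bij len]]] := basis_exists.
have := @weyl_family _ _ _ _ _ bij (fun w0 rho g => (forall h, hn h <= rho -> hreg_plus D k (lambda + h)) /\
  forall z, ctrl lambda rho (g z) (fun l => E_term D pi J v l (tC (lpt b z) \o w0))).
case.
  move=> w0 hw; have [rho [g [r0 near ag cg]]] := ctrl_E_term k_inv J_cocycle pi_module bY len hl hw Vv.
  by exists rho, g; split => // z; exact: ctrl_ge0 (cg z).
move=> rho [g [r0 g0 ag hg]]; exists rho, g; split => //.
  have [rho' rr [near _]] := hg id (weyl_id D).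
  by move=> h hh; apply: near; exact: le_trans rr.
move=> w /(weylY_split bij)[z [w0 [hw ->]]].
have [rho' rr [_ cg]] := hg w0 hw; exact: ctrl_radius rr (cg z).
Qed.

Lemma dmajor_rho (I : choiceType) (mu : I -> hat R[i] r) C x rho rho' i : rho' <= rho ->
  dmajor mu C x rho' i <= dmajor mu C x rho i.
Proof.
move=> rr; rewrite /dmajor ler_wpM2l ?cabs_ge0// ler_expR lerD2l.
by rewrite ler_wpM2r ?hn_ge0.
Qed.

Lemma good_weylY lambda i j : hreg_plus D k lambda ->
  good (weylY D) (fun w => w lambda) (fun w => JMw w lambda i j).
Proof.
move=> hl x Vx; have [d [b [bY bij len]]] := basis_exists.
have := @weyl_family _ _ _ _ _ bij (fun w0 rho g => forall z,
   dmajor (muw b lambda w0) (fun z => JMw (tC (lpt b z) \o w0) lambda i j) x rho z <= g z).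
case.
  move=> w0 hw; have [rho r0 ag] := good_cocycle k_inv J_cocycle pi_module bY len i j hl hw Vx.
  exists rho, (dmajor (muw b lambda w0) (fun z => JMw (tC (lpt b z) \o w0) lambda i j) x rho).
  by split => // z; rewrite mulr_ge0 ?cabs_ge0 ?expR_ge0.
move=> rho [g [r0 g0 ag hg]]; exists rho => //.
apply: absS_le ag => w /(weylY_split bij)[z [w0 [hw ->]]].
have [rho' rr hg'] := hg w0 hw; apply: le_trans (hg' z).
exact: (@dmajor_rho _ (fun w => w lambda) (fun w => JMw w lambda i j) x rho' rho (tC (lpt b z) \o w0)).
Qed.

Lemma tC_inj : set_inj (Y D) (tC (R := R) (r := r)).
Proof.
move=> y y' /set_mem hy /set_mem hy' e; have [_ inj _] := weylY_bij D.
have : (id, y) = (id, y') :> hatmap R r * 'cV[R]_r.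
  by apply: inj; [apply/mem_set; split => //; exact: weyl_id|apply/mem_set; split => //; exact: weyl_id|rewrite /= e].
by case.
Qed.

Lemma good_Y lambda i j : hreg_plus D k lambda ->
  good (Y D) (fun y => tC y lambda) (fun y => JMw (tC y) lambda i j).
Proof.
move=> hl x Vx; have [rho r0 ag] := good_weylY i j hl Vx; exists rho => //.
have := absS_inj tC_inj (fun y => @weylY_tC _ _ D y) ag; exact.
Qed.

Lemma ctrl_E_Y lambda (v : hat R r) : hreg_plus D k lambda -> Vplus v ->
  exists rho g, [/\ 0 < rho, forall h, hn h <= rho -> hreg_plus D k (lambda + h),
    absS (Y D) g &
    forall y, Y D y -> ctrl lambda rho (g y) (fun l => E_term D pi J v l (tC y))].
Proof.
move=> hl Vv; have [rho [g [r0 near ag hg]]] := ctrl_E_weylY hl Vv.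
exists rho, (g \o (tC (R := R) (r := r))); split => //.
  have := absS_inj tC_inj (fun y => @weylY_tC _ _ D y) ag; exact.
by move=> y /weylY_tC hy; exact: hg.
Qed.

Lemma absS_E_weylY lambda (v : hat R r) : hreg_plus D k lambda -> Vplus v ->
  absS (weylY D) (fun w => mn (E_term D pi J v lambda w)).
Proof.
move=> hl Vv; have [rho [g [r0 near ag hg]]] := ctrl_E_weylY hl Vv.
by apply: absS_le ag => w /hg[L []].
Qed.

Lemma absS_E_Y lambda (v : hat R r) : hreg_plus D k lambda -> Vplus v ->
  absS (Y D) (fun y => mn (E_term D pi J v lambda (tC y))).
Proof.
move=> hl Vv; have := absS_inj tC_inj (fun y => @weylY_tC _ _ D y) (absS_E_weylY hl Vv); exact.
Qed.

Lemma hasM_E_M lambda (v : hat R r) : hreg_plus D k lambda -> Vplus v ->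
  hasM (Y D) (fun y => E_term D pi J v lambda (tC y)) (E_M D pi J v lambda).
Proof.
move=> hl Vv; have h := hasM_abs (absS_E_Y hl Vv).
by have [_ e] := hasM_usum h; rewrite /E_M e.
Qed.

Lemma hasM_E_Mplus lambda (v : hat R r) : hreg_plus D k lambda -> Vplus v ->
  hasM (weylY D) (E_term D pi J v lambda) (E_Mplus D pi J v lambda).
Proof.
move=> hl Vv; have h := hasM_abs (absS_E_weylY hl Vv).
by have [_ e] := hasM_usum h; rewrite /E_Mplus e.
Qed.

(** The cocycle rule for a single summand; the decomposition over the Weyl group and the equations
    in lambda are reindexings of it. *)
Lemma E_term_comp lambda v w u : weylY D w -> weylY D u -> hreg D k lambda ->
  E_term D pi J v lambda (w \o u) = E_term D pi J v (u lambda) w *m JMw u lambda.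
Proof.
by move=> hw hu hl; rewrite /E_term (JM_mul k_inv J_cocycle pi_module hw hu hl) scalemxAl.
Qed.

Lemma E_Mplus_decomposition lambda (v : hat R r) : hreg_plus D k lambda -> Vplus v ->
  E_Mplus D pi J v lambda =
    \sum_(w \in weyl D) E_M D pi J v (w lambda) *m JMw w lambda.
Proof.
move=> hl Vv; have h := hasM_reindex (weylY_bij D) (hasM_E_Mplus hl Vv).
apply/matrixP => i j; have fin := finite_weyl D.
have := hasS_iterated (h i j) (s := fun w => (E_M D pi J v (w lambda) *m JMw w lambda) i j).
have hs w : weyl D w -> hasS (Y D) (fun y => E_term D pi J v lambda (tC y \o w) i j)
    ((E_M D pi J v (w lambda) *m JMw w lambda) i j).
  move=> hw; have hW := weylY_weyl hw.
  have := hasM_mulr (JMw w lambda) (hasM_E_M (hreg_plus_weylY k_inv hW hl) Vv).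
  move=> /(_ i j); apply: hasS_ext => y /weylY_tC hy.
  by rewrite E_term_comp//; case: hl.
move=> /(_ hs) h'; rewrite (hasS_uniq h' (hasS_finite _ fin)).
by rewrite !fsbig_finite//= summxE.
Qed.

End WeylFamilies.

(** * The spectral variable *)

Lemma differentiable_quad (K : numFieldType) (V W : normedModType K) (f L : V -> W)
    (x : V) (rho M : K) : linear L -> 0 < rho -> 0 <= M ->
  (forall h, `|L h| <= M * `|h|) ->
  (forall h, `|h| < rho -> `|f (x + h) - f x - L h| <= M * `|h| ^+ 2) ->
  differentiable f x.
Proof.
move=> linL r0 M0 Lb fb.
pose LM := GRing.isLinear.Build _ _ _ _ _ linL.
pose Lin : {linear V -> W} := HB.pack L LM.
have cL : continuous Lin.
  move=> z; apply/cvgrPdist_le => e e0; have M1 : 0 < M + 1 by rewrite ltr_wpDl.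
  near=> y; rewrite -linearB; apply: le_trans (Lb _) _.
  apply: le_trans (_ : (M + 1) * `|z - y| <= _); first by rewrite ler_wpM2r// lerDl.
  rewrite mulrC -ler_pdivlMr//; near: y; apply: cvgr_dist_le => //.
  by rewrite divr_gt0.
have eq : f \o shift x = cst (f x) + Lin +o_ 0 id.
  apply/eqaddoP => e e0; have M1 : 0 < M + 1 by rewrite ltr_wpDl.
  near=> h; rewrite -[(_ - _ : _ -> _) _]/(f (h + x) - (f x + L h)) opprD addrA [h + x]addrC.
  have hr : `|h| < rho by near: h; apply: nbhs0_lt.
  have he : `|h| <= e / (M + 1) by near: h; apply: nbhs0_le; rewrite divr_gt0.
  apply: le_trans (fb h hr) _; rewrite expr2 mulrA ler_wpM2r//.
  apply: le_trans (_ : (M + 1) * `|h| <= _); first by rewrite ler_wpM2r// lerDl.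
  by rewrite mulrC -ler_pdivlMr.
by apply/diff_locallyP; rewrite (diff_unique cL eq).
Unshelve. all: by end_near. Qed.

Section HolomorphicSums.
Context {R : realType} {r m : nat}.

Lemma hn_norm_lt (h : hat R[i] r) (rho : R) :
  `|h| < toC (rho / (r%:R + 2)) -> hn h <= rho.
Proof.
have r2 : 0 < r%:R + 2 :> R by rewrite ltr_wpDl.
by move=> /ltW /hn_norm; rewrite mulrC divfK// gt_eqF.
Qed.

(** The differential of the sum is the sum of the differentials, convergent and bounded because
    their constants [g] are summable; the remainders add in the same way. *)
Lemma differentiable_ctrl_sum (I : choiceType) (A : set I) (lambda : hat R[i] r) (rho : R)
    (T : I -> hat R[i] r -> 'M[R[i]]_m) (g : I -> R) (F : hat R[i] r -> 'M[R[i]]_m) :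
  0 < rho -> absS A g -> (forall w, A w -> ctrl lambda rho (g w) (T w)) ->
  (forall h, hn h <= rho -> hasM A (fun w => T w (lambda + h)) (F (lambda + h))) ->
  forall i j, differentiable (fun l => F l i j) lambda.
Proof.
move=> r0 ag hc hF i j.
have /choice[L hL] : forall w, exists L : hat R[i] r -> 'M[R[i]]_m, A w -> [/\ linear_map L,
  mn (T w lambda) <= g w, forall h, mn (L h) <= g w * hn h &
  forall h, hn h <= rho -> mn (T w (lambda + h) - T w lambda - L h) <= g w * hn h ^+ 2].
  move=> w; have [/hc[L ?]|nA] := pselect (A w); first by exists L.
  by exists (fun=> 0).
have abL h : absS A (fun w => cabs (L w h i j)).
  apply: absS_le (absSZ (c := hn h) (hn_ge0 _) ag) => w Aw; have [_ _ h2 _] := hL w Aw.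
  by apply: le_trans (cabs_le_mn _ _ _) _; rewrite mulrC.
have sL h := absS_csum (abL h).
pose LL h := csum A (fun w => L w h i j).
have [M0 hM0] := ag; pose M := `|M0|.
have hM (S : {fset I}) : \sum_(w <- S | w \in A) g w <= M.
  by apply: le_trans (hM0 S) _; exact: ler_norm.
have M_ge0 : 0 <= M by exact: normr_ge0.
have LLb h : cabs (LL h) <= M * hn h.
  apply: (hasS_le (sL h)) => S; apply: le_trans (_ : \sum_(w <- S | w \in A) g w * hn h <= _).
    apply: ler_sum => w /set_mem Aw; have [_ _ h2 _] := hL w Aw.
    exact: le_trans (cabs_le_mn _ _ _) (h2 h).
  by rewrite -mulr_suml ler_wpM2r ?hn_ge0.
have Fb h : hn h <= rho -> cabs (F (lambda + h) i j - F lambda i j - LL h) <= M * hn h ^+ 2.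
  move=> hh; have h0 : hn (0 : hat R[i] r) <= rho by rewrite hn0 ltW.
  have := hF 0 h0; rewrite addr0 => hF0.
  have sm := hasSB (hasSB (hF h hh i j) (hF0 i j)) (sL h).
  apply: (hasS_le sm) => S; apply: le_trans (_ : \sum_(w <- S | w \in A) g w * hn h ^+ 2 <= _).
    apply: ler_sum => w /set_mem Aw; have [_ _ _ h3] := hL w Aw.
    apply: le_trans (h3 h hh); have := cabs_le_mn (T w (lambda + h) - T w lambda - L w h) i j.
    by rewrite !mxE.
  by rewrite -mulr_suml ler_wpM2r ?exprn_ge0 ?hn_ge0.
have linLL : linear (LL : hat R[i] r -> R[i]).
  move=> c h h'; apply: csumE; apply: hasS_ext (hasSD (hasSZ c (sL h)) (sL h')) => w Aw.
  have [[lD lZ] _ _ _] := hL w Aw; by rewrite lD lZ !mxE.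
(* [hn] is at most [q] times the norm, so the linear bound acquires [q] and the quadratic one
   [q ^+ 2]; their sum serves both. *)
pose q : R := r%:R + 2; have q0 : 0 < q by rewrite /q ltr_wpDl.
have hq h : toC (hn h) <= toC q * `|h : hat R[i] r|.
  by rewrite /q [toC (r%:R + 2)]toCD !natC; exact: hn_norm_le.
have T0 (x : R) : 0 <= x -> 0 <= toC x by move=> x0; rewrite -toC0 ler_toC.
apply: (differentiable_quad (L := LL : hat R[i] r -> R[i]) (rho := toC (rho / q))
  (M := toC (M * (q + q ^+ 2)))) => //.
- by rewrite -toC0 ltr_toC divr_gt0.
- by rewrite T0// mulr_ge0// addr_ge0 ?sqr_ge0// ltW.
- move=> h; rewrite cabsE; apply: le_trans (_ : toC M * toC (hn h) <= _).
    by rewrite -toCM ler_toC.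
  rewrite toCM -mulrA ler_wpM2l ?T0//; apply: le_trans (hq h) _.
  by rewrite ler_wpM2r// ler_toC lerDl sqr_ge0.
- move=> h /hn_norm_lt hh; rewrite cabsE; apply: le_trans (_ : toC M * toC (hn h) ^+ 2 <= _).
    by rewrite -toCX -toCM ler_toC; exact: Fb.
  rewrite toCM -mulrA ler_wpM2l ?T0//; apply: le_trans (_ : (toC q * `|h|) ^+ 2 <= _).
    by apply: lerXn2r; rewrite ?nnegrE ?T0 ?hn_ge0// mulr_ge0// T0// ltW.
  by rewrite exprMn ler_wpM2r ?exprn_ge0// -toCX ler_toC lerDr ltW.
Qed.

End HolomorphicSums.

Section SpectralSide.
Context {R : realType} {r m : nat} (D : affine_datum R r).
Variable k : hat R r -> R[i].
Hypothesis k_inv : weylY_invariant D k.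
Variable J : hatmap R r -> hat R[i] r -> galg R r.
Hypothesis J_cocycle : is_cocycle D k J.
Variable pi : hatmap R r -> 'M[R[i]]_m.
Hypothesis pi_module : is_module D pi.
Implicit Types (w u : hatmap R r) (lambda h : hat R[i] r) (v : hat R r).
Local Notation JMw := (JM D pi J).

(** Moving lambda along c multiplies every summand by the same exponential, so the sums satisfy this
    functional equation exactly. *)
Lemma is_derive_exp_line (V : normedModType R[i]) (f : V -> R[i]) (x u : V) (xi : R[i]) :
  (forall s : R[i], f (x + s *: u) = cexp (s * xi) * f x) -> 'D_u f x = xi * f x.
Proof.
move=> h; pose M := cabs (f x) * (cabs xi ^+ 2 * expR (cabs xi)).
have M0 : 0 <= M by rewrite mulr_ge0 ?cabs_ge0// mulr_ge0 ?sqr_ge0 ?expR_ge0.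
suff [] : is_derive x u f (xi * f x) by [].
apply: (is_derive_quad (rho := 1) (M := toC M)) => //; first by rewrite -toC0 ler_toC.
move=> s; rewrite h cabsE -toC1 ltr_toC => s1.
have -> : cexp (s * xi) * f x - f x - s *: (xi * f x) = f x * (cexp (s * xi) - 1 - s * xi).
  by rewrite /GRing.scale /=; ring.
rewrite cabsE -toCX -toCM ler_toC cabsM /M -mulrA ler_wpM2l ?cabs_ge0//.
apply: le_trans (cexp_remainder _) _; rewrite cabsM exprMn.
have -> : cabs xi ^+ 2 * expR (cabs xi) * cabs s ^+ 2 = cabs s ^+ 2 * cabs xi ^+ 2 * expR (cabs xi) by ring.
apply: ler_wpM2l; first by rewrite mulr_ge0 ?sqr_ge0.
rewrite ler_expR.
by rewrite ler_piMl ?cabs_ge0// ltW.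
Qed.

Lemma hreg_plus_chat (s : R[i]) lambda : hreg_plus D k lambda -> hreg_plus D k (lambda + s *: chat).
Proof.
move=> [h1 h2]; split; first exact: hreg_chat.
by rewrite /= /GRing.scale /= mulr0 addr0.
Qed.

Lemma E_term_chat v w (s : R[i]) lambda : weylY D w -> hreg D k lambda ->
  E_term D pi J v (lambda + s *: chat) w = cexp (s * toC v.2) *: E_term D pi J v lambda w.
Proof.
move=> hw hl; rewrite /E_term (JM_chat k_inv J_cocycle pi_module)//.
rewrite (chat_weylY _ _ hw) hformDl hformZl cexpD scalerA mulrC; congr (cexp (_ * _) * _ *: _).
by rewrite /hform /= dotv0l mul0r add0r mul1r addr0.
Qed.

Lemma hasMZ (I : choiceType) (A : set I) (f : I -> 'M[R[i]]_m) L (c : R[i]) :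
  hasM A f L -> hasM A (fun x => c *: f x) (c *: L).
Proof.
by move=> h i j; rewrite mxE; apply: hasS_ext (hasSZ c (h i j)) => x _; rewrite mxE.
Qed.

Lemma E_M_O_xi v : Vplus v -> tensor_End (O_xi D k (toC v.2)) (E_M D pi J v).
Proof.
move=> Vv i j; split=> lambda hl.
  have [rho [g [r0 near ag hc]]] := ctrl_E_Y k_inv J_cocycle pi_module hl Vv.
  apply: (differentiable_ctrl_sum r0 ag hc) => h hh.
  exact: hasM_E_M (near h hh) Vv.
apply: (@is_derive_exp_line _ (fun l => E_M D pi J v l i j)) => s.
have h1 := hasM_E_M k_inv J_cocycle pi_module (hreg_plus_chat s hl) Vv.
have h2 := hasMZ (cexp (s * toC v.2)) (hasM_E_M k_inv J_cocycle pi_module hl Vv).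
have -> : E_M D pi J v (lambda + s *: chat) = cexp (s * toC v.2) *: E_M D pi J v lambda.
  apply: hasM_uniq h1 _; apply: hasM_ext h2 => y /weylY_tC hy.
  by rewrite E_term_chat//; case: hl.
by rewrite mxE.
Qed.

Lemma E_Mplus_O_xi v : Vplus v -> tensor_End (O_xi D k (toC v.2)) (E_Mplus D pi J v).
Proof.
move=> Vv i j; split=> lambda hl.
  have [rho [g [r0 near ag hc]]] := ctrl_E_weylY k_inv J_cocycle pi_module hl Vv.
  apply: (differentiable_ctrl_sum r0 ag (T := fun w l => E_term D pi J v l w) hc) => h hh.
  exact: hasM_E_Mplus (near h hh) Vv.
apply: (@is_derive_exp_line _ (fun l => E_Mplus D pi J v l i j)) => s.
have h1 := hasM_E_Mplus k_inv J_cocycle pi_module (hreg_plus_chat s hl) Vv.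
have h2 := hasMZ (cexp (s * toC v.2)) (hasM_E_Mplus k_inv J_cocycle pi_module hl Vv).
have -> : E_Mplus D pi J v (lambda + s *: chat) = cexp (s * toC v.2) *: E_Mplus D pi J v lambda.
  apply: hasM_uniq h1 _; apply: hasM_ext h2 => w hw.
  by rewrite E_term_chat//; case: hl.
by rewrite mxE.
Qed.

Lemma Y_shift_bij y : Y D y -> set_bij (Y D) (Y D) (fun y' => y' + y).
Proof.
move=> hy; split=> [y' hy'|y1 y2 _ _ /addIr//|y' hy']; first exact: YD.
by exists (y' - y); rewrite ?subrK//; apply: YD => //; exact: YN.
Qed.

Lemma weylY_shift_bij u : weylY D u -> set_bij (weylY D) (weylY D) (fun w => w \o u).
Proof.
move=> hu; have [u' [hu' c1 c2]] := weylY_inv hu; split=> [w hw|w1 w2 _ _ e|w hw].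
- exact: weylY_comp.
- apply/funext => x; rewrite -[x]c2; exact: (congr1 (fun f => f (u' x)) e).
- exists (w \o u'); first exact: weylY_comp.
  by apply/funext => x /=; rewrite c1.
Qed.

Lemma E_M_invariant v y lambda : Vplus v -> Y D y -> hreg_plus D k lambda ->
  ract D pi J (E_M D pi J v) (tC y) lambda = E_M D pi J v lambda.
Proof.
move=> Vv hy hl; have hY := weylY_tC hy.
have h1 := hasM_E_M k_inv J_cocycle pi_module (hreg_plus_weylY k_inv hY hl) Vv.
have h2 := hasM_reindex (Y_shift_bij hy) (hasM_E_M k_inv J_cocycle pi_module hl Vv).
apply: hasM_uniq (hasM_mulr (JMw (tC y) lambda) h1) _.
apply: hasM_ext h2 => y' /weylY_tC hy' /=.
by rewrite -tC_comp (E_term_comp k_inv J_cocycle pi_module)//; case: hl.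
Qed.

Lemma E_Mplus_invariant v u lambda : Vplus v -> weylY D u -> hreg_plus D k lambda ->
  ract D pi J (E_Mplus D pi J v) u lambda = E_Mplus D pi J v lambda.
Proof.
move=> Vv hu hl.
have h1 := hasM_E_Mplus k_inv J_cocycle pi_module (hreg_plus_weylY k_inv hu hl) Vv.
have h2 := hasM_reindex (weylY_shift_bij hu) (hasM_E_Mplus k_inv J_cocycle pi_module hl Vv).
apply: hasM_uniq (hasM_mulr (JMw u lambda) h1) _.
apply: hasM_ext h2 => w hw /=.
by rewrite (E_term_comp k_inv J_cocycle pi_module)//; case: hl.
Qed.

End SpectralSide.

(** * The real variable *)

Section RealAnalyticSeries.
Context {R : realType} {r : nat}.
Implicit Types (f g : hat R r -> R[i]) (x u v h : hat R r).

Lemma near_Vplus x : Vplus x -> \forall z \near x, Vplus z.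
Proof.
move=> Vx; apply/nbhs_ballP; exists x.2 => //= z; rewrite -ball_normE /= => hz.
have /normr_prod[_ h2] := lexx `|x - z|.
have : `|x.2 - z.2| < x.2 by exact: le_lt_trans h2 hz.
rewrite ltr_norml /Vplus /= => /andP[_]; lra.
Qed.

(** The matrix sums are identified with exponential series on [Vplus] only; this set being open,
    derivatives there depend on nothing else. *)
Lemma dirder_near f g x u : (forall z, Vplus z -> f z = g z) -> Vplus x ->
  dirder u f x = dirder u g x.
Proof.
move=> fg Vx; rewrite /dirder; have nV := near_Vplus Vx.
congr (_ +i* _)%C; apply: near_eq_derive; near=> z; rewrite fg//; by near: z.
Unshelve. all: by end_near. Qed.

Lemma analytic_near f g x : (forall z, Vplus z -> f z = g z) -> Vplus x ->
  analytic_at g x -> analytic_at f x.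
Proof.
move=> fg Vx [rho [c [r0 hc]]]; exists (Num.min rho x.2), c.
split=> [|h]; first by rewrite lt_min r0.
rewrite lt_min => /andP[h1 h2]; rewrite fg; first exact: hc.
have /normr_prod[_ h3] := lexx `|h|.
have : `|h.2| < x.2 by exact: le_lt_trans h3 h2.
rewrite ltr_norml /Vplus /= => /andP[]; lra.
Qed.

Variables (I : choiceType) (A : set I) (mu : I -> hat R[i] r) (C : I -> R[i]).
Variables (kappa Gam : R[i]) (f : hat R r -> R[i]).
Hypothesis gC : good A mu C.
Hypothesis fE : forall x, Vplus x -> f x = dseries A mu C x.
Hypothesis mu_d : forall i, A i -> (mu i).2 = kappa.
Hypothesis mu_form : forall i, A i -> hform (mu i) (mu i) = Gam.

Lemma hform_chat (l : hat R[i] r) : hform l (hatC chat) = l.2.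
Proof. by rewrite /hform /= vecC0 dotv0r toC0 toC1; ring. Qed.

Lemma hform_dhat (l : hat R[i] r) : hform l (hatC dhat) = l.1.2.
Proof. by rewrite /hform /= vecC0 dotv0r toC0 toC1; ring. Qed.

Lemma hform_delta (l : hat R[i] r) (i : 'I_r) : hform l (hatC (vhat (delta_mx i 0))) = l.1.1 i 0.
Proof.
rewrite /hform /= toC0 !mulr0 !addr0 /dotv (bigD1 i)//= !mxE !eqxx toC1 mulr1.
by rewrite big1 ?addr0// => j /negbTE ji; rewrite !mxE ji toC0 mulr0.
Qed.

Lemma dseries_Comega_kappa : Comega_kappa kappa f.
Proof.
split=> x Vx; first by apply: (analytic_near fE Vx); exact: analytic_dseries.
rewrite (dirder_near _ fE Vx) dirder_dseries// fE//.
apply: csumE; apply: hasS_ext (hasSZ kappa (dseries_hasS gC Vx)) => i Ai.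
by rewrite /dterm /dcoef hform_chat mu_d// mulrA.
Qed.

Lemma dirder2_series x u w : Vplus x ->
  dirder u (dirder w f) x = dseries A mu (dcoef mu u (dcoef mu w C)) x.
Proof.
move=> Vx; rewrite (@dirder_near _ (dirder w (dseries A mu C))) ?dirder2_dseries// => z Vz.
exact: dirder_near.
Qed.

(** On the exponential of (mu, v) the operator acts by the scalar (mu, mu), its c-d part coming from
    the mixed derivative. The hypotheses give every term the same two eigenvalues. *)
Lemma dseries_Shat : Shat kappa Gam f.
Proof.
split=> [|x Vx]; first exact: dseries_Comega_kappa.
rewrite /hatLaplacian; under eq_bigr do rewrite dirder2_series//.
rewrite dirder2_series// fE//.
have h1 u w := dseries_hasS (good_dcoef u (good_dcoef w gC)) Vx.
have h2 := hasSD (hasS_sum (index_enum 'I_r) (fun i => h1 (vhat (delta_mx i 0)) (vhat (delta_mx i 0))))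
  (hasSZ 2 (h1 chat dhat)).
apply: hasS_uniq h2 _; apply: hasS_ext (hasSZ Gam (dseries_hasS gC Vx)) => i Ai.
rewrite /dterm /dcoef hform_chat hform_dhat.
set e := cexp _.
rewrite [X in _ = X + _](_ : _ = dotv (mu i).1.1 (mu i).1.1 * (C i * e)); last first.
  by rewrite mulr_suml; apply: eq_bigr => j _; rewrite hform_delta; ring.
by rewrite -(mu_form Ai) /hform; ring.
Qed.

End RealAnalyticSeries.

Section RealSide.
Context {R : realType} {r m : nat} (D : affine_datum R r).
Variable k : hat R r -> R[i].
Hypothesis k_inv : weylY_invariant D k.
Variable J : hatmap R r -> hat R[i] r -> galg R r.
Hypothesis J_cocycle : is_cocycle D k J.
Variable pi : hatmap R r -> 'M[R[i]]_m.
Hypothesis pi_module : is_module D pi.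
Variable lambda : hat R[i] r.
Hypothesis hl : hreg_plus D k lambda.
Implicit Types (w u : hatmap R r) (v : hat R r) (a : hat R r).
Local Notation JMw := (JM D pi J).
Local Notation E := (fun v => E_Mplus D pi J v lambda).

Lemma E_M_dseries i j v : Vplus v ->
  E_M D pi J v lambda i j = dseries (Y D) (fun y => tC y lambda) (fun y => JMw (tC y) lambda i j) v.
Proof.
move=> Vv; apply/esym/csumE; apply: hasS_ext (hasM_E_M k_inv J_cocycle pi_module hl Vv i j) => y _.
by rewrite /E_term mxE mulrC.
Qed.

Lemma E_Mplus_dseries i j v : Vplus v ->
  E v i j = dseries (weylY D) (fun w => w lambda) (fun w => JMw w lambda i j) v.
Proof.
move=> Vv; apply/esym/csumE; apply: hasS_ext (hasM_E_Mplus k_inv J_cocycle pi_module hl Vv i j) => w _.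
by rewrite /E_term mxE mulrC.
Qed.

Lemma weylY_lshift_bij u : weylY D u -> set_bij (weylY D) (weylY D) (fun w => u \o w).
Proof.
move=> hu; have [u' [hu' c1 c2]] := weylY_inv hu; split=> [w hw|w1 w2 _ _ e|w hw].
- exact: weylY_comp.
- apply/funext => x; rewrite -[w1 x]c1 -[w2 x]c1; congr (u' _).
  exact: (congr1 (fun f => f x) e).
- exists (u' \o w); first exact: weylY_comp.
  by apply/funext => x /=; rewrite c2.
Qed.

(** The cocycle matrix of [o] is [pi o], and (w lambda, o^-1 v) = (o w lambda, v): the operator
    sends the summand of [w] to that of [o \o w]. *)
Lemma Q_omega_E o o' v : Omega D o -> cancel o o' -> cancel o' o -> Vplus v ->
  Q_omega pi o o' E v = E v.
Proof.
move=> ho c1 c2 Vv; have hW : weylY D o by case: ho.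
have [u [hu d1 d2]] := weylY_inv hW.
(* [o'] is given as a two-sided inverse map; inverses being unique, it belongs to the group. *)
have eu : o' = u by apply/funext => x; rewrite -[x in LHS]d2 c1.
rewrite -eu in hu; have rg := rigid_weylY hu.
rewrite /Q_omega; set v' := hatRe _.
have ev : hatC v' = o' (hatC v) by rewrite /v' -(rigid_real rg).
have e2 : v'.2 = v.2.
  by apply: toC_inj; rewrite -[LHS]/((hatC v').2) ev (rigid_d rg).
have Vv' : Vplus v' by move: Vv; rewrite /Vplus /mkset -e2.
have h1 := hasM_mull (pi o) (hasM_E_Mplus k_inv J_cocycle pi_module hl Vv').
have h2 := hasM_reindex (weylY_lshift_bij hW) (hasM_E_Mplus k_inv J_cocycle pi_module hl Vv).
apply: hasM_uniq h1 _; apply: hasM_ext h2 => w hw /=.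
have hreg : hreg D k lambda by case: hl.
rewrite /E_term ev (JM_mul k_inv J_cocycle pi_module hW hw hreg).
rewrite (JM_omega J_cocycle)//; last exact: hreg_weylY.
rewrite -scalemxAr; congr (cexp _ *: _).
by rewrite -[in RHS](rigid_form (rigid_weylY hW)) c2.
Qed.

Lemma Vplus_coroot a v (t : R) : Rhat D a -> Vplus v -> Vplus (v - t *: hcoroot a).
Proof.
move=> /RhatP[n [_ ->]]; rewrite /Vplus /= /hcoroot /=.
by rewrite /GRing.scale /= !mulr0 subr0.
Qed.

(** The path v - t a^vee reaches the reflected point at t = (a, v), so the integral contributes
    boundary terms at [hrefl a v] and at [v]. *)
Lemma hrefl_coroot a v : hrefl a v = v - hform a v *: hcoroot a.
Proof.
rewrite /hrefl /hcoroot hformZr scalerA; congr (_ - _ *: _).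
by rewrite mulrC hformC.
Qed.

(** Along the line each term is an exponential in t with rate - (a^vee, mu). Dividing the
    coefficients by these rates gives a primitive, again a convergent series since they stay away
    from 0. *)
Lemma cint0_dseries (I : choiceType) (A : set I) (mu : I -> hat R[i] r) (C : I -> R[i]) a v
    (c : R) (f : hat R r -> R[i]) :
  Rhat D a -> Vplus v -> good A mu C -> (forall x, Vplus x -> f x = dseries A mu C x) ->
  (forall i, A i -> cpair a (mu i) != 0) ->
  0 <= c -> (forall i, A i -> cabs (- (cpair a (mu i))^-1) <= c) ->
  forall b, cint0 (fun t => f (v - t *: hcoroot a)) b =
    dseries A mu (fun i => - (cpair a (mu i))^-1 * C i) (v - b *: hcoroot a) -
    dseries A mu (fun i => - (cpair a (mu i))^-1 * C i) v.
Proof.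
move=> ra Vv gC fE nz c0 hc b.
have gG : good A mu (fun i => - (cpair a (mu i))^-1 * C i).
  apply: (good_mul c0) gC => i Ai; apply: le_trans (hc i Ai) _.
  by rewrite ler_peMr// lerDl hn_ge0.
have line C' t (s : R) : dseries A mu C' (v - (t + s *: (1 : R)) *: hcoroot a) =
   dseries A mu C' (v - t *: hcoroot a + s *: (- hcoroot a)).
  congr dseries; rewrite [s *: _]mulr1 scalerDl opprD addrA scalerN //.
have der C' t : good A mu C' ->
  is_derive t (1 : R) ((fun t : R => complex.Re (dseries A mu C' (v - t *: hcoroot a))) : R -> R^o)
    (complex.Re (dseries A mu (dcoef mu (- hcoroot a) C') (v - t *: hcoroot a))) /\
  is_derive t (1 : R) ((fun t : R => complex.Im (dseries A mu C' (v - t *: hcoroot a))) : R -> R^o)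
    (complex.Im (dseries A mu (dcoef mu (- hcoroot a) C') (v - t *: hcoroot a))).
  move=> gC'; have Vt := Vplus_coroot t ra Vv.
  have [rho [M [r0 M0 h]]] := dseries_quad (- hcoroot a) gC' Vt.
  apply: (@is_derive_ReIm_quad R R (fun t => dseries A mu C' (v - t *: hcoroot a)) t 1).
  by exists rho, M; split => // s hs; rewrite line; exact: h.
have fG t : f (v - t *: hcoroot a) = dseries A mu (dcoef mu (- hcoroot a)
    (fun i => - (cpair a (mu i))^-1 * C i)) (v - t *: hcoroot a).
  have Vt := Vplus_coroot t ra Vv; rewrite fE//; apply: csum_ext => i Ai.
  have ez : hform (mu i) (hatC (- hcoroot a)) = - cpair a (mu i).
    by rewrite hatCN hformNr hformC.
  rewrite /dterm /dcoef ez; congr (_ * _).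
  by rewrite mulrA mulrNN mulfV ?mul1r// nz.
pose G t := dseries A mu (fun i => - (cpair a (mu i))^-1 * C i) (v - t *: hcoroot a).
transitivity (G b - G 0); last by rewrite /G scale0r subr0.
apply: cint0_FTC.
- move=> t; have -> : (fun t => complex.Re (f (v - t *: hcoroot a))) =
    fun t => complex.Re (dseries A mu C (v - t *: hcoroot a)).
    by apply/funext => s; rewrite fE//; exact: Vplus_coroot.
  apply/differentiable_continuous/derivable1_diffP.
  by have [[]] := der C t gC.
- move=> t; have -> : (fun t => complex.Im (f (v - t *: hcoroot a))) =
    fun t => complex.Im (dseries A mu C (v - t *: hcoroot a)).
    by apply/funext => s; rewrite fE//; exact: Vplus_coroot.
  apply/differentiable_continuous/derivable1_diffP.
  by have [_ []] := der C t gC.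
- by move=> t; rewrite fG; have [] := der _ t gG.
- by move=> t; rewrite fG; have [] := der _ t gG.
Qed.

Lemma Q_refl_E a v : Fhat D a -> Vplus v -> Q_refl k pi a E v = E v.
Proof.
move=> ha Vv; have ra := Fhat_Rhat ha; have hs := sC_weylY ra.
have hreg : hreg D k lambda by case: hl.
have [rho [C [_ _ [C0 _] _ hC]]] := reg_constP k_inv hl.
pose z w := cpair a (w lambda).
have hz w : weylY D w -> z w != 0 /\ cabs (- (z w)^-1) <= C.
  move=> hw; have [b [hb _ eb _]] := cpair_weylY k_inv lambda hw ra.
  have [_ _ _ h4] := hC b hb; rewrite /z eb cabsN cabsV; split.
    by case: (hreg b hb).
  have z0 : 0 < cabs (cpair b lambda) by rewrite cabs_gt0; case: (hreg b hb).
  by rewrite -div1r ler_pdivrMr.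
have zs w : weylY D w -> z (sC a \o w) = - z w.
  move=> hw; rewrite /z /cpair /= /sC hatC_hcoroot.
  rewrite -[in LHS](hform_hrefl (hatC a)) hreflK.
  have aa : hform (hatC a) (hatC a) != 0.
    rewrite hform_hatC (hform_Rhat ra ra); apply/eqP => /(@toC_inj R _ 0)/eqP; apply/negP.
    by have /RhatP[n [h _]] := ra; exact: Phi_dot_neq0 h.
  by rewrite /hcoroot hreflZ hrefl_self// scalerN hformNl.
have Vs : Vplus (hrefl a v) by rewrite hrefl_coroot; exact: Vplus_coroot.
apply/matrixP => i j.
pose Cw w := JMw w lambda i j; pose Cz w := - (z w)^-1 * Cw w.
have gC : good (weylY D) (fun w => w lambda) Cw.
  exact: (good_weylY k_inv J_cocycle pi_module i j hl).
have gz : good (weylY D) (fun w => w lambda) Cz.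
  apply: (good_mul (ltW C0)) gC => w hw; have [_ h] := hz w hw.
  by apply: le_trans h _; rewrite ler_peMr ?(ltW C0)// lerDl hn_ge0.
pose T w := E_term D pi J v lambda w i j; pose Tk w := (k a / z w) * T w.
have hT : hasS (weylY D) T (E v i j) := hasM_E_Mplus k_inv J_cocycle pi_module hl Vv i j.
have hTk : hasS (weylY D) Tk (csum (weylY D) Tk).
  apply: absS_csum; apply: absS_le (absSZ (c := cabs (k a) * C) _ (absS_E_weylY k_inv J_cocycle pi_module hl Vv)) => [w hw|].
    have [_] := hz w hw; rewrite cabsN => h; rewrite /Tk cabsM cabsM.
    apply: ler_pM; rewrite ?mulr_ge0 ?cabs_ge0//; last exact: cabs_le_mn.
    by rewrite ler_wpM2l ?cabs_ge0.
  by rewrite mulr_ge0 ?cabs_ge0// ltW.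
(* The inverse of [z] being bounded on the orbit, [Tk] is summable by itself. Reindexing [T + Tk] by
   left multiplication with [sC a] and subtracting [Tk] leaves the sum of [T], so only an identity
   between summands remains. *)
have hU := hasSB (hasS_reindex (weylY_lshift_bij hs) (hasSD hT hTk)) hTk.
rewrite addrK in hU.
have h1 := hasM_mull (pi (sC a)) (hasM_E_Mplus k_inv J_cocycle pi_module hl Vs) i j.
have h2 := hasSZ (k a) (hasSB (dseries_hasS gz Vs) (dseries_hasS gz Vv)).
apply: hasS_uniq hU.
have -> : Q_refl k pi a E v i j = (pi (sC a) *m E (hrefl a v)) i j -
    k a * (dseries (weylY D) (fun w => w lambda) Cz (hrefl a v) -
           dseries (weylY D) (fun w => w lambda) Cz v).
  have sub (M N : 'M[R[i]]_m) (c : R[i]) : (M - c *: N) i j = M i j - c * N i j by rewrite !mxE.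
  rewrite /Q_refl sub; congr (_ - _ * _); rewrite /Iint mxE.
  rewrite (cint0_dseries (f := fun x => E x i j) ra Vv gC (fun x => @E_Mplus_dseries i j x) _ (ltW C0)).
  - by rewrite -hrefl_coroot.
  - by move=> w /hz[].
  - by move=> w /hz[].
apply: hasS_ext (hasSB h1 h2) => w hw /=.
have [z0 _] := hz w hw.
have zk : z w - k a != 0.
  by rewrite subr_eq0; case: (hreg_weylY k_inv hw hreg ra).
have e1 : hform ((sC a \o w) lambda) (hatC v) = hform (w lambda) (hatC (hrefl a v)).
  by rewrite hatC_hrefl -[in RHS](hform_hrefl (hatC a)) /sC hreflK.
have e2 : JMw (sC a \o w) lambda i j = (pi (sC a) *m JMw w lambda) i j +
   (k a / (z w - k a)) * ((pi (sC a) *m JMw w lambda) i j + Cw w).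
  rewrite (JM_mul k_inv J_cocycle pi_module hs hw hreg).
  rewrite (JM_refl J_cocycle pi_module ha (hreg_weylY k_inv hw hreg)).
  have add (M N : 'M[R[i]]_m) (c : R[i]) : (M + c *: N) i j = M i j + c * N i j by rewrite !mxE.
  rewrite mulmxDl -scalemxAl mulmxDl mul1mx add; congr (_ + _ * _).
  by rewrite -[X in _ + X]scale1r add mul1r.
have sc (M : 'M[R[i]]_m) (c : R[i]) : (c *: M) i j = c * M i j by rewrite mxE.
rewrite /Tk /T zs// /E_term -scalemxAr !sc e1 e2 /dterm /Cz -/(Cw w).
set e := cexp _; set e' := cexp _; set P := fun_of_matrix _ _ _.
(* [x] and [y] are the exponentials at the reflected and at the original point, [p] and [c] the
   entries of [pi (sC a) *m JMw w lambda] and of [JMw w lambda]. *)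
have fin (zz kk c p x y : R[i]) : zz != 0 -> zz - kk != 0 ->
    x * p - kk * (- zz^-1 * c * x - - zz^-1 * c * y) =
    x * (p + kk / (zz - kk) * (p + c)) + kk / - zz * (x * (p + kk / (zz - kk) * (p + c))) -
    kk / zz * (y * c).
  by move=> nz nk; field; rewrite nz nk.
exact: fin.
Qed.

(** Invariance is available on [Vplus], so the induction needs the generators to evaluate their
    argument there: coroots have no d-component, and the group preserves the d-coordinate. *)
Lemma Qhat_E w Q : Qhat D k pi w Q -> forall v, Vplus v -> Q E v = E v.
Proof.
elim=> [//|a {}w {}Q ha _ IH|o o' {}w {}Q ho c1 c2 _ IH] v Vv /=.
  have ra := Fhat_Rhat ha; rewrite -[RHS](Q_refl_E ha Vv) /Q_refl.
  have Vs : Vplus (hrefl a v) by rewrite hrefl_coroot; exact: Vplus_coroot.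
  rewrite (IH _ Vs); congr (_ - _ *: _); apply/matrixP => i j; rewrite !mxE.
  congr cint0; apply/funext => t; rewrite IH//; exact: Vplus_coroot.
rewrite -[RHS](Q_omega_E ho c1 c2 Vv) /Q_omega IH//.
have hW : weylY D o by case: ho.
have [u [hu d1 d2]] := weylY_inv hW.
have eu : o' = u by apply/funext => x; rewrite -[x in LHS]d2 c1.
rewrite -eu in hu; have rg := rigid_weylY hu.
have e2 : (hatRe (o' (hatC v))).2 = v.2.
  by apply: toC_inj; rewrite -[LHS]/((hatC (hatRe (o' (hatC v)))).2) -(rigid_real rg) (rigid_d rg).
by move: Vv; rewrite /Vplus /mkset -e2.
Qed.

End RealSide.

Theorem theorem3p6 (R : realType) (r : nat) (D : affine_datum R r)
  (k : hat R r -> R[i])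
  (k_inv : weylY_invariant D k)
  (J : hatmap R r -> hat R[i] r -> galg R r)
  (J_cocycle : is_cocycle D k J)
  (m : nat)
  (pi : hatmap R r -> 'M[R[i]]_m)
  (pi_module : is_module D pi)
  (pi_unitarizable : unitarizable D pi) :
  (forall (v : hat R r) (lambda : hat R[i] r),
     Vplus v -> hreg_plus D k lambda ->
     [/\ E_M_summable D pi J v lambda,
         E_Mplus_summable D pi J v lambda &
         E_Mplus D pi J v lambda =
           \sum_(w \in weyl D) E_M D pi J v (w lambda) *m JM D pi J w lambda])
  /\
  (forall (kappa : R[i]) (lambda : hat R[i] r),
     0 < complex.Re kappa -> hreg_kappa D k kappa lambda ->
     tensor_End (Comega_kappa kappa) (fun v => E_M D pi J v lambda) /\
     Shat_invariants D k pi kappa (hform lambda lambda)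
       (fun v => E_Mplus D pi J v lambda))
  /\
  (forall (xi : R) (v : hat R r),
     0 < xi -> v.2 = xi ->
     adKZ D k pi J (toC xi) (E_M D pi J v) /\
     adKZ_weyl D k pi J (toC xi) (E_Mplus D pi J v)).
Proof.
split; [|split].
- move=> v lambda Vv hl; split.
  + by have [] := hasM_usum (hasM_E_M k_inv J_cocycle pi_module hl Vv).
  + by have [] := hasM_usum (hasM_E_Mplus k_inv J_cocycle pi_module hl Vv).
  + exact: (E_Mplus_decomposition k_inv J_cocycle pi_module hl Vv).
- move=> kappa lambda kappa0 [hreg lk].
  have hl : hreg_plus D k lambda by split; rewrite // lk.
  split=> [i j|].
    apply: (dseries_Comega_kappa (good_Y k_inv J_cocycle pi_module i j hl)).
      by move=> x Vx; exact: (E_M_dseries k_inv J_cocycle pi_module hl).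
    by move=> y _; rewrite -lk.
  split=> [i j|w Q hQ v Vv]; last exact: Qhat_E hQ v Vv.
  apply: (dseries_Shat (good_weylY k_inv J_cocycle pi_module i j hl)).
  + by move=> x Vx; exact: (E_Mplus_dseries k_inv J_cocycle pi_module hl).
  + by move=> w hw; rewrite (rigid_d (rigid_weylY hw)).
  + by move=> w hw; rewrite (rigid_form (rigid_weylY hw)).
- move=> xi v xi0 vxi; have Vv : Vplus v by rewrite /Vplus /mkset vxi.
  rewrite -vxi.
  split; [split|split; [split|]].
  + exact: (E_M_O_xi k_inv J_cocycle pi_module Vv).
  + by move=> y lambda hy hl; exact: (E_M_invariant k_inv J_cocycle pi_module Vv hy hl).
  + exact: (E_Mplus_O_xi k_inv J_cocycle pi_module Vv).
  + by move=> y lambda /weylY_tC hy hl; exact: (E_Mplus_invariant k_inv J_cocycle pi_module Vv hy hl).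
  + by move=> w lambda /weylY_weyl hw hl; exact: (E_Mplus_invariant k_inv J_cocycle pi_module Vv hw hl).
Qed.
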